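(* Let $(X,\bar 0)\subset(\mathbb{C}^3,\bar 0)$ be a surface germ and let $\pi:\mathbb{C}^3\to\mathbb{C}^2$ be a linear projection with $\pi|_{(X,\bar 0)}$ finite. If the generic arc gives an irreducible arc-section, then either the tangent cone $C_{X,\bar 0}\subset\mathbb{CP}^2$ is a line (with certain multiplicity), or $C_{X,\bar 0}$ is a union of lines and we are projecting from the singular point of $C_{X,\bar 0}$ (that is, the lines all pass through a common point and the projection direction $p_\pi$ is that point).
   Context: Finiteness of $\pi|_{(X,\bar 0)}$ means $\pi^{-1}(\bar 0)\cap X=\{\bar 0\}$ as germs. $C_{X,\bar 0}\subset\mathbb{CP}^2$ is the projectivized tangent cone; $p_\pi\in\mathbb{CP}^2$ is the point given by $\ker\pi$. After a linear change of coordinates $\pi(x_1,x_2,x_3)=(x_1,x_2)$ and $X=\{F=0\}$ with $F$ a reduced Weierstrass polynomial in $x_3$; the discriminant $\Delta\subset(\mathbb{C}^2,\bar 0)$ of $\pi|_X$ is the zero set of the discriminant of $F$ with respect to $x_3$. An arc is a holomorphic map germ $\alpha:(\mathbb{C},0)\to(\mathbb{C}^2,\bar 0)$; it is smooth if $\alpha'(0)\ne\bar 0$. A generic arc is a smooth arc not tangent to $\Delta$, i.e. whose tangent line at $\bar 0$ is not in the tangent cone of $\Delta$ at $\bar 0$. (All generic arcs for a given $\pi$ have the same associated monodromy, so either all of them or none of them give irreducible arc-sections.) The arc-section over such $\alpha$ is $\pi^{-1}(\alpha(\mathbb{D}))\cap X$ with $\alpha:\mathbb{D}\to\mathbb{C}^2$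 an injective representative on a closed disk small enough that $\alpha(\mathbb{D})\cap\Delta=\{\bar 0\}$; it is irreducible if its germ at $\bar 0$ is irreducible. *)

(* Defs.v *)
(* The definitions make sense over any numFieldType K; they are used with
   K = R[i] for R : realType.  Points of K^n are row vectors, and a germ at the
   origin is given by a function or a set on the whole space of which only the
   restriction to small neighbourhoods of 0 matters. *)
From HB Require Import structures.
From mathcomp Require Import all_boot all_order all_algebra.
From mathcomp Require Import all_classical all_reals all_analysis.
From mathcomp Require Export complex.

Set Implicit Arguments.
Unset Strict Implicit.
Unset Printing Implicit Defensive.

Import Order.TTheory GRing.Theory Num.Theory.
Import numFieldNormedType.Exports.

Local Open Scope classical_set_scope.
Local Open Scope ring_scope.

Section Germs.
Variable K : numFieldType.

Section AnyDimension.
Variable n : nat.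

Definition multi_index := {ffun 'I_n -> nat}.

Definition weight (k : multi_index) : nat := \sum_i k i.

Definition monomial (k : multi_index) (x : 'rV[K]_n) : K :=
  \prod_i x 0 i ^+ k i.

Definition index_of_box (N : nat) (k : {ffun 'I_n -> 'I_N}) : multi_index :=
  [ffun i => k i : nat].

(* The bound makes the series converge absolutely on the open polydisc of
   radius r, so that summing over the boxes [0, N)^n is only a choice of an
   order of summation. *)
Definition has_expansion (r : K) (a : multi_index -> K) (f : 'rV[K]_n -> K) :=
  (exists M : K, forall k, `|a k| * r ^+ weight k <= M) /\
  (forall x : 'rV[K]_n, (forall i, `|x 0 i| < r) ->
     (fun N : nat => \sum_(k : {ffun 'I_n -> 'I_N})
        a (index_of_box k) * monomial (index_of_box k) x) @ \oo --> f x).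

Definition analytic_on_polydisc (r : K) (f : 'rV[K]_n -> K) :=
  exists a, has_expansion r a f.

(* Holomorphic germs at the origin, as sums of convergent power series. *)
Definition analytic_germ (f : 'rV[K]_n -> K) :=
  exists2 r : K, 0 < r & analytic_on_polydisc r f.

(* The form H is the nonzero homogeneous part of lowest degree, m, of f. *)
Definition initial_form (f : 'rV[K]_n -> K) (m : nat) (H : 'rV[K]_n -> K) :=
  exists r : K, exists a : multi_index -> K,
    [/\ 0 < r, has_expansion r a f,
        forall k, (weight k < m)%N -> a k = 0,
        exists k, weight k = m /\ a k != 0
      & forall v, H v =
          \sum_(k : {ffun 'I_n -> 'I_m.+1} | weight (index_of_box k) == m)
            a (index_of_box k) * monomial (index_of_box k) v].

Definition vanishes_on (S : set 'rV[K]_n) (g : 'rV[K]_n -> K) :=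
  \forall x \near (0 : 'rV[K]_n), S x -> g x = 0.

(* The affine tangent cone at 0 of the germ of S: the common zeros of the
   initial forms of the elements of the ideal I(S) of the germ. *)
Definition tangent_cone (S : set 'rV[K]_n) : set 'rV[K]_n :=
  [set v | forall g m H, analytic_germ g -> vanishes_on S g ->
             initial_form g m H -> H v = 0].

Definition divides_germ (f g : 'rV[K]_n -> K) :=
  exists2 q, analytic_germ q & \forall x \near (0 : 'rV[K]_n), g x = f x * q x.

(* S = {f = 0} is a hypersurface germ and f is a reduced equation of it: f
   generates the ideal I(S) in the ring of holomorphic germs. *)
Definition reduced_equation (S : set 'rV[K]_n) (f : 'rV[K]_n -> K) :=
  [/\ analytic_germ f,
      ~ (\forall x \near (0 : 'rV[K]_n), f x = 0),
      \forall x \near (0 : 'rV[K]_n), S x <-> f x = 0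
    & forall g, analytic_germ g -> vanishes_on S g -> divides_germ f g].

(* As I(S) is generated by f, the tangent cone with its multiplicities is the
   hypersurface H = 0, where H is the initial form of f. *)
Definition tangent_cone_equation (S : set 'rV[K]_n) (m : nat)
    (H : 'rV[K]_n -> K) :=
  exists2 f, reduced_equation S f & initial_form f m H.

Definition analytic_set_germ (Y : set 'rV[K]_n) :=
  exists p (g : 'I_p -> 'rV[K]_n -> K), (forall j, analytic_germ (g j)) /\
    \forall x \near (0 : 'rV[K]_n), Y x <-> forall j, g j x = 0.

Definition same_germ (S T : set 'rV[K]_n) :=
  \forall x \near (0 : 'rV[K]_n), S x <-> T x.

Definition irreducible_germ (S : set 'rV[K]_n) :=
  S 0 /\
  forall Y1 Y2, analytic_set_germ Y1 -> analytic_set_germ Y2 ->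
    same_germ S (Y1 `|` Y2) -> same_germ S Y1 \/ same_germ S Y2.

End AnyDimension.

(* Surface germs in a space of dimension 3: the germs of pure dimension 2 are
   the hypersurface germs. *)
Definition surface_germ (X : set 'rV[K]_3) :=
  X 0 /\ exists f, reduced_equation X f.

(* A linear map pi : K^3 -> K^2 is given by its matrix P, pi x = x *m P. *)
Definition finite_projection (X : set 'rV[K]_3) (P : 'M[K]_(3, 2)) :=
  \forall x \near (0 : 'rV[K]_3), X x -> x *m P = 0 -> x = 0.

(* A function y |-> F y into polynomials in x3 stands for a polynomial in x3
   with coefficients in the holomorphic germs in y = (x1, x2). *)
Definition weierstrass_polynomial (n : nat) (F : 'rV[K]_2 -> {poly K}) :=
  [/\ forall y, F y \is monic,
      forall y, size (F y) = n.+1,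
      forall i, analytic_germ (fun y => (F y)`_i)
    & forall i, (i < n)%N -> (F 0)`_i = 0].

(* For a monic polynomial. *)
Definition discriminant (p : {poly K}) : K :=
  (-1) ^+ 'C((size p).-1, 2) * resultant p p^`().

(* D represents the discriminant germ of the restriction of pi to X.  The
   linear form l is a third coordinate: (x *m P, x *m l) = (x1, x2, x3) are
   linear coordinates in which pi (x1, x2, x3) = (x1, x2). *)
Definition is_discriminant (X : set 'rV[K]_3) (P : 'M[K]_(3, 2))
    (D : set 'rV[K]_2) :=
  exists (l : 'cV[K]_3) (n : nat) (F : 'rV[K]_2 -> {poly K}),
    [/\ \rank (row_mx P l) = 3%N,
        weierstrass_polynomial n F,
        reduced_equation X (fun x => (F (x *m P)).[(x *m l) 0 0])
      & \forall y \near (0 : 'rV[K]_2), D y <-> discriminant (F y) = 0].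

(* alpha is defined by convergent power series on the disk |t| < r. *)
Definition holomorphic_arc (r : K) (alpha : K -> 'rV[K]_2) :=
  alpha 0 = 0 /\
  forall i, analytic_on_polydisc r (fun t : 'rV[K]_1 => alpha (t 0 0) 0 i).

(* A smooth arc whose tangent line is not in the tangent cone of D. *)
Definition generic_arc (D : set 'rV[K]_2) (alpha : K -> 'rV[K]_2) :=
  [/\ exists2 r : K, 0 < r & holomorphic_arc r alpha,
      derive1 alpha 0 != 0
    & ~ tangent_cone D (derive1 alpha 0)].

(* On the closed disk of radius rho, alpha is an injective representative of
   the arc which meets D at the origin only.  (D does not contain
   the origin when X is the graph of a function over K^2; hence an inclusion
   instead of an equality.) *)
Definition small_disk (D : set 'rV[K]_2) (alpha : K -> 'rV[K]_2) (rho : K) :=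
  [/\ 0 < rho,
      exists2 r : K, rho < r & holomorphic_arc r alpha,
      forall s t, `|s| <= rho -> `|t| <= rho -> alpha s = alpha t -> s = t
    & forall t, `|t| <= rho -> D (alpha t) -> alpha t = 0].

Definition arc_section (X : set 'rV[K]_3) (P : 'M[K]_(3, 2))
    (alpha : K -> 'rV[K]_2) (rho : K) : set 'rV[K]_3 :=
  [set x | X x /\ exists2 t : K, `|t| <= rho & alpha t = x *m P].

Definition generic_arc_section_irreducible (X : set 'rV[K]_3)
    (P : 'M[K]_(3, 2)) (D : set 'rV[K]_2) :=
  forall alpha rho, generic_arc D alpha -> small_disk D alpha rho ->
    irreducible_germ (arc_section X P alpha rho).

(* Plane projective curves with multiplicities are given by an equation H of
   degree m, and lines by a nonzero linear form v |-> v *m l. *)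
Definition multiple_line (m : nat) (H : 'rV[K]_3 -> K) :=
  exists (c : K) (l : 'cV[K]_3),
    [/\ c != 0, l != 0 & forall v, H v = c * (v *m l) 0 0 ^+ m].

(* The curve H = 0 is a union of lines (with multiplicities) whose only common
   point is the point of the projective plane given by the kernel of P. *)
Definition lines_through_center (P : 'M[K]_(3, 2)) (m : nat)
    (H : 'rV[K]_3 -> K) :=
  exists (c : K) (l : 'I_m -> 'cV[K]_3),
    [/\ c != 0, forall i, l i != 0,
        forall v, H v = c * \prod_(i < m) (v *m l i) 0 0
      & forall p : 'rV[K]_3, (forall i, p *m l i = 0) <-> p *m P = 0].

End Germs.

(* Main.v *)
(* Let f(x) = F(x *m P).[x *m l] with F a reduced Weierstrass polynomial of degree
   n in z, and let H be its initial form, of degree m.  Since F is reduced, its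
   discriminant is not the zero germ, so for all but finitely many s the arc
   t |-> t (1, s) is generic.  Over such an arc f becomes a Weierstrass polynomial
   in z over the convergent power series in t, whose initial form is
   H(t (1, s), z).  Put z = t w: if H((1, s), w) has a root of multiplicity k with
   0 < k < n, Hensel's lemma factors t^-m F(t (1, s))(t w), and the arc-section
   is a union of two analytic germs, both proper because F(t (1, s)) has n
   distinct roots for t <> 0.  Hence H((1, s), w) is either constant in w or
   c (w - lambda(s))^m.  In the second case lambda(s) is, up to a constant, the
   coefficient of w^(m-1), hence affine in s, and H is the m-th power of a linear
   form.  In the first case H does not depend on z: it is a binary form in the
   coordinates of x *m P, a product of m linear forms vanishing on the kernel
   of P. *)
Require Import Defs.
From mathcomp Require Import all_boot all_order all_algebra.
From mathcomp Require Import all_classical all_reals all_analysis.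
From mathcomp Require Import separable.
From mathcomp Require Import ring lra zify.
Set Implicit Arguments.
Unset Strict Implicit.
Unset Printing Implicit Defensive.
Import Order.TTheory GRing.Theory Num.Theory.
Import numFieldNormedType.Exports.
Local Open Scope classical_set_scope.
Local Open Scope ring_scope.
Local Open Scope complex_scope.

(** The tangent cone may come from any reduced equation; two of them differ by a unit, which only
    multiplies the initial form by a constant, so the Weierstrass equation can be used. Power series
    carry explicit geometric bounds on terms and remainders, so that closure properties, uniqueness
    of leading terms and convergence of the Hensel factors become inequalities. Reducedness is a
    statement on germs in three variables, whereas the discriminant concerns the polynomials [F y].
    The link is a bound |B| <= C |F| on a disc containing the roots of [F y]: it turns divisibility
    of germs into divisibility of polynomials for each small y. A root of multiplicity k >= n is
    harmless: H((1, s), w) has degree at most m in w, and m <= n because z^n occurs in F, so k = m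
    and the cofactor is constant. The alternative is obtained for each s separately, but it is the
    same for all s: the coefficient of w^i in H((1, s), w) has degree at most m - i in s, so that of
    w^m is a constant, and whether it is 0 decides. Identities between these coefficients, known off
    finitely many s, hold for all s. *)

Section AbstractField.
Variable K : numFieldType.

Definition near0 n (P : 'rV[K]_n -> Prop) := \forall x \near (0 : 'rV[K]_n), P x.

Definition seq_cvg (u : nat -> K) (l : K) := u @ \oo --> l.

Lemma near0_norm n (P : 'rV[K]_n -> Prop) :
  near0 P <->
  (exists2 e : K, 0 < e & forall x : 'rV[K]_n, (forall i, `|x 0 i| < e) -> P x).
Proof.
split.
- move=> /nbhs_ballP[e /= e0 h]; exists e => // x hx.
  apply: h; split=> // i j.
  by rewrite /ball /= !ord1 mxE sub0r normrN.
- move=> [e e0 h]; apply/nbhs_ballP; exists e => //.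
  move=> x [_ hx]; apply: h => i; have := hx 0 i.
  by rewrite /ball /= mxE sub0r normrN.
Qed.

Lemma seq_cvg_norm (u : nat -> K) (l : K) :
  seq_cvg u l <->
  (forall e : K, 0 < e -> exists N, forall k, (N <= k)%N -> `|l - u k| <= e).
Proof.
split.
- move=> /cvgrPdist_le h e /h[N _ hN]; by exists N => k /hN.
- move=> h; apply/cvgrPdist_le => e /h[N hN].
  by exists N => // k /hN.
Qed.

Lemma derive1_line n (v : 'rV[K]_n) : derive1 (fun t : K => t *: v) 0 = v.
Proof.
rewrite derive1E; apply: cvg_lim => //.
apply: cvg_near_cst; apply/nbhs_ballP; exists 1 => //= h _ h0.
rewrite /= addr0 scale0r subr0.
have -> : h%:A = h :> K by rewrite /GRing.scale /= mulr1.
by rewrite scalerA mulVf // scale1r.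
Qed.

End AbstractField.

(** * The real-valued modulus and neighbourhoods of the origin *)

Section Modulus.
Variable R : realType.
Notation K := R[i].

(* The modulus as an element of the ordered field R; the norm `|x| of K = R[i]
   takes its values in K, which is only partially ordered. *)
Definition nm (x : K) : R := ComplexField.Normc.normc x.

Lemma norm_nm (x : K) : `|x| = (nm x)%:C.
Proof. by []. Qed.

Lemma nm_ge0 x : 0 <= nm x.
Proof. by rewrite -ler0c -norm_nm. Qed.

Lemma nm0 : nm 0 = 0.
Proof. exact: ComplexField.Normc.normc0. Qed.

Lemma nm1 : nm 1 = 1.
Proof. exact: ComplexField.Normc.normc1. Qed.

Lemma nm_eq0 x : (nm x == 0) = (x == 0).
Proof.
apply/eqP/eqP => [|->]; last exact: nm0.
exact: ComplexField.Normc.eq0_normc.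
Qed.

Lemma nm_gt0 x : (0 < nm x) = (x != 0).
Proof. by rewrite lt_def nm_ge0 andbT nm_eq0. Qed.

Lemma nmM x y : nm (x * y) = nm x * nm y.
Proof. exact: ComplexField.Normc.normcM. Qed.

Lemma nmX x n : nm (x ^+ n) = nm x ^+ n.
Proof. by elim: n => [|n IH]; rewrite ?expr0 ?nm1 // !exprS nmM IH. Qed.

Lemma nmN x : nm (- x) = nm x.
Proof. by apply: complexI; rewrite -!norm_nm normrN. Qed.

Lemma nmD x y : nm (x + y) <= nm x + nm y.
Proof. by rewrite -lecR rmorphD /= -!norm_nm ler_normD. Qed.

Lemma nm_sum (I : Type) (r : seq I) (P : pred I) (F : I -> K) :
  nm (\sum_(i <- r | P i) F i) <= \sum_(i <- r | P i) nm (F i).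
Proof.
elim/big_rec2: _ => [|i y x _ h]; first by rewrite nm0.
by apply: le_trans (nmD _ _) _; rewrite lerD2l.
Qed.

Lemma nm_real (x : R) : 0 <= x -> nm x%:C = x.
Proof. by move=> x0; apply: complexI; rewrite -norm_nm ger0_norm // ler0c. Qed.

Lemma gt0_real (e : K) : 0 < e -> exists2 r : R, 0 < r & e = r%:C.
Proof.
move=> e0; exists (nm e); first by rewrite nm_gt0 gt_eqF.
by rewrite -norm_nm gtr0_norm.
Qed.

Lemma nm_Re (x : K) : `|complex.Re x| <= nm x.
Proof. by rewrite -lecR -norm_nm normc_ge_Re. Qed.

Lemma nm_Im (x : K) : `|complex.Im x| <= nm x.
Proof.
rewrite /nm; case: x => a b /=; rewrite -sqrtr_sqr; apply: ler_wsqrtr.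
by rewrite lerDr sqr_ge0.
Qed.

Lemma nm_le_ReIm (x : K) : nm x <= `|complex.Re x| + `|complex.Im x|.
Proof.
rewrite {1}[x]complexE; apply: le_trans (nmD _ _) _; rewrite nmM.
have -> : nm 'i%C = 1.
  by rewrite /nm /= expr0n /= add0r expr1n sqrtr1.
have nmC y : nm y%:C = `|y|.
  by rewrite /nm /= expr0n /= addr0 sqrtr_sqr.
by rewrite mul1r !nmC.
Qed.

Definition bounded_by n (x : 'rV[K]_n) (s : R) := forall i, nm (x 0 i) <= s.

Lemma near0P n (P : 'rV[K]_n -> Prop) :
  near0 P <->
  (exists2 e : R, 0 < e & forall x : 'rV[K]_n, (forall i, nm (x 0 i) < e) -> P x).
Proof.
rewrite near0_norm; split.
- move=> [e /gt0_real[r r0 ->] h]; exists r => // x hx.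
  by apply: h => i; rewrite norm_nm ltcR.
- move=> [e e0 h]; exists e%:C; first by rewrite ltcR.
  by move=> x hx; apply: h => i; rewrite -ltcR -norm_nm.
Qed.

Lemma near0_le n (P : 'rV[K]_n -> Prop) :
  near0 P <-> (exists2 e : R, 0 < e & forall x, bounded_by x e -> P x).
Proof.
rewrite near0P; split => -[e e0 h].
  exists (e / 2); first by rewrite divr_gt0.
  move=> x hx; apply: h => i; apply: le_lt_trans (hx i) _.
  by rewrite ltr_pdivrMr // ltr_pMr // ltr1n.
by exists e => // x hx; apply: h => i; apply: ltW; apply: hx.
Qed.

Lemma cvg_nm (u : nat -> K) (l : K) :
  seq_cvg u l <->
  (forall e : R, 0 < e -> exists N, forall k, (N <= k)%N -> nm (l - u k) <= e).
Proof.
rewrite seq_cvg_norm; split.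
- move=> h e e0; have /h[N hN] : 0 < e%:C :> K by rewrite ltcR.
  by exists N => k /hN; rewrite norm_nm lecR.
- move=> h e /gt0_real[r /h[N hN] ->].
  by exists N => // k /hN; rewrite norm_nm lecR.
Qed.

End Modulus.

(** * Homogeneous forms *)

Section Forms.
Variable R : realType.
Notation K := R[i].

(* p is a form of degree j, written recursively as \sum_i x_i q_i with forms q_i
   of degree j - 1, and C bounds the sum of the moduli of the coefficients of its
   expansion into words in the x_i.  Products and linear substitutions become
   inductions on j, with submultiplicative bounds. *)
Fixpoint hform n (j : nat) (C : R) (p : 'rV[K]_n -> K) : Prop :=
  if j is j'.+1 then
    exists (c : 'I_n -> R) (q : 'I_n -> 'rV[K]_n -> K),
      [/\ forall i, hform j' (c i) (q i), \sum_i c i <= C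
        & forall x, p x = \sum_i x 0 i * q i x]
  else exists a : K, nm a <= C /\ forall x, p x = a.

Section Closure.
Variable n : nat.
Implicit Types (p q : 'rV[K]_n -> K) (x e : 'rV[K]_n).

Lemma hform_ge0 j C p : hform j C p -> 0 <= C.
Proof.
elim: j C p => [|j IH] C p /=.
  by move=> [a [h _]]; apply: le_trans (nm_ge0 _) h.
move=> [c [q [h hC _]]]; apply: le_trans hC.
by apply: sumr_ge0 => i _; apply: IH (h i).
Qed.

Lemma hform_le j C D p : hform j C p -> C <= D -> hform j D p.
Proof.
case: j => [|j] /=; first by move=> [a [h ?]] hD; exists a; split=> //; apply: le_trans hD.
by move=> [c [q [h hC ?]]] hD; exists c, q; split=> //; apply: le_trans hD.
Qed.

Lemma hform_ext j C p q : hform j C p -> p =1 q -> hform j C q.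
Proof.
case: j => [|j] /= => [[a [h e]]|[c [r [h hC e]]]] epq.
  by exists a; split=> // x; rewrite -epq.
by exists c, r; split=> // x; rewrite -epq.
Qed.

Lemma hform0 j : hform j 0 (fun=> 0 : K) (n := n).
Proof.
elim: j => [|j IH] /=; first by exists 0; rewrite nm0.
exists (fun=> 0), (fun _ _ => 0); split=> //; first by rewrite big1.
by move=> x; rewrite big1 // => i _; rewrite mulr0.
Qed.

Lemma hformD j C D p q :
  hform j C p -> hform j D q -> hform j (C + D) (fun x => p x + q x).
Proof.
elim: j C D p q => [|j IH] C D p q /=.
  move=> [a [ha ea]] [b [hb eb]]; exists (a + b); split.
    by apply: le_trans (nmD _ _) _; apply: lerD.
  by move=> x; rewrite ea eb.
move=> [c [r [hr hC er]]] [d [s [hs hD es]]].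
exists (fun i => c i + d i), (fun i x => r i x + s i x); split.
- by move=> i; apply: IH.
- by rewrite big_split lerD.
- by move=> x; rewrite er es -big_split; apply: eq_bigr => i _; rewrite mulrDr.
Qed.

Lemma hformZ j C p (a : K) : hform j C p -> hform j (nm a * C) (fun x => a * p x).
Proof.
elim: j C p => [|j IH] C p /=.
  move=> [b [hb eb]]; exists (a * b); split; last by move=> x; rewrite eb.
  by rewrite nmM ler_wpM2l // nm_ge0.
move=> [c [r [hr hC er]]].
exists (fun i => nm a * c i), (fun i x => a * r i x); split.
- by move=> i; apply: IH.
- by rewrite -mulr_sumr ler_wpM2l // nm_ge0.
- by move=> x; rewrite er mulr_sumr; apply: eq_bigr => i _; rewrite mulrCA.
Qed.

Lemma hform_sum j (I : Type) (r : seq I) (P : pred I) (C : I -> R)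
    (p : I -> 'rV[K]_n -> K) :
  (forall i, P i -> hform j (C i) (p i)) ->
  hform j (\sum_(i <- r | P i) C i) (fun x => \sum_(i <- r | P i) p i x).
Proof.
move=> h; elim: r => [|i r IH].
  by rewrite big_nil; apply: hform_ext (hform0 j) _ => x; rewrite big_nil.
rewrite big_cons; case: ifP => Pi.
  by apply: hform_ext (hformD (h i Pi) IH) _ => x; rewrite big_cons Pi.
by apply: hform_ext IH _ => x; rewrite big_cons Pi.
Qed.

Lemma hformM i j C D p q :
  hform i C p -> hform j D q -> hform (i + j) (C * D) (fun x => p x * q x).
Proof.
move=> + hq; have D0 := hform_ge0 hq; elim: i C p => [|i IH] C p /=.
  move=> [a [ha ea]]; rewrite add0n.
  by apply: hform_le (hform_ext (hformZ a hq) _) _ => [x|]; rewrite ?ea // ler_wpM2r.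
move=> [c [r [hr hC er]]].
exists (fun i => c i * D), (fun i x => r i x * q x); split.
- by move=> k; apply: IH.
- by rewrite -mulr_suml ler_wpM2r.
- by move=> x; rewrite er mulr_suml; apply: eq_bigr => k _; rewrite mulrA.
Qed.

Lemma hform_coord i : hform 1 1 (fun x : 'rV[K]_n => x 0 i).
Proof.
exists (fun k => (k == i)%:R), (fun k _ => (k == i)%:R); split.
- move=> k; exists (k == i)%:R; split=> //.
  by case: eqP => _; rewrite ?nm1 ?nm0.
- by rewrite (bigD1 i) //= eqxx big1 ?addr0 // => k /negPf ->.
- by move=> x; rewrite (bigD1 i) //= eqxx mulr1 big1 ?addr0 // => k /negPf ->; rewrite mulr0.
Qed.

Lemma hformX j C p k : hform j C p -> hform (k * j) (C ^+ k) (fun x => p x ^+ k).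
Proof.
move=> h; elim: k => [|k IH].
  by exists 1; rewrite nm1 expr0.
rewrite mulSn exprS; apply: hform_ext (hformM h IH) _ => x.
by rewrite exprS.
Qed.

Lemma hform_le_bound j C p x s :
  hform j C p -> 0 <= s -> bounded_by x s -> nm (p x) <= C * s ^+ j.
Proof.
move=> + s0 hx; elim: j C p => [|j IH] C p /=.
  by move=> [a [ha ->]]; rewrite mulr1.
move=> [c [r [hr hC ->]]].
apply: le_trans (nm_sum _ _ _) _.
apply: (@le_trans _ _ (\sum_i s * (c i * s ^+ j))).
  apply: ler_sum => i _; rewrite nmM; apply: ler_pM => //; try exact: nm_ge0.
  exact: IH.
by rewrite -mulr_sumr -mulr_suml mulrCA -exprS ler_wpM2r // exprn_ge0.
Qed.

Lemma hform_homog j C p t x : hform j C p -> p (t *: x) = t ^+ j * p x.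
Proof.
elim: j C p => [|j IH] C p /=; first by move=> [a [_ h]]; rewrite !h mul1r.
move=> [c [r [hr hC e]]]; rewrite !e mulr_sumr; apply: eq_bigr => i _.
by rewrite (IH _ _ (hr i)) mxE exprS; ring.
Qed.

Lemma hform_line j C p x e : hform j C p ->
  exists q : {poly K}, forall s, p (x + s *: e) = q.[s].
Proof.
elim: j C p => [|j IH] C p /=.
  by move=> [a [_ h]]; exists a%:P => s; rewrite hornerC.
move=> [c [r [hr _ ep]]].
have /choice[q hq] : forall i, exists q : {poly K},
    forall s, r i (x + s *: e) = q.[s] by move=> i; apply: IH (hr i).
exists (\sum_i ((x 0 i)%:P + (e 0 i)%:P * 'X) * q i) => s.
rewrite ep horner_sum; apply: eq_bigr => i _.
by rewrite hornerM hq !mxE !hornerE [s * _]mulrC.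
Qed.

End Closure.

Definition mx_size m n (A : 'M[K]_(m, n)) : R := \sum_i \sum_j nm (A i j).

Lemma mx_size_ge0 m n (A : 'M[K]_(m, n)) : 0 <= mx_size A.
Proof. by apply: sumr_ge0 => i _; apply: sumr_ge0 => j _; apply: nm_ge0. Qed.

Lemma bounded_by_mulmx m n (A : 'M[K]_(m, n)) x s : 0 <= s ->
  bounded_by x s -> bounded_by (x *m A) (mx_size A * s).
Proof.
move=> s0 hx j; rewrite mxE; apply: le_trans (nm_sum _ _ _) _.
rewrite /mx_size mulr_suml; apply: ler_sum => i _.
rewrite nmM mulrC; apply: ler_pM; rewrite ?nm_ge0 //.
by rewrite (bigD1 j) //= lerDl; apply: sumr_ge0 => k _; apply: nm_ge0.
Qed.

(** Each of the j letters of a word is replaced by a linear form whose coefficients have moduli of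
    sum at most [mx_size A]. *)
Lemma hform_mulmx m n (A : 'M[K]_(m, n)) j C p :
  hform j C p -> hform j (C * mx_size A ^+ j) (fun x => p (x *m A)).
Proof.
elim: j C p => [|j IH] C p /=.
  by move=> [a [ha ea]]; exists a; rewrite mulr1.
move=> [c [r [hr hC er]]].
exists (fun i => \sum_k nm (A i k) * (c k * mx_size A ^+ j)),
  (fun i x => \sum_k A i k * r k (x *m A)); split.
- by move=> i; apply: hform_sum => k _; apply/hformZ/IH.
- have c0 i : 0 <= c i by apply: hform_ge0 (hr i).
  have le_sum k : c k <= \sum_i c i.
    by rewrite (bigD1 k) //= lerDl sumr_ge0.
  apply: (@le_trans _ _ (\sum_i \sum_k nm (A i k) * (C * mx_size A ^+ j))).
    apply: ler_sum => i _; apply: ler_sum => k _.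
    apply: ler_wpM2l; first exact: nm_ge0.
    by apply: ler_wpM2r; rewrite ?exprn_ge0 ?mx_size_ge0 // (le_trans (le_sum k)).
  under eq_bigr do rewrite -mulr_suml.
  by rewrite -mulr_suml exprS; set a := \sum_i _; rewrite -/(mx_size A) mulrCA.
- move=> x; rewrite er; under eq_bigr => i _ do rewrite mxE mulr_suml.
  rewrite exchange_big; apply: eq_bigr => i _ /=; rewrite mulr_sumr.
  by apply: eq_bigr => k _; rewrite mulrA.
Qed.

End Forms.

(** * From forms written in words to sums of monomials over boxes *)

Section Monomials.
Variable R : realType.
Notation K := R[i].
Variable n : nat.
Implicit Types (x : 'rV[K]_n).

(** Inverse of [index_of_box] for exponents at most [M] only: [inord] sends larger ones to 0. *)
Definition box_index M (k : multi_index n) : {ffun 'I_n -> 'I_M.+1} :=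
  [ffun i => inord (k i)].

Lemma index_of_boxK M : cancel (@index_of_box n M.+1) (@box_index M).
Proof. by move=> k; apply/ffunP => i; rewrite !ffunE inord_val. Qed.

Lemma box_indexK M (k : multi_index n) :
  (forall i, (k i <= M)%N) -> index_of_box (box_index M k) = k.
Proof. by move=> h; apply/ffunP => i; rewrite !ffunE inordK // ltnS. Qed.

Lemma index_of_box_le M (k : {ffun 'I_n -> 'I_M.+1}) i : (index_of_box k i <= M)%N.
Proof. by rewrite ffunE -ltnS. Qed.

Lemma leq_weight (k : multi_index n) i : (k i <= weight k)%N.
Proof. by rewrite /weight (bigD1 i) //= leq_addr. Qed.

(** The indices selected by [P] already lie in the smaller box; the box only makes the sum
    finite. *)
Lemma box_widen M M' (P : pred (multi_index n)) (F : multi_index n -> K) :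
  (M <= M')%N -> (forall k, P k -> forall i, (k i <= M)%N) ->
  \sum_(k : {ffun 'I_n -> 'I_M'.+1} | P (index_of_box k)) F (index_of_box k) =
  \sum_(k : {ffun 'I_n -> 'I_M.+1} | P (index_of_box k)) F (index_of_box k).
Proof.
move=> le hP; rewrite (reindex_onto (fun k => box_index M' (index_of_box k))
  (fun k => box_index M (index_of_box k))) /=; last first.
  move=> k /hP hk; rewrite box_indexK // index_of_boxK //.
have e (k : {ffun 'I_n -> 'I_M.+1}) : index_of_box (box_index M' (index_of_box k)) = index_of_box k.
  by apply: box_indexK => i; apply: leq_trans (index_of_box_le k i) le.
apply: eq_big => [k|k _]; last by rewrite e.
by rewrite e index_of_boxK eqxx andbT.
Qed.

Definition mono_add (i : 'I_n) (k : multi_index n) : multi_index n :=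
  [ffun l => k l + (l == i)]%N.
Definition mono_sub (i : 'I_n) (k : multi_index n) : multi_index n :=
  [ffun l => k l - (l == i)]%N.

Lemma mono_addK i : cancel (mono_add i) (mono_sub i).
Proof. by move=> k; apply/ffunP => l; rewrite !ffunE addnK. Qed.

Lemma mono_subK i (k : multi_index n) :
  (0 < k i)%N -> mono_add i (mono_sub i k) = k.
Proof. by move=> h; apply/ffunP => l; rewrite !ffunE; case: eqP => [->|] /=; lia. Qed.

Lemma weight_add i k : weight (mono_add i k) = (weight k).+1.
Proof.
rewrite /weight; under eq_bigr do rewrite ffunE.
rewrite big_split /= -addn1; congr (_ + _)%N.
by rewrite (bigD1 i) //= eqxx big1 // => l /negPf ->.
Qed.

Lemma monomial_add i (k : multi_index n) x :
  monomial (mono_add i k) x = x 0 i * monomial k x.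
Proof.
rewrite /monomial; under eq_bigr do rewrite ffunE exprD.
rewrite big_split /= mulrC; congr (_ * _).
by rewrite (bigD1 i) //= eqxx big1 ?mulr1 // => l /negPf ->.
Qed.

Lemma hform_monomial (k : multi_index n) : hform (weight k) 1 (@monomial K n k).
Proof.
rewrite /weight /monomial; elim: index_enum => [|i r IH].
  by rewrite big_nil; exists 1; rewrite nm1; split=> // x; rewrite big_nil.
rewrite big_cons -[1]mulr1.
apply: hform_ext (hformM _ IH) _ => [|x]; last by rewrite big_cons.
by have := hformX (k i) (hform_coord R i); rewrite muln1 expr1n.
Qed.

Lemma hform_box M j (a : multi_index n -> K) (C : R) :
  0 <= C -> (forall k, weight k = j -> nm (a k) <= C) ->
  hform j (C * #|{ffun 'I_n -> 'I_M.+1}|%:R)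
    (fun x => \sum_(k : {ffun 'I_n -> 'I_M.+1} | weight (index_of_box k) == j)
        a (index_of_box k) * monomial (index_of_box k) x).
Proof.
move=> C0 h.
have hC : hform j (\sum_(k : {ffun 'I_n -> 'I_M.+1} | weight (index_of_box k) == j) C)
   (fun x => \sum_(k : {ffun 'I_n -> 'I_M.+1} | weight (index_of_box k) == j)
        a (index_of_box k) * monomial (index_of_box k) x).
  apply: hform_sum => k /eqP hk.
  apply: hform_le (hformZ (a (index_of_box k)) _) _; first by rewrite -hk; apply: hform_monomial.
  by rewrite mulr1 h.
apply: hform_le hC _; rewrite sumr_const mulr_natr.
by apply: ler_wpMn2l => //; apply: max_card.
Qed.

(** Words are collected into monomials: the coefficient of [k] is the sum, over the possible first
    letters [i], of the coefficient of [mono_sub i k] in the cofactor of [x_i]. *)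
Lemma hform_coef j C (p : 'rV[K]_n -> K) : hform j C p ->
  exists a : multi_index n -> K, (forall k, nm (a k) <= C) /\
    forall M x, (j <= M)%N -> p x =
      \sum_(k : {ffun 'I_n -> 'I_M.+1} | weight (index_of_box k) == j)
        a (index_of_box k) * monomial (index_of_box k) x.
Proof.
elim: j C p => [|j IH] C p /=.
  move=> [b [hb eb]]; exists (fun=> b); split=> // M x _.
  rewrite eb (bigD1 (box_index M [ffun=> 0%N])) /=.
    rewrite big1 ?addr0 => [|k /andP[/eqP k0]].
      rewrite box_indexK => [|i]; last by rewrite ffunE.
      by rewrite /monomial big1 ?mulr1 // => i _; rewrite ffunE.
    case/eqP; rewrite -[k]index_of_boxK; congr box_index; apply/ffunP => i.
    by have := leq_weight (index_of_box k) i; rewrite k0 !ffunE leqn0 => /eqP.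
  rewrite box_indexK => [|i]; last by rewrite ffunE.
  by rewrite /weight big1 // => i _; rewrite ffunE.
move=> [c [r [hr hC er]]].
have /choice[b hb] : forall i, exists a : multi_index n -> K, (forall k, nm (a k) <= c i) /\
    forall M x, (j <= M)%N -> r i x =
      \sum_(k : {ffun 'I_n -> 'I_M.+1} | weight (index_of_box k) == j)
        a (index_of_box k) * monomial (index_of_box k) x.
  by move=> i; apply: IH (hr i).
exists (fun k : multi_index n => \sum_i if (0 < k i)%N then b i (mono_sub i k) else 0); split.
  move=> k; apply: le_trans (nm_sum _ _ _) (le_trans _ hC); apply: ler_sum => i _.
  case: ifP => _; first by case: (hb i).
  by rewrite nm0; apply: hform_ge0 (hr i).
move=> M x jM; rewrite er.
under [RHS]eq_bigr do rewrite mulr_suml.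
rewrite exchange_big; apply: eq_bigr => i _ /=.
rewrite (bigID (fun k : {ffun 'I_n -> 'I_M.+1} => (0 < index_of_box k i)%N)) /=.
rewrite addrC big1 ?add0r; last by move=> k /andP[_ /negPf ->]; rewrite mul0r.
rewrite (proj2 (hb i) M x (ltnW jM)) mulr_sumr.
rewrite [RHS](reindex_onto (fun k => box_index M (mono_add i (index_of_box k)))
  (fun k => box_index M (mono_sub i (index_of_box k)))) /=; last first.
  move=> k /andP[_ k0]; rewrite box_indexK ?mono_subK ?index_of_boxK // => l.
  by rewrite ffunE leq_subLR; apply: leq_trans (index_of_box_le k l) (leq_addl _ _).
apply: eq_big => [k|k /eqP hk].
  case: (boolP [forall l, (mono_add i (index_of_box k) l <= M)%N]) => [/forallP h|].
    rewrite box_indexK // weight_add eqSS mono_addK index_of_boxK eqxx ffunE eqxx.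
    by rewrite addn1 ltnS leq0n !andbT.
  (* Only the exponent of [x_i] can leave the box. [inord] then resets it to 0, and the way back
     does not return [k], because [M] is positive. *)
  move=> hn; apply/idP/idP; last first.
    move=> /andP[_ /eqP e]; case/negP: hn; apply/forallP => l.
    move: (congr1 (fun f : {ffun 'I_n -> 'I_M.+1} => nat_of_ord (f l)) e) => /=.
    rewrite !ffunE; have [->|_ _] := eqVneq l i; last by rewrite addn0 -ltnS.
    rewrite /= addn1; have [//|kM] := ltnP (k i) M.
    have -> : nat_of_ord (inord (k i).+1 : 'I_M.+1) = 0%N.
      by rewrite [LHS]val_insubd ltnS ltnNge kM.
    by rewrite inordK // => e0; rewrite leqNgt -e0 in kM; move: jM kM; case: (M).
  move=> /eqP hk; case/negP: hn; apply/forallP => l.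
  by apply: leq_trans (leq_weight _ l) _; rewrite weight_add hk.
rewrite box_indexK; last first.
  by move=> l; apply: leq_trans (leq_weight _ l) _; rewrite weight_add hk.
by rewrite mono_addK monomial_add ffunE eqxx addn1 /= mulrCA.
Qed.

End Monomials.

(** * Power series expansions *)

(** Truncated Cauchy product, regrouped by its first factor; it serves for remainders of products,
    for the Hensel majorant and for the norm of polynomials. *)
Lemma triangle_sum (S : pzRingType) (p q : nat -> S) N :
  \sum_(j < N) \sum_(i < j.+1) p i * q (j - i)%N =
  \sum_(i < N) p i * \sum_(l < N - i) q l.
Proof.
elim: N => [|N IH]; first by rewrite !big_ord0.
rewrite big_ord_recr IH /= [RHS]big_ord_recr /= [X in _ + X = _]big_ord_recr /=.
rewrite addrA -big_split /=; congr (_ + _); last by rewrite subnn subSnn big_ord1.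
by apply: eq_bigr => i _; rewrite subSn ?big_ord_recr ?mulrDr // ltnW.
Qed.

Section Expansions.
Variable R : realType.
Notation K := R[i].

(* Convergence of \sum_j p_j to f on the polydisc of radius 1 / B is replaced by
   geometric bounds on the remainders, so that no limit has to be taken. *)
Definition expands_with n (C B : R) (f : 'rV[K]_n -> K)
    (p : nat -> 'rV[K]_n -> K) :=
  (forall j, hform j (C * B ^+ j) (p j)) /\
  (forall N x s, 0 <= s -> B * s <= 1 -> bounded_by x s ->
     nm (f x - \sum_(j < N) p j x) <= C * (B * s) ^+ N).

Definition expands n (f : 'rV[K]_n -> K) p :=
  exists C B, [/\ 0 <= C, 0 < B & expands_with C B f p].

Definition analytic n (f : 'rV[K]_n -> K) := exists p, expands f p.

(** Absorbs the number of terms of a Cauchy product into a geometric ratio twice as large. *)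
Lemma leq_succ_expn2 j : (j.+1%:R <= 2 ^+ j :> R).
Proof. by rewrite -natrX ler_nat ltn_expl. Qed.

Lemma half_pow_le (C e : R) : 0 <= C -> 0 < e ->
  exists N, forall k, (N <= k)%N -> C * 2^-1 ^+ k <= e.
Proof.
move=> C0 e0; exists (Num.bound (C / e)) => k hk.
have h : C / e < k%:R.
  by apply: lt_le_trans (archi_boundP _) _; rewrite ?divr_ge0 ?ler_nat // ltW.
rewrite exprVn ler_pdivrMr ?exprn_gt0 // mulrC -ler_pdivrMr //.
apply: ltW; apply: lt_le_trans h _; apply: le_trans (leq_succ_expn2 k).
by rewrite ler_nat.
Qed.

Lemma half_geometric N : \sum_(i < N) 2^-1 ^+ i <= 2 :> R.
Proof.
suff -> : \sum_(i < N) 2^-1 ^+ i = 2 - 2 * 2^-1 ^+ N :> R.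
  by rewrite gerBl mulr_ge0 // exprn_ge0 // invr_ge0.
elim: N => [|N IH]; first by rewrite big_ord0 expr0 mulr1 subrr.
by rewrite big_ord_recr /= IH exprS; field.
Qed.

Section Fixed.
Variable n : nat.
Implicit Types (f g : 'rV[K]_n -> K) (p q : nat -> 'rV[K]_n -> K).

Lemma expands_withW C B C' B' f p : 0 <= C -> 0 <= B -> C <= C' -> B <= B' ->
  expands_with C B f p -> expands_with C' B' f p.
Proof.
move=> C0 B0 hC hB [h1 h2]; split.
  move=> j; apply: hform_le (h1 j) _; apply: ler_pM => //; first exact: exprn_ge0.
  by apply: lerXn2r; rewrite ?nnegrE // (le_trans B0).
move=> N x s s0 hs hx; have le_s : B * s <= B' * s by apply: ler_wpM2r.
apply: le_trans (h2 N x s s0 (le_trans le_s hs) hx) _.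
apply: ler_pM => //; first by rewrite exprn_ge0 // mulr_ge0.
by apply: lerXn2r; rewrite ?nnegrE ?mulr_ge0 // (le_trans B0).
Qed.

Lemma expands2 f p g q : expands f p -> expands g q ->
  exists C B, [/\ 0 <= C, 0 < B, expands_with C B f p & expands_with C B g q].
Proof.
move=> [C [B [C0 B0 hf]]] [C' [B' [C'0 B'0 hg]]].
exists (C + C'), (B + B'); split; first exact: addr_ge0.
- exact: addr_gt0.
- by apply: expands_withW hf; rewrite ?lerDl // ltW.
- by apply: expands_withW hg; rewrite ?lerDr // ltW.
Qed.

Lemma expandsD f p g q : expands f p -> expands g q ->
  expands (fun x => f x + g x) (fun j x => p j x + q j x).
Proof.
move=> hf hg; have [C [B [C0 B0 [f1 f2] [g1 g2]]]] := expands2 hf hg.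
exists (C + C), B; split=> //; first exact: addr_ge0.
split=> [j|N x s s0 hs hx]; first by rewrite mulrDl; apply: hformD.
rewrite big_split /= opprD addrACA mulrDl; apply: le_trans (nmD _ _) _.
by apply: lerD; [apply: f2|apply: g2].
Qed.

Lemma expands_form d C (p0 : 'rV[K]_n -> K) : hform d C p0 ->
  expands p0 (fun j x => if j == d then p0 x else 0).
Proof.
move=> h; have C0 := hform_ge0 h; exists C, 1; split=> //; split=> [j|N x s s0 hs hx].
  by rewrite expr1n mulr1; case: eqP => [->//|_]; apply: hform_le (hform0 _ _ _) _.
rewrite mul1r; case: (ltnP d N) => dN.
  rewrite (bigD1 (Ordinal dN)) //= eqxx big1 ?addr0 ?subrr ?nm0.
    by rewrite mulr_ge0 // exprn_ge0.
  by move=> i; rewrite -val_eqE /= => /negPf ->.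
rewrite big1 ?subr0 => [|i _]; last by rewrite ltn_eqF // (leq_trans (ltn_ord i)).
apply: le_trans (hform_le_bound h s0 hx) _; rewrite ler_wpM2l //.
by apply: ler_wiXn2l; rewrite // -[s]mul1r.
Qed.

(** The remainder is (f - S_N) g plus the sum of the p_i (g - T_(N - i)), where S and T are the
    partial sums of f and g. These are N + 1 terms of size at most C^2 (B s)^N, and N + 1 <= 2^N is
    paid for by doubling B. *)
Lemma expandsM f p g q : expands f p -> expands g q ->
  expands (fun x => f x * g x) (fun j x => \sum_(i < j.+1) p i x * q (j - i)%N x).
Proof.
move=> hf hg; have [C [B [C0 B0 [f1 f2] [g1 g2]]]] := expands2 hf hg.
have succ_le N s : 0 <= s -> N.+1%:R * (C * C * (B * s) ^+ N) <= C * C * (B * 2 * s) ^+ N.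
  move=> s0; rewrite mulrCA ler_wpM2l ?mulr_ge0 // [B * 2 * s]mulrAC [leRHS]exprMn mulrC.
  by rewrite ler_wpM2l ?leq_succ_expn2 // exprn_ge0 // mulr_ge0 // ltW.
exists (C * C), (B * 2); split; [exact: mulr_ge0|by rewrite mulr_gt0|split].
  move=> j; have := succ_le j 1 ler01; rewrite !mulr1; apply: hform_le.
  have -> : j.+1%:R * (C * C * B ^+ j) = \sum_(i < j.+1) (C * B ^+ i) * (C * B ^+ (j - i)).
    rewrite (eq_bigr (fun=> C * C * B ^+ j)) ?sumr_const ?card_ord ?mulr_natl //.
    by move=> i _; rewrite mulrACA -exprD subnKC // -ltnS.
  apply: (hform_sum _ (p := fun (i : 'I_j.+1) x => p i x * q (j - i)%N x)) => i _.
  by have := hformM (f1 i) (g1 (j - i)%N); rewrite subnKC // -ltnS.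
move=> N x s s0 hs hx; have Bs1 : B * s <= 1.
  by apply: le_trans hs; rewrite ler_wpM2r // ler_pMr // ler1n.
apply: le_trans (succ_le N s s0).
rewrite (triangle_sum (fun i => p i x) (fun j => q j x)).
have -> : f x * g x - \sum_(i < N) p i x * \sum_(l < N - i) q l x =
   (f x - \sum_(i < N) p i x) * g x
   + \sum_(i < N) p i x * (g x - \sum_(l < N - i) q l x).
  under [X in _ = _ + X]eq_bigr do rewrite mulrBr.
  by rewrite sumrB -mulr_suml mulrBl addrA subrK.
apply: le_trans (nmD _ _) _; rewrite -natr1 [leRHS]mulrDl mul1r [leRHS]addrC; apply: lerD.
  rewrite nmM mulrAC; apply: ler_pM; rewrite ?nm_ge0 //; first exact: f2.
  by have := g2 0%N x s s0 Bs1 hx; rewrite big_ord0 subr0 mulr1.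
apply: le_trans (nm_sum _ _ _) _.
rewrite -[N in N%:R]card_ord mulr_natl -sumr_const; apply: ler_sum => i _.
rewrite nmM; have -> : (B * s) ^+ N = (B * s) ^+ i * (B * s) ^+ (N - i).
  by rewrite -exprD subnKC // ltnW.
rewrite mulrACA.
apply: ler_pM; rewrite ?nm_ge0 //; last exact: g2.
by rewrite exprMn mulrA; apply: hform_le_bound.
Qed.

End Fixed.

Lemma expands_mulmx m n (A : 'M[K]_(m, n)) f p : expands f p ->
  expands (fun x => f (x *m A)) (fun j x => p j (x *m A)).
Proof.
move=> [C [B [C0 B0 [h1 h2]]]].
have A0 : 0 < 1 + mx_size A by rewrite ltr_wpDr // mx_size_ge0.
have Ale : mx_size A <= 1 + mx_size A by rewrite lerDr.
exists C, (B * (1 + mx_size A)); split=> //; first exact: mulr_gt0.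
split=> [j|N x s s0 hs hx].
  apply: hform_le (hform_mulmx A (h1 j)) _; rewrite exprMn mulrA ler_wpM2l //.
    by rewrite mulr_ge0 // exprn_ge0 // ltW.
  by apply: lerXn2r; rewrite // ?nnegrE ?mx_size_ge0 // ltW.
rewrite -mulrA; apply: h2; rewrite ?mulrA // ?mulr_ge0 // ?ltW //.
move=> i; apply: le_trans (bounded_by_mulmx A s0 hx i) _.
by rewrite ler_wpM2r.
Qed.

End Expansions.

(** * Holomorphic germs and series with geometric bounds are the same functions *)

Section Germs.
Variable R : realType.
Notation K := R[i].

Definition box_part n (a : multi_index n -> K) (j : nat) (x : 'rV[K]_n) : K :=
  \sum_(k : {ffun 'I_n -> 'I_j.+1} | weight (index_of_box k) == j)
    a (index_of_box k) * monomial (index_of_box k) x.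

Lemma box_low n (a : multi_index n -> K) M N x : (N <= M.+1)%N ->
  \sum_(k : {ffun 'I_n -> 'I_M.+1} | (weight (index_of_box k) < N)%N)
    a (index_of_box k) * monomial (index_of_box k) x =
  \sum_(j < N) box_part a j x.
Proof.
elim: N => [|N IH] h; first by rewrite big_ord0 big1.
rewrite big_ord_recr /= -IH ?(ltnW h) //.
rewrite (bigID (fun k : {ffun 'I_n -> 'I_M.+1} => weight (index_of_box k) == N)) /= addrC.
congr (_ + _); first by apply: eq_bigl => k; lia.
rewrite /box_part -(@box_widen R n N M (fun k => weight k == N)
  (fun k => a k * monomial k x)) //; first by apply: eq_bigl => k; lia.
by move=> k /eqP <- i; apply: leq_weight.
Qed.

(** Write q^w = (2 q)^w 2^-w: the first factor is at most (2 q)^N, and the sum of the second over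
    the box is a product of n geometric sums, each at most 2. *)
Lemma box_high_le n (t : multi_index n -> K) (c q : R) M N :
  0 <= c -> 0 <= q -> q * 2 <= 1 -> (forall k, nm (t k) <= c * q ^+ weight k) ->
  nm (\sum_(k : {ffun 'I_n -> 'I_M.+1} | ~~ (weight (index_of_box k) < N)%N)
        t (index_of_box k)) <= c * 2 ^+ n * (q * 2) ^+ N.
Proof.
move=> c0 q0 q1 ht; apply: le_trans (nm_sum _ _ _) _.
apply: (@le_trans _ _ (\sum_(k : {ffun 'I_n -> 'I_M.+1})
    c * (q * 2) ^+ N * \prod_i 2^-1 ^+ k i)).
  rewrite big_mkcond; apply: ler_sum => k _; case: ifP => hk; last first.
    apply: mulr_ge0; first by rewrite mulr_ge0 // exprn_ge0 // mulr_ge0.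
    by apply: prodr_ge0 => i _; rewrite exprn_ge0 // invr_ge0.
  apply: le_trans (ht _) _; rewrite -mulrA ler_wpM2l //.
  have -> : \prod_i 2^-1 ^+ k i = 2^-1 ^+ weight (index_of_box k) :> R.
    by rewrite /weight expr_sum; apply: eq_bigr => i _; rewrite ffunE.
  set w := weight _; have -> : q ^+ w = (q * 2) ^+ w * 2^-1 ^+ w.
    by rewrite -exprMn mulfK.
  rewrite ler_wpM2r ?exprn_ge0 ?invr_ge0 //.
  by apply: ler_wiXn2l; rewrite ?mulr_ge0 // leqNgt.
rewrite -mulr_sumr mulrAC -!mulrA ler_wpM2l // ler_wpM2r ?exprn_ge0 ?mulr_ge0 //.
rewrite -(bigA_distr_bigA (fun (i : 'I_n) (j : 'I_M.+1) => 2^-1 ^+ j)) prodr_const card_ord.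
apply: lerXn2r; rewrite ?nnegrE //; last exact: half_geometric.
by apply: sumr_ge0 => i _; rewrite exprn_ge0 // invr_ge0.
Qed.

Lemma nm_monomial_le n (k : multi_index n) (x : 'rV[K]_n) s :
  0 <= s -> bounded_by x s -> nm (monomial k x) <= s ^+ weight k.
Proof.
by move=> s0 hx; rewrite -[leRHS]mul1r; apply: hform_le_bound (hform_monomial R k) s0 hx.
Qed.

(** The ratio [2 ^+ n.+1 * rho^-1] dominates both 2^n / rho, which absorbs the (j + 1)^n terms of a
    box, and 2 / rho, which [box_high_le] asks for. The limit is used at a single box, up to an
    arbitrary error [e]. *)
Lemma has_expansion_expands n (r : K) (a : multi_index n -> K) f :
  0 < r -> has_expansion r a f -> expands f (box_part a).
Proof.
move=> /gt0_real[rho rho0 ->] [[M hM] hf] {r}.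
have [mu mu0 hmu] : exists2 mu : R, 0 <= mu & forall k, nm (a k) <= mu * rho^-1 ^+ weight k.
  have M0 : 0 <= M.
    apply: le_trans (hM [ffun=> 0%N]); rewrite mulr_ge0 //.
    by rewrite exprn_ge0 // lecR ltW.
  exists (nm M); first exact: nm_ge0.
  move=> k; rewrite exprVn ler_pdivlMr ?exprn_gt0 // -lecR rmorphM rmorphXn /=.
  by rewrite -!norm_nm (ger0_norm M0).
have hB : 0 < 2 ^+ n.+1 * rho^-1 by rewrite mulr_gt0 ?exprn_gt0 ?invr_gt0.
exists (mu * 2 ^+ n), (2 ^+ n.+1 * rho^-1); split=> //.
  by rewrite mulr_ge0 // exprn_ge0.
split=> [j|N x s s0 hs hx].
  have := @hform_box R n j j a (mu * rho^-1 ^+ j); rewrite card_ffun !card_ord.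
  move=> /(_ _ _)/hform_le; apply.
  - by rewrite mulr_ge0 // exprn_ge0 // invr_ge0 ltW.
  - by move=> k <-.
  have card_le : (j.+1 ^ n)%:R <= (2 ^+ n.+1) ^+ j :> R.
    rewrite natrX; apply: (@le_trans _ _ ((2 ^+ j) ^+ n)).
      by apply: lerXn2r; rewrite ?nnegrE ?ler0n ?exprn_ge0 // leq_succ_expn2.
    by rewrite -!exprM ler_weXn2l ?ler1n // mulSn mulnC leq_addl.
  rewrite exprMn -!mulrA ler_wpM2l // mulrC.
  apply: (@le_trans _ _ (1 * ((2 ^+ n.+1) ^+ j * rho^-1 ^+ j))).
    by rewrite mul1r ler_wpM2r // exprn_ge0 // invr_ge0 ltW.
  by rewrite ler_wpM2r ?exprn_ege1 ?ler1n // mulr_ge0 // exprn_ge0 ?exprn_ge0 // invr_ge0 ltW.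
have q2 : s / rho * 2 <= 2 ^+ n.+1 * rho^-1 * s.
  rewrite mulrC mulrA [leRHS]mulrAC ler_wpM2r ?invr_ge0 ?(ltW rho0) //.
  by rewrite ler_wpM2r // exprS ler_peMr // exprn_ege1 // ler1n.
apply/ler_addgt0Pr => e e0.
have hxr i : `|x 0 i| < rho%:C.
  rewrite norm_nm ltcR; apply: le_lt_trans (hx i) _.
  have := le_trans q2 hs; rewrite -mulrA [_^-1 * _]mulrC mulrA ler_pdivrMr // mul1r.
  by lra.
have /cvg_nm/(_ e e0)[N0 hN0] : seq_cvg (fun N => \sum_(k : {ffun 'I_n -> 'I_N})
        a (index_of_box k) * monomial (index_of_box k) x) (f x) := hf x hxr.
(* The box has to bring the partial sum within [e] of [f x] and to contain all indices of weight
   less than [N]. *)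
clear M hM; pose M := maxn N0 N; have hM1 := hN0 M.+1 (leqW (leq_maxl _ _)).
rewrite -(@box_low n a M N x) ?(leqW (leq_maxr _ _)) // [leRHS]addrC.
rewrite (bigID (fun k : {ffun 'I_n -> 'I_M.+1} => (weight (index_of_box k) < N)%N)) /= in hM1.
set S1 := (X in f x - (X + _)) in hM1; set S2 := (X in f x - (_ + X)) in hM1.
rewrite -/S1; have -> : f x - S1 = (f x - (S1 + S2)) + S2 by ring.
apply: le_trans (nmD _ _) _; apply: lerD => //.
apply: (@le_trans _ _ (mu * 2 ^+ n * (s / rho * 2) ^+ N)).
  apply: (@box_high_le n (fun k => a k * monomial k x)) => //.
  - by rewrite divr_ge0 // ltW.
  - exact: le_trans hs.
  move=> k; rewrite nmM exprMn [s ^+ _ * _]mulrC mulrA; apply: ler_pM; rewrite ?nm_ge0 //.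
  exact: nm_monomial_le.
rewrite ler_wpM2l ?mulr_ge0 ?exprn_ge0 //.
by apply: lerXn2r; rewrite ?nnegrE ?mulr_ge0 ?exprn_ge0 ?invr_ge0 ?(ltW rho0).
Qed.

Lemma analytic_germ_analytic n (f : 'rV[K]_n -> K) : analytic_germ f -> analytic f.
Proof. by move=> [r r0 [a h]]; exists (box_part a); apply: has_expansion_expands r0 h. Qed.

Lemma analytic_analytic_germ n (f : 'rV[K]_n -> K) : analytic f -> analytic_germ f.
Proof.
move=> [p [C [B [C0 B0 [hp hf]]]]].
have /choice[b hb] := fun j => hform_coef (hp j).
pose a k := b (weight k) k.
have ha k : nm (a k) <= C * B ^+ weight k by have [+ _] := hb (weight k); apply.
have pE j x : p j x = box_part a j x.
  have [_ /(_ j x (leqnn _)) ->] := hb j.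
  by apply: eq_bigr => k /eqP e; rewrite /a e.
(* With [B * s] equal to 1/4, [box_high_le] gives the part of weight above [k] the ratio 1/2, so
   that [half_pow_le] applies. *)
pose s := (B * 4)^-1; have B40 : 0 < B * 4 by rewrite mulr_gt0.
have s0 : 0 < s by rewrite invr_gt0.
have Bs : B * s = 4^-1 by rewrite /s; field; rewrite gt_eqF.
exists s%:C; first by rewrite ltcR.
exists a; split.
  exists C%:C => k; rewrite norm_nm -rmorphXn -rmorphM lecR.
  apply: le_trans (ler_wpM2r _ (ha k)) _; first by rewrite exprn_ge0 // ltW.
  rewrite -mulrA -exprMn Bs ler_piMr // exprn_ile1 // ?invr_ge0 //; lra.
move=> x hx0; have hx : bounded_by x s.
  by move=> i; have := hx0 i; rewrite norm_nm ltcR => /ltW.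
apply/(cvg_nm (fun N => \sum_(k : {ffun 'I_n -> 'I_N})
        a (index_of_box k) * monomial (index_of_box k) x)) => e e0.
have D0 : 0 <= C * (2 ^+ n + 1) by rewrite mulr_ge0 // addr_ge0 // exprn_ge0.
have [N hN] := half_pow_le D0 e0.
exists N.+1 => -[//|k] kN.
rewrite (bigID (fun l : {ffun 'I_n -> 'I_k.+1} => (weight (index_of_box l) < k.+1)%N)) /=.
rewrite box_low // opprD addrA.
apply: le_trans (hN k.+1 (ltnW kN)); rewrite mulrDr mulr1 mulrDl [leRHS]addrC.
apply: le_trans (nmD _ _) _; apply: lerD; last first.
  rewrite nmN; have -> : 2^-1 = B * s * 2 :> R by rewrite Bs; field.
  apply: (@box_high_le n (fun k => a k * monomial k x)) => //; rewrite ?Bs ?invr_ge0 //; first by lra.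
  move=> l; rewrite nmM -Bs exprMn mulrA; apply: ler_pM; rewrite ?nm_ge0 //.
  exact: nm_monomial_le (ltW s0) hx.
have Bs1 : B * s <= 1 by rewrite Bs; lra.
have := hf k.+1 x s (ltW s0) Bs1 hx; under eq_bigr do rewrite pE.
move=> /le_trans; apply; rewrite Bs ler_wpM2l //.
by apply: lerXn2r; rewrite ?nnegrE ?invr_ge0 //; lra.
Qed.

Section Algebra.
Variable n : nat.
Implicit Types (f g : 'rV[K]_n -> K).

Lemma analytic_ext f g : analytic f -> f =1 g -> analytic g.
Proof.
move=> [p [C [B [C0 B0 [h1 h2]]]]] e; exists p, C, B; split=> //; split=> // N x s s0 hs hx.
by rewrite -e; apply: h2.
Qed.

Lemma analytic_cst a : analytic (fun _ : 'rV[K]_n => a).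
Proof.
exists (fun j x => if j == 0%N then a else 0); apply: (expands_form (d := 0%N) (C := nm a)).
by exists a.
Qed.

Lemma analytic_coord i : analytic (fun x : 'rV[K]_n => x 0 i).
Proof. by eexists; apply: expands_form (hform_coord R i). Qed.

Lemma analyticD f g : analytic f -> analytic g -> analytic (fun x => f x + g x).
Proof. by move=> [p hp] [q hq]; eexists; apply: expandsD hp hq. Qed.

Lemma analyticM f g : analytic f -> analytic g -> analytic (fun x => f x * g x).
Proof. by move=> [p hp] [q hq]; eexists; apply: expandsM hp hq. Qed.

Lemma analytic_sum (I : Type) (r : seq I) (P : pred I) (F : I -> 'rV[K]_n -> K) :
  (forall i, P i -> analytic (F i)) ->
  analytic (fun x => \sum_(i <- r | P i) F i x).
Proof.
move=> h; elim: r => [|i r IH].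
  by apply: analytic_ext (analytic_cst 0) _ => x; rewrite big_nil.
case Pi: (P i); last by apply: analytic_ext IH _ => x; rewrite big_cons Pi.
by apply: analytic_ext (analyticD (h i Pi) IH) _ => x; rewrite big_cons Pi.
Qed.

Lemma analytic_prod (I : Type) (r : seq I) (F : I -> 'rV[K]_n -> K) :
  (forall i, analytic (F i)) -> analytic (fun x => \prod_(i <- r) F i x).
Proof.
move=> h; elim: r => [|i r IH].
  by apply: analytic_ext (analytic_cst 1) _ => x; rewrite big_nil.
by apply: analytic_ext (analyticM (h i) IH) _ => x; rewrite big_cons.
Qed.

Lemma analyticX f k : analytic f -> analytic (fun x => f x ^+ k).
Proof.
move=> h; elim: k => [|k IH]; first exact: analytic_ext (analytic_cst 1) _.
by apply: analytic_ext (analyticM h IH) _ => x; rewrite exprS.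
Qed.

Lemma analytic_det k (M : 'rV[K]_n -> 'M[K]_k) :
  (forall i j, analytic (fun x => M x i j)) -> analytic (fun x => \det (M x)).
Proof.
move=> h; apply: analytic_sum => s _; apply: analyticM; first exact: analytic_cst.
by apply: analytic_prod => i; apply: h.
Qed.

End Algebra.

Lemma analytic_mulmx m n (A : 'M[K]_(m, n)) f :
  analytic f -> analytic (fun x => f (x *m A)).
Proof. by move=> [p hp]; eexists; apply: expands_mulmx hp. Qed.

Lemma analytic_linear n (l : 'cV[K]_n) : analytic (fun x => (x *m l) 0 0).
Proof. exact: analytic_mulmx (analytic_coord 0). Qed.

End Germs.

(** * Initial forms *)

Section InitialForms.
Variable R : realType.
Notation K := R[i].

Lemma exists_nonroot (q : {poly K}) (s : seq K) :
  q != 0 -> exists2 t, q.[t] != 0 & t \notin s.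
Proof.
move=> q0; pose Q := q * \prod_(c <- s) ('X - c%:P).
have Q0 : Q != 0.
  by rewrite mulf_neq0 // monic_neq0 // monic_prod_XsubC.
pose r := [seq i%:R : K | i <- iota 0 (size Q)].
have [/allP h|/allPn[t _ ht]] := boolP (all (root Q) r).
  have := max_poly_roots Q0; move=> /(_ r); rewrite size_map size_iota ltnn.
  move=> H; suff : false by []; apply: H; first exact/allP.
  by rewrite map_inj_uniq ?iota_uniq // => i j /eqP; rewrite eqr_nat => /eqP.
exists t; first by apply: contraNneq ht => e; rewrite rootM /root e eqxx.
by apply: contra ht => ts; rewrite rootM root_prod_XsubC ts orbT.
Qed.

Lemma digits_inj b n (f g : 'I_n -> nat) :
  (forall i, f i < b)%N -> (forall i, g i < b)%N ->
  (\sum_i f i * b ^ i = \sum_i g i * b ^ i)%N -> f =1 g.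
Proof.
elim: n f g => [|n IH] f g hf hg; first by move=> _ [].
rewrite !big_ord_recl !muln1.
have shift (h : 'I_n.+1 -> nat) :
    (\sum_(i < n) h (lift ord0 i) * b ^ (lift ord0 i) =
     b * \sum_(i < n) h (lift ord0 i) * b ^ i)%N.
  by rewrite big_distrr; apply: eq_bigr => i _; rewrite /= /bump /= add1n expnS mulnCA.
rewrite !shift => e.
have e0 : f ord0 = g ord0.
  move/(congr1 (modn^~ b)): e; rewrite ![(_ + b * _)%N]addnC ![(b * _)%N]mulnC.
  by rewrite !modnMDl !modn_small.
move: e; rewrite e0 => /addnI /eqP; rewrite eqn_mul2l.
have /negPf -> : b != 0%N by rewrite -lt0n (leq_ltn_trans _ (hf ord0)).
move=> /eqP e i; case: (unliftP ord0 i) => [j|] ->; last by [].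
by apply: (IH (fun j => f (lift ord0 j)) (fun j => g (lift ord0 j))).
Qed.

(* Kronecker substitution x_i = t ^ ((m + 1) ^ i). *)
Lemma box_part_neq0 n (a : multi_index n -> K) m k :
  weight k = m -> a k != 0 -> exists v, box_part a m v != 0.
Proof.
move=> km ak.
pose ex (l : multi_index n) := (\sum_i l i * m.+1 ^ i)%N.
pose Q : {poly K} := \sum_(l : {ffun 'I_n -> 'I_m.+1} | weight (index_of_box l) == m)
  a (index_of_box l) *: 'X^(ex (index_of_box l)).
have le_k i : (k i <= m)%N by rewrite -km leq_weight.
have Q0 : Q != 0.
  apply: contra_neq ak => /(congr1 (fun q : {poly K} => q`_(ex k))).
  rewrite coef0 coef_sum (bigD1 (box_index m k)) /=; last by rewrite box_indexK // km.
  rewrite coefZ coefXn box_indexK // eqxx mulr1 big1 ?addr0 // => l /andP[_ lk].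
  rewrite coefZ coefXn; case: eqP => [e|_]; last by rewrite mulr0.
  case/negP: lk; apply/eqP; rewrite -[l]index_of_boxK; congr box_index.
  apply/ffunP => i; apply: (@digits_inj m.+1 n (index_of_box l) k) => [{}i|{}i|].
  - by rewrite ltnS index_of_box_le.
  - by rewrite ltnS le_k.
  - by rewrite -/(ex _) -/(ex _) e.
have [t ht _] := exists_nonroot [::] Q0.
exists (\row_i t ^+ (m.+1 ^ i)); apply: contra_neq ht => <-.
rewrite horner_sum; apply: eq_bigr => l _; rewrite hornerZ hornerXn.
congr (_ * _); rewrite /monomial /ex expr_sum; apply: eq_bigr => i _.
by rewrite mxE -exprM mulnC.
Qed.

(* f = H + O(|x|^(m+1)) near 0. *)
Definition leading n (f : 'rV[K]_n -> K) m (H : 'rV[K]_n -> K) :=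
  exists C e, [/\ 0 <= C, 0 < e & forall x s, 0 <= s -> s <= e -> bounded_by x s ->
    nm (f x - H x) <= C * s ^+ m.+1].

Lemma expands_leading n (f : 'rV[K]_n -> K) p m : expands f p ->
  (forall j x, (j < m)%N -> p j x = 0) -> leading f m (p m).
Proof.
move=> [C [B [C0 B0 [_ h]]]] p0; exists (C * B ^+ m.+1), B^-1; split.
- by rewrite mulr_ge0 // exprn_ge0 // ltW.
- by rewrite invr_gt0.
move=> x s s0 se hx; rewrite -mulrA -exprMn.
have := h m.+1 x s s0 _ hx; rewrite big_ord_recr /= big1 ?add0r => [|i _]; last exact: p0.
by apply; rewrite -ler_pdivlMl // mulr1.
Qed.

Lemma initial_formP n (f : 'rV[K]_n -> K) m H : initial_form f m H ->
  [/\ exists C, hform m C H, exists v, H v != 0 & leading f m H].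
Proof.
move=> [r [a [r0 hf a0 [k [km ak]] hH]]].
have hE : H =1 box_part a m by [].
have ex := has_expansion_expands r0 hf.
split.
- have [C [B [_ _ [/(_ m) h _]]]] := ex; exists (C * B ^+ m).
  by apply: hform_ext h _ => x; rewrite hE.
- by have [v hv] := box_part_neq0 km ak; exists v; rewrite hE.
- have [C [e [C0 e0 h]]] : leading f m (box_part a m).
    apply: expands_leading ex _ => j x jm; apply: big1 => l /eqP hl.
    by rewrite a0 ?mul0r // hl.
  by exists C, e; split=> // x s s0 se hx; rewrite hE; apply: h.
Qed.

Lemma initial_form_exists n (f : 'rV[K]_n -> K) : analytic_germ f ->
  ~ near0 (fun x => f x = 0) -> exists m H, initial_form f m H.
Proof.
move=> [r r0 [a hf]] nz.
have [[k ak]|h] := pselect (exists k, a k != 0); last first.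
  case: nz; apply/near0_norm; exists r => // x hx.
  have /cvg_nm hc : seq_cvg (fun N => \sum_(k : {ffun 'I_n -> 'I_N})
        a (index_of_box k) * monomial (index_of_box k) x) (f x) := hf.2 x hx.
  apply/eqP; rewrite -nm_eq0 eq_le nm_ge0 andbT.
  apply/ler_addgt0Pr => e /hc[N /(_ N (leqnn _))]; rewrite big1 ?subr0 ?add0r //.
  move=> k _; apply/eqP; rewrite mulf_eq0; apply/orP; left.
  by apply/negPn/negP => ak; apply: h; exists (index_of_box k).
have ex : exists m, `[< exists k, weight k = m /\ a k != 0 >].
  by exists (weight k); apply/asboolP; exists k.
case: (ex_minnP ex) => m /asboolP hm min_m.
exists m, (box_part a m), r, a; split=> // l lm; apply/eqP/negPn/negP => al.
by have := min_m (weight l); rewrite leqNgt lm => /(_ _)/notF; apply; apply/asboolP; exists l.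
Qed.

End InitialForms.

(** * Uniqueness of leading forms *)

Section Leading.
Variable R : realType.
Notation K := R[i].

(** Replaces the passage to the limit d -> 0. *)
Lemma le0_small (x C e : R) : 0 < e ->
  (forall d, 0 < d -> d <= e -> x <= C * d) -> x <= 0.
Proof.
move=> e0 h; rewrite leNgt; apply/negP => x0.
have C0 : 0 < C.
  by have := h e e0 (lexx _); move/(lt_le_trans x0); rewrite pmulr_lgt0.
pose d := Num.min e (x / C / 2).
have d0 : 0 < d by rewrite lt_min e0 !divr_gt0.
have := h d d0 _; rewrite ge_min lexx => /(_ isT); rewrite leNgt => /negP; apply.
rewrite mulrC -ltr_pdivlMr //; apply: le_lt_trans (_ : _ <= x / C / 2) _.
  by rewrite ge_min lexx orbT.
have : 0 < x / C by rewrite divr_gt0.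
lra.
Qed.

Lemma poly_lipschitz0 (Q : {poly K}) : exists2 L, 0 <= L &
  forall t, nm t <= 1 -> nm (Q.[t] - Q.[0]) <= L * nm t.
Proof.
elim/poly_ind: Q => [|Q c [L L0 h]].
  by exists 0 => // t _; rewrite !horner0 subrr nm0 mul0r.
exists (L + nm Q.[0]); first by rewrite addr_ge0 // nm_ge0.
move=> t t1; rewrite !hornerMXaddC mulr0 add0r addrK nmM ler_wpM2r ?nm_ge0 //.
rewrite -[Q.[t]](subrK Q.[0]); apply: le_trans (nmD _ _) _.
rewrite lerD2r; apply: le_trans (h t t1) _.
by rewrite -[leRHS]mulr1 ler_wpM2l.
Qed.

Lemma poly_small_root0 (Q : {poly K}) (C e : R) : 0 < e ->
  (forall t, t != 0 -> nm t <= e -> nm Q.[t] <= C * nm t) -> Q.[0] = 0.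
Proof.
move=> e0 h; have [L L0 hL] := poly_lipschitz0 Q.
apply/eqP; rewrite -nm_eq0 eq_le nm_ge0 andbT.
have e10 : 0 < Num.min e 1 by rewrite lt_min e0 ltr01.
apply: (le0_small (C := C + L) e10) => d d0; rewrite le_min => /andP[de d1].
have nd : nm d%:C = d by rewrite nm_real // ltW.
have := h d%:C; rewrite -nm_gt0 nd => /(_ d0 de) h1.
have := hL d%:C; rewrite nd => /(_ d1) h2.
rewrite -[Q.[0]](subKr Q.[d%:C]) mulrDl.
by apply: le_trans (nmD _ _) _; rewrite nmN lerD.
Qed.

(** The bound forces Q(0) = 0, and Q / X satisfies the same bound with exponent m - 1. *)
Lemma poly_small_eq0 m (Q : {poly K}) (C e : R) : 0 < e -> (size Q <= m)%N ->
  (forall t, t != 0 -> nm t <= e -> nm Q.[t] <= C * nm t ^+ m) -> Q = 0.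
Proof.
move=> e0; wlog e1 : e e0 / e <= 1 => [hw sQ h|].
  apply: (hw (Num.min e 1)) => //; first by rewrite lt_min e0 ltr01.
    by rewrite ge_min lexx orbT.
  by move=> t t0; rewrite le_min => /andP[te _]; apply: h.
elim: m Q => [|m IH] Q sQ h.
  by apply/eqP; rewrite -size_poly_eq0 -leqn0.
have Q0 : Q.[0] = 0.
  apply: (poly_small_root0 (C := `|C|) e0) => t t0 te; apply: le_trans (h t t0 te) _.
  apply: le_trans (_ : `|C| * nm t ^+ m.+1 <= _).
    by rewrite ler_wpM2r ?exprn_ge0 ?nm_ge0 // ler_norm.
  rewrite ler_wpM2l // exprS ler_piMr ?nm_ge0 // exprn_ile1 ?nm_ge0 //.
  exact: le_trans e1.
have [q qE] : exists q, Q = q * ('X - 0%:P) by apply/factor_theorem/rootP.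
rewrite subr0 in qE; have [q0|q0] := eqVneq q 0; first by rewrite qE q0 mul0r.
suff q'0 : q = 0 by rewrite qE q'0 mul0r.
apply: IH; first by rewrite -ltnS -(size_mulX q0) -qE.
move=> t t0 te; have := h t t0 te; rewrite qE hornerM hornerX nmM exprS mulrCA mulrC.
by rewrite ler_pM2l ?nm_gt0.
Qed.

Lemma bounded_byZ n (x : 'rV[K]_n) t s : bounded_by x s -> bounded_by (t *: x) (nm t * s).
Proof. by move=> h i; rewrite mxE nmM ler_wpM2l ?nm_ge0. Qed.

Lemma exists_bound n (x : 'rV[K]_n) : exists2 s, 0 < s & bounded_by x s.
Proof.
have n0 : 0 <= \sum_i nm (x 0 i) by apply: sumr_ge0 => i _; apply: nm_ge0.
exists (1 + \sum_i nm (x 0 i)); first by rewrite ltr_pwDl.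
move=> i; rewrite (bigD1 i) //= addrCA lerDl addr_ge0 //.
by apply: sumr_ge0 => k _; apply: nm_ge0.
Qed.

(** On the polydisc of radius 1 / (2 B) both functions are within C 2^-N of the same partial sum,
    for every N. *)
Lemma expands_near_eq n (f g : 'rV[K]_n -> K) p :
  expands f p -> expands g p -> near0 (fun x => f x = g x).
Proof.
move=> hf hg; have [C [B [C0 B0 [_ f2] [_ g2]]]] := expands2 hf hg.
have B20 : 0 < (B * 2)^-1 by rewrite invr_gt0 mulr_gt0.
apply/near0_le; exists (B * 2)^-1 => // x hx.
apply/eqP; rewrite -subr_eq0 -nm_eq0 eq_le nm_ge0 andbT.
have Bs : B * (B * 2)^-1 = 2^-1 by field; rewrite gt_eqF.
have Bs1 : B * (B * 2)^-1 <= 1 by rewrite Bs; lra.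
apply/ler_addgt0Pr => e e0; rewrite add0r.
have [N /(_ N (leqnn _)) hN] := half_pow_le (addr_ge0 C0 C0) e0.
apply: le_trans hN; rewrite mulrDl -Bs.
have h1 := f2 N x _ (ltW B20) Bs1 hx; have h2 := g2 N x _ (ltW B20) Bs1 hx.
rewrite -[f x](subrK (\sum_(j < N) p j x)) -addrA -[_ - g x]opprB.
by apply: le_trans (nmD _ _) _; rewrite nmN lerD.
Qed.

Lemma expands_ext n (f g : 'rV[K]_n -> K) p q :
  expands f p -> f =1 g -> (forall j, p j =1 q j) -> expands g q.
Proof.
move=> [C [B [C0 B0 [h1 h2]]]] e ep; exists C, B; split=> //; split=> [j|N x s s0 hs hx].
  exact: hform_ext (h1 j) (ep j).
by rewrite -e; under eq_bigr do rewrite -ep; apply: h2.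
Qed.

Lemma expands_sum n (I : Type) (r : seq I) (F : I -> 'rV[K]_n -> K)
    (p : I -> nat -> 'rV[K]_n -> K) :
  (forall i, expands (F i) (p i)) ->
  expands (fun x => \sum_(i <- r) F i x) (fun j x => \sum_(i <- r) p i j x).
Proof.
move=> h; elim: r => [|i r IH].
  have h0 : hform 0 0 (fun _ : 'rV[K]_n => 0 : K) by exact: hform0.
  apply: expands_ext (expands_form h0) _ _ => [x|j x]; rewrite big_nil //.
  by case: eqP.
by apply: expands_ext (expandsD (h i) IH) _ _ => [x|j x]; rewrite big_cons.
Qed.

Lemma expands_mul_form n (f p0 : 'rV[K]_n -> K) p d C :
  expands f p -> hform d C p0 ->
  expands (fun x => f x * p0 x) (fun j x => if (d <= j)%N then p (j - d)%N x * p0 x else 0).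
Proof.
move=> hf h0; apply: expands_ext (expandsM hf (expands_form h0)) _ _ => [//|j x].
case: leqP => dj; last first.
  by rewrite big1 // => i _; case: eqP => [e|]; rewrite ?mulr0 //; have := ltn_ord i; lia.
have dj' : (j - d < j.+1)%N by lia.
rewrite (bigD1 (Ordinal dj')) //= subKn // eqxx big1 ?addr0 // => i; rewrite -val_eqE /= => ij.
by case: eqP => [e|]; rewrite ?mulr0 //; have := ltn_ord i; lia.
Qed.

Lemma expands0 n (f : 'rV[K]_n -> K) p : expands f p -> p 0%N 0 = f 0.
Proof.
move=> [C [B [C0 B0 [_ h]]]]; apply/eqP; rewrite eq_sym -subr_eq0 -nm_eq0 eq_le nm_ge0 andbT.
have := h 1%N 0 0 (lexx _); rewrite big_ord1 mulr0 expr1 mulr0; apply=> //.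
by move=> i; rewrite mxE nm0.
Qed.

(** On the line t x, the sum of the p_j(t x) for j <= m minus H(t x) is a polynomial in t of degree
    at most m which is O(t^(m + 1)); so it is zero, and its coefficients are compared. *)
Lemma leading_expands n (f : 'rV[K]_n -> K) p m H D :
  expands f p -> leading f m H -> hform m D H ->
  (forall d x, (d < m)%N -> p d x = 0) /\ (forall x, p m x = H x).
Proof.
move=> [C [B [C0 B0 [hp h]]]] [C' [e [C'0 e0 h']]] hH.
suff hx x d : (d <= m)%N -> p d x = if d == m then H x else 0.
  split=> [d x dm|x]; last by rewrite hx ?eqxx.
  by rewrite hx ?(ltnW dm) // ltn_eqF.
pose Q : {poly K} := \poly_(d < m.+1) (p d x - if d == m then H x else 0).
have [s s0 xs] := exists_bound x.
have e'0 : 0 < Num.min (e / s) ((B * s)^-1) by rewrite lt_min divr_gt0 // invr_gt0 mulr_gt0.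
suff Q0 : Q = 0.
  move=> dm; apply/eqP; rewrite -subr_eq0; move/(congr1 (fun q : {poly K} => q`_d)): Q0.
  by rewrite coef_poly ltnS dm coef0 => ->.
apply: (poly_small_eq0 (m := m.+1) (C := C * (B * s) ^+ m.+1 + C' * s ^+ m.+1) e'0).
  exact: size_poly.
move=> t t0; rewrite le_min => /andP[te tB].
have xts := bounded_byZ t xs.
have ts0 : 0 <= nm t * s by rewrite mulr_ge0 ?nm_ge0 // ltW.
have h1 : nm (f (t *: x) - \sum_(j < m.+1) p j (t *: x)) <= C * (B * s) ^+ m.+1 * nm t ^+ m.+1.
  rewrite -mulrA -exprMn mulrAC -mulrA; apply: h => //.
  by rewrite mulrCA -ler_pdivlMr ?mulr_gt0 // mul1r.
have h2 : nm (f (t *: x) - H (t *: x)) <= C' * s ^+ m.+1 * nm t ^+ m.+1.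
  rewrite -mulrA -exprMn [s * _]mulrC; apply: h' => //.
  by rewrite -ler_pdivlMr.
have -> : Q.[t] = (f (t *: x) - H (t *: x)) - (f (t *: x) - \sum_(j < m.+1) p j (t *: x)).
  rewrite horner_poly; under eq_bigr do rewrite mulrBl; rewrite sumrB.
  have -> : \sum_(i < m.+1) p i x * t ^+ i = \sum_(i < m.+1) p i (t *: x).
    by apply: eq_bigr => i _; rewrite (hform_homog _ _ (hp i)) mulrC.
  have -> : \sum_(i < m.+1) (if i == m :> nat then H x else 0) * t ^+ i = H (t *: x).
    rewrite (bigD1 ord_max) //= eqxx big1 ?addr0 => [|i].
      by rewrite (hform_homog _ _ hH) mulrC.
    by rewrite -val_eqE /= => /negPf ->; rewrite mul0r.
  by ring.
apply: le_trans (nmD _ _) _; rewrite nmN mulrDl addrC; exact: lerD.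
Qed.

Lemma leading_mulmx m n (A : 'M[K]_(m, n)) f d H :
  leading f d H -> leading (fun x => f (x *m A)) d (fun x => H (x *m A)).
Proof.
move=> [C [e [C0 e0 h]]]; have A0 := mx_size_ge0 A.
exists (C * mx_size A ^+ d.+1), (e / (1 + mx_size A)); split.
- by rewrite mulr_ge0 // exprn_ge0.
- by rewrite divr_gt0 // ltr_wpDr.
move=> x s s0 se hx; rewrite -mulrA -exprMn; apply: h.
- exact: mulr_ge0.
- rewrite ler_pdivlMr ?ltr_wpDr // in se; apply: le_trans se.
  by rewrite mulrDr mulr1 mulrC lerDr.
- exact: bounded_by_mulmx.
Qed.

Lemma analytic_lipschitz0 n (q : 'rV[K]_n -> K) : analytic q ->
  exists C e, [/\ 0 <= C, 0 < e & forall x s, 0 <= s -> s <= e -> bounded_by x s ->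
    nm (q x - q 0) <= C * s].
Proof.
move=> [p hq]; have p0 := expands0 hq; move: hq => [C [B [C0 B0 [hp h]]]].
exists (C * B), B^-1; split; first by rewrite mulr_ge0 // ltW.
  by rewrite invr_gt0.
move=> x s s0 sB hx; have := h 1%N x s s0 _ hx; rewrite big_ord1 expr1 mulrA -p0.
have /= [a [_ ha]] := hp 0%N; rewrite !ha; apply.
by rewrite -ler_pdivlMl // mulr1.
Qed.

(** f q - q(0) H = (f - H) q + H (q - q(0)), and both terms are of order m + 1. *)
Lemma leading_mul n (f q : 'rV[K]_n -> K) m H D : hform m D H ->
  leading f m H -> analytic q -> leading (fun x => f x * q x) m (fun x => q 0 * H x).
Proof.
move=> hH [C [e [C0 e0 h]]] /analytic_lipschitz0[L [e' [L0 e'0 h']]].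
have D0 := hform_ge0 hH; have q00 := nm_ge0 (q 0).
exists (C * (L * e' + nm (q 0)) + D * L), (Num.min e e'); split.
- by rewrite addr_ge0 ?mulr_ge0 ?addr_ge0 ?mulr_ge0 // ltW.
- by rewrite lt_min e0.
move=> x s s0; rewrite le_min => /andP[se se'] hx.
have -> : f x * q x - q 0 * H x = (f x - H x) * q x + H x * (q x - q 0) by ring.
apply: le_trans (nmD _ _) _; rewrite [leRHS]mulrDl; apply: lerD; rewrite nmM.
  rewrite mulrAC; apply: ler_pM; rewrite ?nm_ge0 //; first exact: h.
  rewrite -[q x](subrK (q 0)); apply: le_trans (nmD _ _) _; rewrite lerD2r.
  apply: le_trans (h' x s s0 se' hx) _; exact: ler_wpM2l.
rewrite exprSr mulrACA; apply: ler_pM; rewrite ?nm_ge0 //; last exact: h'.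
exact: hform_le_bound.
Qed.

Lemma leading_near n (f g : 'rV[K]_n -> K) m H : near0 (fun x => f x = g x) ->
  leading f m H -> leading g m H.
Proof.
move=> /near0_le[e' e'0 he] [C [e [C0 e0 h]]]; exists C, (Num.min e e'); split=> //.
  by rewrite lt_min e0.
move=> x s s0; rewrite le_min => /andP[se se'] hx; rewrite -he; first exact: h.
by move=> i; apply: le_trans (hx i) se'.
Qed.

End Leading.

(** * The discriminant of a reduced Weierstrass polynomial *)

Section NearZero.
Variable K : numFieldType.

Lemma near0_imp n (P Q : 'rV[K]_n -> Prop) :
  near0 P -> (forall x, P x -> Q x) -> near0 Q.
Proof. by rewrite /near0 => hP h; exact (filterS h hP). Qed.

Lemma near0_and n (P Q : 'rV[K]_n -> Prop) :
  near0 P -> near0 Q -> near0 (fun x => P x /\ Q x).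
Proof. by rewrite /near0 => hP hQ; exact (filterI hP hQ). Qed.

Lemma near0_forall n (I : finType) (P : I -> 'rV[K]_n -> Prop) :
  (forall i, near0 (P i)) -> near0 (fun x => forall i, P i x).
Proof. by rewrite /near0 => h; exact (filter_forall _ h). Qed.

End NearZero.

Section Discriminant.
Variable R : realType.
Notation K := R[i].

Lemma near0_at0 n (P : 'rV[K]_n -> Prop) : near0 P -> P 0.
Proof. by move=> /near0_le[e e0]; apply=> i; rewrite mxE nm0 ltW. Qed.

Lemma near0_mulmx m n (A : 'M[K]_(m, n)) P : near0 P -> near0 (fun x => P (x *m A)).
Proof.
move=> /near0_le[e e0 h]; apply/near0_le; exists (e / (1 + mx_size A)).
  by rewrite divr_gt0 // ltr_wpDr // mx_size_ge0.
move=> x hx; apply: h => i; apply: le_trans (bounded_by_mulmx _ _ hx i) _.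
  by rewrite divr_ge0 ?addr_ge0 ?mx_size_ge0 // ltW.
rewrite mulrA ler_pdivrMr ?ltr_wpDr ?mx_size_ge0 // mulrC.
by apply: ler_wpM2l; rewrite ?lerDr // ltW.
Qed.

Lemma analytic_small n (q : 'rV[K]_n -> K) d : analytic q -> q 0 = 0 -> 0 < d ->
  near0 (fun x => nm (q x) <= d).
Proof.
move=> /analytic_lipschitz0[C [e [C0 e0 h]]] q0 d0.
have C1 : 0 < C + 1 by rewrite ltr_wpDl.
pose s := Num.min e (d / (C + 1)).
have s0 : 0 < s by rewrite lt_min e0 divr_gt0.
have se : s <= e by rewrite ge_min lexx.
have sd : s <= d / (C + 1) by rewrite ge_min lexx orbT.
apply/near0_le; exists s => // x hx.
have := h x s (ltW s0) se hx; rewrite q0 subr0 => /le_trans; apply.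
apply: le_trans (_ : (C + 1) * (d / (C + 1)) <= d); last by rewrite mulrC divfK // gt_eqF.
by apply: ler_pM => //; rewrite ?lerDl // ltW.
Qed.

(* McCoy: cofactors of a maximal generically nonsingular minor give a kernel
   vector with analytic entries. *)
Lemma analytic_kernel n N (M : 'rV[K]_n -> 'M[K]_N) :
  (forall i j, analytic (fun y => M y i j)) -> near0 (fun y => \det (M y) = 0) ->
  exists u : 'rV[K]_n -> 'rV[K]_N,
    [/\ forall j, analytic (fun y => u y 0 j), ~ near0 (fun y => u y = 0)
      & near0 (fun y => u y *m M y = 0)].
Proof.
move=> hM detM.
(* Repeated rows and columns are allowed: their minors are zero anyway, and bordering by a column
   that is already present needs no special case. *)
pose Q r := `[< forall (f g : 'I_r -> 'I_N), near0 (fun y => \det (mxsub f g (M y)) = 0) >].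
have QN : Q N.
  apply/asboolP => f g; apply: near0_imp detM _ => y e.
  have -> : mxsub f g (M y) = rowsub f 1%:M *m M y *m colsub g 1%:M.
    by rewrite mulmx_colsub mulmx1 mul_rowsub_mx mul1mx; apply/matrixP => i j; rewrite !mxE.
  by rewrite !det_mulmx e mulr0 mul0r.
case: (ex_minnP (ex_intro _ N QN)) => -[|r] /asboolP hr min_r.
  have /near0_at0 := hr (ffun0 (card_ord 0)) (ffun0 (card_ord 0)).
  by rewrite det_mx00 => /eqP; rewrite oner_eq0.
have /asboolPn nQ : ~~ Q r by apply/negP => /min_r; rewrite ltnn.
have [f nf] : exists f : 'I_r -> 'I_N, ~ forall g : 'I_r -> 'I_N,
    near0 (fun y => \det (mxsub f g (M y)) = 0) by exact/existsNP.
have {nf}[g nfg] : exists g : 'I_r -> 'I_N,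
    ~ near0 (fun y => \det (mxsub f g (M y)) = 0) by exact/existsNP.
have rN : (r < N)%N by exact: min_r _ QN.
have [i0 hi0] : exists i0, i0 \notin codom f.
  apply/existsP; rewrite -negb_forall; apply/negP => /forallP h.
  have : (N <= r)%N.
    rewrite -[N]card_ord -[X in (_ <= X)%N]card_ord -(size_codom f).
    apply: leq_trans (card_size _); apply: subset_leq_card; apply/fintype.subsetP => i _.
    exact: h.
  by rewrite leqNgt rN.
(* The minor (f, g), not identically 0 near the origin, is bordered by row [i0] and column [j0]. The
   cofactors along the new column do not depend on [j0], so [i0] serves as placeholder for it in
   [c]. Column [j0] of the product u M is the bordered minor, hence 0; entry [i0] of u is the minor
   (f, g), since [i0] is not a row of [f]. *)
pose F (k : 'I_r.+1) := if unlift ord0 k is Some k' then f k' else i0.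
pose G j0 (k : 'I_r.+1) := if unlift ord0 k is Some k' then g k' else j0.
pose c y k := cofactor (mxsub F (G i0) (M y)) k ord0.
exists (fun y => \row_i \sum_(k | F k == i) c y k); split.
- move=> i; apply: analytic_ext (_ : analytic (fun y => \sum_(k | F k == i) c y k)) _;
    last by move=> y; rewrite mxE.
  apply: analytic_sum => k _; apply: analyticM; first exact: analytic_cst.
  apply: analytic_det => a b.
  by apply: analytic_ext (hM (F (lift k a)) (G i0 (lift ord0 b))) _ => y; rewrite !mxE.
- move=> h; apply: nfg; apply: near0_imp h _ => y /matrixP/(_ 0 i0); rewrite !mxE.
  rewrite (bigD1 ord0) /=; last by rewrite /F unlift_none.
  rewrite big1 ?addr0 => [|k /andP[/eqP Fk k0]].
    rewrite /c /cofactor addn0 expr0 mul1r => <-; congr (\det _); apply/matrixP => a b.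
    by rewrite !mxE /F /G !liftK.
  move: Fk k0; rewrite /F; case: unliftP => [k' _ fk|-> _]; last by rewrite eqxx.
  by case/negP: hi0; rewrite -fk codom_f.
- have : near0 (fun y => forall j0, \det (mxsub F (G j0) (M y)) = 0).
    by apply: near0_forall => j0; apply: hr.
  move=> h; apply: near0_imp h _ => y h; apply/rowP => j0; rewrite !mxE.
  rewrite -[RHS](h j0) (expand_det_col _ ord0).
  under [LHS] eq_bigr => i _ do rewrite mxE mulr_suml.
  rewrite (exchange_big_dep xpredT) //=; apply: eq_bigr => k _.
  rewrite (big_pred1 (F k)) => [|i]; last by rewrite /= eq_sym.
  rewrite mulrC !mxE /G unlift_none; congr (_ * _).
  rewrite /c /cofactor; congr (_ * \det _); apply/matrixP => a b.
  by rewrite !mxE /G liftK.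
Qed.

(** The Sylvester matrix with block sizes as parameters: in [resultant] they are computed from the
    polynomials, so the type of the matrix would vary with the point y. *)
Definition band_mx a b (p q : {poly K}) : 'M[K]_(a + b) :=
  col_mx (lin1_mx (poly_rV \o p \o* rVpoly)) (lin1_mx (poly_rV \o q \o* rVpoly)).

Lemma resultant_band a b (p q : {poly K}) : size p = b.+1 -> size q = a.+1 ->
  resultant p q = \det (band_mx a b p q).
Proof.
move=> hp hq; have -> : resultant p q = \det (band_mx (size q).-1 (size p).-1 p q) by [].
by rewrite hp hq.
Qed.

Lemma band_mxE a b (p q : {poly K}) i j : band_mx a b p q i j =
  match fintype.split i with
  | inl k => p`_(j - k) *+ (k <= j)
  | inr k => q`_(j - k) *+ (k <= j)
  end.
Proof.
rewrite mxE; case: (fintype.split i) => k /[!mxE] /=;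
  by rewrite rVpoly_delta coefXnM ltnNge if_neg -mulrb.
Qed.

Lemma band_kernel a b (p q : {poly K}) (u : 'rV[K]_(a + b)) :
  size p = b.+1 -> size q = a.+1 -> u *m band_mx a b p q = 0 ->
  rVpoly (lsubmx u) * p + rVpoly (rsubmx u) * q = 0.
Proof.
move=> hp hq; rewrite -{1}[u]hsubmxK mul_row_col !mul_rV_lin1 /=.
rewrite -linearD /= => h; rewrite -[LHS](@poly_rV_K _ (a + b)) ?h ?linear0 //.
have sM (c d : {poly K}) k l : (size c <= k)%N -> size d = l.+1 -> (size (c * d)%R <= k + l)%N.
  move=> hc hd; apply: leq_trans (size_polyMleq _ _) _.
  by rewrite hd addnS /= leq_add2r.
apply: leq_trans (size_polyD _ _) _; rewrite geq_max sM ?size_poly //=.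
by rewrite addnC sM ?size_poly.
Qed.

(* A root of p of multiplicity k has multiplicity k - 1 in p^`(). *)
Lemma root_cofactor (p A B : {poly K}) z : p != 0 ->
  A * p + B * p^`() = 0 -> root p z -> root B z.
Proof.
move=> p0 e pz; have [k [r]] := multiplicity_XsubC p z; rewrite p0 /= => rz pE.
case: k pE => [|k] pE; first by rewrite pE expr0 mulr1 (negPf rz) in pz.
have X0 : ('X - z%:P) ^+ k != 0 by rewrite expf_neq0 // polyXsubC_eq0.
have : (A * r * ('X - z%:P) + B * (r^`() * ('X - z%:P) + r *+ k.+1)) * ('X - z%:P) ^+ k = 0.
  rewrite -[RHS]e pE derivM deriv_exp derivXsubC mul1r /= exprS.
  by rewrite -[r *+ k.+1]mulr_natl -[_ ^+ k *+ k.+1]mulr_natl; ring.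
move/eqP; rewrite mulf_eq0 (negPf X0) orbF => /eqP/(congr1 (fun q => q.[z])).
rewrite !(hornerD, hornerM, hornerN, hornerX, hornerC, hornerMn, horner0) subrr !mulr0 !add0r.
move/eqP; rewrite mulf_eq0 mulrn_eq0 /=; case/orP => // /eqP rz0.
by case/negP: rz; apply/eqP.
Qed.

Lemma poly_lipschitz (Q : {poly K}) z : exists2 L, 0 <= L &
  forall t, nm t <= 1 -> nm (Q.[z + t] - Q.[z]) <= L * nm t.
Proof.
have [L L0 h] := poly_lipschitz0 (Q \Po ('X + z%:P)); exists L => // t /h.
have e s : (Q \Po ('X + z%:P)).[s] = Q.[z + s] by rewrite horner_comp !hornerE addrC.
by rewrite !e addr0.
Qed.

(** A root z of p is a root of b, and both are divided by X - z. The bound persists for the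
    quotients away from z by cancellation, and at z by continuity; the disc of radius 2 e leaves
    room around every root for this limit. *)
Lemma dvdp_of_bound (p b : {poly K}) (C e : R) : 0 <= C -> 0 < e -> p != 0 ->
  (forall z, root p z -> nm z <= e) ->
  (forall z, nm z <= 2 * e -> nm b.[z] <= C * nm p.[z]) -> p %| b.
Proof.
move=> C0 e0; move: {2}(size p) (leqnn (size p)) => N.
elim: N p b => [|N IH] p b sp p0 hr hb.
  by rewrite leqn0 size_poly_eq0 (negPf p0) in sp.
have [s1|s1] := leqP (size p) 1.
  rewrite (size1_polyC s1); apply: dvdp_trans (dvd1p b).
  rewrite dvdp1 size_polyC; suff -> : p`_0 != 0 by [].
  by apply: contraNneq p0 => pc; rewrite (size1_polyC s1) pc.
have /closed_rootP[z pz] : size p != 1%N by rewrite neq_ltn s1 orbT.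
have z_le := hr z pz.
have bz : root b z.
  have := hb z; rewrite (rootP pz) nm0 mulr0 => h.
  by apply/rootP/eqP; rewrite -nm_eq0 eq_le nm_ge0 andbT h //; lra.
have /factor_theorem[p1 pE] := pz; have /factor_theorem[b1 bE] := bz.
have X0 : 'X - z%:P != 0 :> {poly K} by rewrite polyXsubC_eq0.
have p10 : p1 != 0 by apply: contraNneq p0 => p1e; rewrite pE p1e mul0r.
rewrite pE bE dvdp_mul2r //; apply: IH => //.
- by move: sp; rewrite pE size_Mmonic ?monicXsubC // size_XsubC addn2 /=.
- by move=> t tr; apply: hr; rewrite pE rootM tr.
have far t : t != z -> nm t <= 2 * e -> nm b1.[t] <= C * nm p1.[t].
  move=> tz /hb; rewrite pE bE !hornerM !nmM mulrA ler_pM2r //.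
  by rewrite nm_gt0 hornerXsubC subr_eq0.
move=> t te; have [->{t te}|tz] := eqVneq t z; last exact: far.
have [Lb Lb0 hLb] := poly_lipschitz b1 z; have [Lp Lp0 hLp] := poly_lipschitz p1 z.
rewrite -subr_le0; have e10 : 0 < Num.min e 1 by rewrite lt_min e0 ltr01.
apply: (le0_small (C := Lb + C * Lp) e10) => d d0; rewrite le_min => /andP[de d1].
have nd : nm d%:C = d by rewrite nm_real // ltW.
have dz : z + d%:C != z by rewrite -subr_eq0 addrAC subrr add0r -nm_gt0 nd.
have zd : nm (z + d%:C) <= 2 * e.
  by apply: le_trans (nmD _ _) _; rewrite nd; lra.
have := far _ dz zd; have := hLb d%:C; have := hLp d%:C; rewrite nd.
move=> /(_ d1) h1 /(_ d1) h2 h3.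
have h4 : nm b1.[z] <= nm b1.[z + d%:C] + nm (b1.[z + d%:C] - b1.[z]).
  by rewrite -{1}[b1.[z]](subKr b1.[z + d%:C]); apply: le_trans (nmD _ _) _; rewrite nmN.
have h5 : nm p1.[z + d%:C] <= nm p1.[z] + Lp * d.
  rewrite -[p1.[z + d%:C]](subrK p1.[z]) addrC; apply: le_trans (nmD _ _) _.
  by rewrite lerD2l.
have h6 := ler_wpM2l C0 h5; lra.
Qed.

(** Near 0 the lower coefficients are at most e^n / (n + 1). If |z| > e, each of the n lower terms
    is at most |z|^n / (n + 1), so they cannot cancel z^n. *)
Lemma weierstrass_root_small n (F : 'rV[K]_2 -> {poly K}) e :
  weierstrass_polynomial n F -> 0 < e ->
  near0 (fun y => forall z, root (F y) z -> nm z <= e).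
Proof.
move=> [hmon hsize han h0] e0; wlog e1 : e e0 / e <= 1 => [hw|].
  apply: near0_imp (hw (Num.min e 1) _ _) _ => [||y h z /h].
  - by rewrite lt_min e0 ltr01.
  - by rewrite ge_min lexx orbT.
  - by rewrite le_min => /andP[].
have d0 : 0 < e ^+ n / n.+1%:R by rewrite divr_gt0 // exprn_gt0.
have : near0 (fun y => forall i : 'I_n, nm (F y)`_i <= e ^+ n / n.+1%:R).
  apply: near0_forall => i; apply: analytic_small => //; last exact: h0.
  exact/analytic_germ_analytic/han.
move=> h; apply: near0_imp h _ => y h z /rootP.
rewrite horner_coef hsize big_ord_recr /=.
have -> : (F y)`_n = 1 by have /monicP := hmon y; rewrite lead_coefE hsize.
rewrite mul1r => /eqP; rewrite addrC addr_eq0 => /eqP zn; rewrite leNgt; apply/negP => ze.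
have c1 : 1 <= nm z / e by rewrite ler_pdivlMr // mul1r ltW.
have : nm z ^+ n <= n%:R * (e ^+ n / n.+1%:R * (nm z / e) ^+ n).
  rewrite -nmX zn nmN; apply: le_trans (nm_sum _ _ _) _.
  rewrite -[n%:R]/(n%:R) -[in n%:R](card_ord n) mulr_natl -sumr_const.
  apply: ler_sum => i _; rewrite nmM nmX; apply: ler_pM; rewrite ?nm_ge0 ?exprn_ge0 ?nm_ge0 //.
  have -> : nm z ^+ i = (nm z / e) ^+ i * e ^+ i by rewrite -exprMn divfK // gt_eqF.
  apply: le_trans (_ : (nm z / e) ^+ i <= _).
    by rewrite ler_piMr ?exprn_ge0 ?divr_ge0 ?nm_ge0 ?exprn_ile1 // ltW.
  by rewrite ler_weXn2l // ltnW.
have -> : nm z ^+ n = (nm z / e) ^+ n * e ^+ n by rewrite -exprMn divfK // gt_eqF.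
rewrite mulrA mulrC ler_pM2r ?exprn_gt0 ?(lt_le_trans ltr01) //.
rewrite mulrCA ler_pMr ?exprn_gt0 // ler_pdivlMr // mul1r ler_nat ltnn //.
Qed.

Lemma analytic_horner m n (A : 'M[K]_(m, n)) (l : 'cV[K]_m) N (B : 'rV[K]_n -> {poly K}) :
  (forall i, (i < N)%N -> analytic (fun y => (B y)`_i)) -> (forall y, (size (B y) <= N)%N) ->
  analytic (fun x => (B (x *m A)).[(x *m l) 0 0]).
Proof.
move=> hB sB; apply: analytic_ext (_ : analytic (fun x =>
    \sum_(i < N) (B (x *m A))`_i * (x *m l) 0 0 ^+ i)) _; last first.
  by move=> x; rewrite (horner_coef_wide _ (sB _)).
apply: analytic_sum => i _; apply: analyticM; last exact/analyticX/analytic_linear.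
by apply: analytic_mulmx (fun y => (B y)`_i) (hB i (ltn_ord i)).
Qed.

(** [E] and [w] are the row blocks of the inverse of [row_mx P l]: [E] is the section of the
    projection on which [l] vanishes, [w] spans its kernel. *)
Lemma coordinates (P : 'M[K]_(3, 2)) (l : 'cV[K]_3) : \rank (row_mx P l) = 3%N ->
  exists (E : 'M[K]_(2, 3)) (w : 'rV[K]_3),
    [/\ E *m P = 1%:M, E *m l = 0, w *m P = 0, w *m l = 1%:M & P *m E + l *m w = 1%:M].
Proof.
move=> r3; have u : (row_mx P l : 'M[K]_(2 + 1)) \in unitmx by rewrite -row_free_unit /row_free r3.
pose B : 'M[K]_(2 + 1) := invmx (row_mx P l : 'M[K]_(2 + 1)).
exists (usubmx B), (dsubmx B).
have := mulmxV u; rewrite -/B -{1}[B]vsubmxK mul_row_col => ->.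
have := mulVmx u; rewrite -/B -{1}[B]vsubmxK mul_col_row (@scalar_mx_block _ 2 1 1).
by move/eq_block_mx => [-> -> -> ->].
Qed.

Lemma size_deriv_weierstrass n (F : 'rV[K]_2 -> {poly K}) y :
  weierstrass_polynomial n.+1 F -> size (F y)^`() = n.+1.
Proof.
move=> [hmon hsize _ _].
apply/eqP; rewrite eqn_leq -ltnS -[in X in (_ < X)%N](hsize y) lt_size_deriv ?monic_neq0 //=.
rewrite ltnNge; apply/negP => /leq_sizeP/(_ n (leqnn _))/eqP.
have /monicP := hmon y; rewrite lead_coefE hsize coef_deriv => ->.
by rewrite pnatr_eq0.
Qed.

Lemma weierstrass0 (F : 'rV[K]_2 -> {poly K}) y : weierstrass_polynomial 0 F -> F y = 1%:P.
Proof.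
move=> [hmon hsize _ _]; have /monicP := hmon y; rewrite lead_coefE hsize /= => <-.
by rewrite -size1_polyC // hsize.
Qed.

Lemma band_analytic n (F : 'rV[K]_2 -> {poly K}) i j : weierstrass_polynomial n.+1 F ->
  analytic (fun y => band_mx n n.+1 (F y) (F y)^`() i j).
Proof.
move=> [_ _ han _].
have Fan k : analytic (fun y => (F y)`_k) by exact/analytic_germ_analytic/han.
have natan c (f : 'rV[K]_2 -> K) : analytic f -> analytic (fun y => f y *+ c).
  by move=> hf; apply: analytic_ext (analyticM (analytic_cst 2 c%:R) hf) _ => y; rewrite mulr_natl.
case: (splitP i) => k ik.
  apply: analytic_ext (_ : analytic (fun y => (F y)`_(j - k) *+ (k <= j))) _; first exact: natan.
  move=> y; rewrite band_mxE; case: splitP => k' ik'.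
    by rewrite (_ : k = k') //; apply: val_inj; rewrite /= -ik ik'.
  by have := ltn_ord k; rewrite -ik ik' ltnNge leq_addr.
apply: analytic_ext (_ : analytic (fun y => (F y)`_(j - k).+1 *+ (j - k).+1 *+ (k <= j))) _.
  exact/natan/natan.
move=> y; rewrite band_mxE; case: splitP => k' ik'.
  by have := ltn_ord k'; rewrite -ik' ik ltnNge leq_addr.
by rewrite (_ : k' = k) ?coef_deriv //; apply: val_inj; apply/eqP; rewrite -(eqn_add2l n) -ik ik'.
Qed.

Lemma discriminant_analytic n (F : 'rV[K]_2 -> {poly K}) : weierstrass_polynomial n F ->
  analytic_germ (fun y => discriminant (F y)).
Proof.
move=> hF; apply: analytic_analytic_germ; case: n hF => [|n] hF.
  apply: analytic_ext (analytic_cst 2 (discriminant (1%:P : {poly K}))) _ => y.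
  by rewrite (weierstrass0 y hF).
have [_ hsize _ _] := hF.
apply: analytic_ext (analyticM (analytic_cst 2 ((-1) ^+ 'C(n.+1, 2)))
  (analytic_det (fun i j => band_analytic i j hF))) _ => y.
by rewrite /discriminant (resultant_band (hsize y) (size_deriv_weierstrass y hF)) hsize.
Qed.

(* If the discriminant vanished, a kernel vector of the Sylvester matrix would
   give B of degree < n in x3, not zero, with F | B F'; then B vanishes on X, so
   F | B since F is reduced, which is impossible for reasons of degree. *)
Lemma reduced_discriminant_neq0 (X : set 'rV[K]_3) (P : 'M[K]_(3, 2)) (l : 'cV[K]_3)
    n (F : 'rV[K]_2 -> {poly K}) :
  X 0 -> \rank (row_mx P l) = 3%N -> weierstrass_polynomial n F ->
  reduced_equation X (fun x => (F (x *m P)).[(x *m l) 0 0]) ->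
  ~ near0 (fun y => discriminant (F y) = 0).
Proof.
move=> X0 hr hF [fan _ fX fdiv] disc0.
have [hmon hsize han h0] := hF.
have [E [w [EP El wP wl _]]] := coordinates hr.
have Fn0 y : F y != 0 by rewrite monic_neq0.
case: n hF hsize h0 => [|n] hF hsize h0.
  have := near0_at0 fX; rewrite mul0mx (weierstrass0 0 hF) hornerC => -[/(_ X0)/eqP].
  by rewrite oner_eq0.
have sdF y := size_deriv_weierstrass y hF.
pose M y := band_mx n n.+1 (F y) (F y)^`().
have hM i j := band_analytic i j hF.
have detM : near0 (fun y => \det (M y) = 0).
  apply: near0_imp disc0 _ => y; rewrite /discriminant (resultant_band (hsize y) (sdF y)).
  by move/eqP; rewrite mulf_eq0 expf_eq0 oppr_eq0 oner_eq0 andbF => /eqP.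
have [u [uan un0 uM]] := analytic_kernel hM detM.
pose A y := rVpoly (lsubmx (u y)); pose B y := rVpoly (rsubmx (u y)).
have AB y : u y *m M y = 0 -> A y * F y + B y * (F y)^`() = 0.
  exact: band_kernel.
have sB y : (size (B y) <= n.+1)%N by exact: size_poly.
have Ban i : (i < n.+1)%N -> analytic (fun y => (B y)`_i).
  move=> hi; apply: analytic_ext (uan (rshift n (Ordinal hi))) _ => y.
  by rewrite /B (coef_rVpoly_ord (rsubmx (u y)) (Ordinal hi)) mxE.
pose g x := (B (x *m P)).[(x *m l) 0 0].
have gan : analytic_germ g by apply/analytic_analytic_germ/analytic_horner; [exact: Ban|exact: sB].
have gX : vanishes_on X g.
  have h := near0_and fX (near0_mulmx P uM).
  apply: near0_imp h _ => x [fx /AB e] /fx fx0.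
  by apply/rootP; apply: root_cofactor e _ => //; apply/rootP.
have [q /analytic_germ_analytic qan gq] := fdiv g gan gX.
have [C [e [C0 e0 hq]]] := analytic_lipschitz0 qan.
have /near0_le[e' e'0 {}gq] := gq.
pose d := Num.min e e'; have d0 : 0 < d by rewrite lt_min e0 e'0.
apply: un0; pose c := d / (mx_size E + 2 * (mx_size w) + 1).
(* [c] keeps y E + z w in the polydisc of radius [d] as long as |y| <= c and |z| <= 2 c. *)
have D0 : 0 < mx_size E + 2 * mx_size w + 1.
  by rewrite ltr_wpDl // addr_ge0 ?mulr_ge0 ?mx_size_ge0.
have c0 : 0 < c by rewrite divr_gt0.
have hy : near0 (fun y : 'rV[K]_2 => bounded_by y c) by apply/near0_le; exists c.
have h := near0_and (near0_and hy uM) (weierstrass_root_small hF c0).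
apply: near0_imp h _ => y [[yc /AB ABy] rootF].
(* The relation g = f q bounds [B y] by a constant times [F y] on |z| <= 2 c, while all roots of
   [F y] satisfy |z| <= c. *)
have dvd : F y %| B y.
  have Q0 : 0 <= C * d + nm (q 0) by rewrite addr_ge0 ?mulr_ge0 ?nm_ge0 // ltW.
  apply: (dvdp_of_bound Q0 c0) => // z z2.
  pose x := y *m E + z *: w.
  have xP : x *m P = y by rewrite mulmxDl -mulmxA EP mulmx1 -scalemxAl wP scaler0 addr0.
  have xl : (x *m l) 0 0 = z.
    by rewrite mulmxDl -mulmxA El mulmx0 add0r -scalemxAl wl !mxE mulr1.
  have xd : bounded_by x d.
    move=> i; rewrite mxE; apply: le_trans (nmD _ _) _.
    have h1 : nm ((y *m E) 0 i) <= mx_size E * c by apply: bounded_by_mulmx; rewrite // ltW.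
    have h2 : nm ((z *: w) 0 i) <= mx_size w * (2 * c).
      rewrite mxE nmM mulrC; apply: ler_pM; rewrite ?nm_ge0 //.
      rewrite /mx_size big_ord1 (bigD1 i) //= lerDl.
      by apply: sumr_ge0 => k _; apply: nm_ge0.
    apply: le_trans (lerD h1 h2) _.
    apply: le_trans (_ : c * (mx_size E + 2 * mx_size w + 1) <= _).
      by rewrite mulrDr mulr1 [c * _]mulrC; have := mx_size_ge0 E; nra.
    by rewrite /c divfK // gt_eqF.
  have := gq x _; rewrite /g xP xl => -> //; last first.
    by move=> i; apply: le_trans (xd i) _; rewrite ge_min lexx orbT.
  rewrite nmM mulrC ler_wpM2r ?nm_ge0 //.
  have := hq x d (ltW d0) _ xd; rewrite ge_min lexx => /(_ isT) h1.
  by rewrite -[q x](subrK (q 0)); apply: le_trans (nmD _ _) _; rewrite lerD2r.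
have By : B y = 0.
  apply/eqP; apply: contraTT dvd => B0; apply/negP => /(dvdp_leq B0).
  by rewrite hsize leqNgt ltnS sB.
have Ay : A y = 0.
  move: ABy; rewrite By mul0r addr0 => /eqP; rewrite mulf_eq0 (negPf (Fn0 y)) orbF.
  by move/eqP.
by rewrite -[u y]hsubmxK -[lsubmx _]rVpolyK -[rsubmx _]rVpolyK -/(A y) -/(B y) Ay By !linear0 row_mx0.
Qed.

End Discriminant.

(** * Power series in one variable *)

Section PowerSeries.
Variable R : realType.
Notation K := R[i].
Implicit Types (phi psi : K -> K) (c d : nat -> K).

(** Read on rows of length 1, so that the closure properties of [expands] apply. *)
Definition power_series phi c :=
  expands (fun u : 'rV[K]_1 => phi (u 0 0)) (fun j u => c j * u 0 0 ^+ j).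

Lemma power_series_bound phi c : power_series phi c ->
  exists C B, [/\ 0 <= C, 0 < B & forall j, nm (c j) <= C * B ^+ j].
Proof.
move=> [C [B [C0 B0 [h _]]]]; exists C, B; split=> // j.
have b1 : bounded_by (const_mx 1 : 'rV[K]_1) 1 by move=> i; rewrite mxE nm1.
by have := hform_le_bound (h j) ler01 b1; rewrite mxE !expr1n !mulr1.
Qed.

(* The limit is the supremum of the lower bounds S_N - 2 C q^N. *)
Lemma real_series (u : nat -> R) (C q : R) : 0 <= C -> 0 <= q -> q <= 2^-1 ->
  (forall j, `|u j| <= C * q ^+ j) ->
  exists l, forall N, `|l - \sum_(j < N) u j| <= C * 2 * q ^+ N.
Proof.
move=> C0 q0 q1 hu; pose S N := \sum_(j < N) u j.
have tail N k : `|S (N + k)%N - S N| <= C * 2 * q ^+ N.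
  rewrite /S big_split_ord /= addrAC subrr add0r.
  apply: le_trans (ler_norm_sum _ _ _) _.
  apply: (@le_trans _ _ (\sum_(j < k) C * q ^+ N * 2^-1 ^+ j)).
    apply: ler_sum => j _; apply: le_trans (hu _) _; rewrite exprD mulrA.
    by rewrite ler_wpM2l ?mulr_ge0 ?exprn_ge0 //; apply: lerXn2r; rewrite // nnegrE invr_ge0.
  rewrite -mulr_sumr mulrAC ler_wpM2r ?exprn_ge0 // ler_wpM2l //.
  exact: half_geometric.
pose t N := C * 2 * q ^+ N.
have lo_hi N M : S N - t N <= S M + t M.
  have tM : 0 <= t M by rewrite !mulr_ge0 // exprn_ge0.
  have tN : 0 <= t N by rewrite !mulr_ge0 // exprn_ge0.
  have [NM|MN] := leqP N M.
    have := tail N (M - N)%N; rewrite subnKC // -/(t N) ler_norml; lra.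
  have := tail M (N - M)%N; rewrite subnKC 1?ltnW // -/(t M) ler_norml; lra.
pose E := [set x | exists N, x = S N - t N].
have ubE M : ubound E (S M + t M) by move=> _ [N ->].
exists (sup E) => N; rewrite ler_norml; apply/andP; split.
  have : S N - t N <= sup E.
    by apply: ub_le_sup; [exists (S 0%N + t 0%N); exact: ubE|exists N].
  rewrite -/(S N) -/(t N); lra.
have : sup E <= S N + t N.
  by apply: ge_sup; [exists (S 0%N - t 0%N); exists 0%N|exact: ubE].
rewrite -/(S N) -/(t N); lra.
Qed.

Lemma Re_sum (I : Type) (r : seq I) (F : I -> K) :
  complex.Re (\sum_(i <- r) F i) = \sum_(i <- r) complex.Re (F i).
Proof. by elim/big_rec2: _ => // i x y _ <-; case: (F i) y => ? ? [? ?]. Qed.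

Lemma Im_sum (I : Type) (r : seq I) (F : I -> K) :
  complex.Im (\sum_(i <- r) F i) = \sum_(i <- r) complex.Im (F i).
Proof. by elim/big_rec2: _ => // i x y _ <-; case: (F i) y => ? ? [? ?]. Qed.

Lemma power_series_exists c C B : 0 <= C -> 0 < B ->
  (forall j, nm (c j) <= C * B ^+ j) -> exists phi, power_series phi c.
Proof.
move=> C0 B0 hc.
have : forall t, exists l, B * 2 * nm t <= 1 ->
    forall N, nm (l - \sum_(j < N) c j * t ^+ j) <= C * 4 * (B * nm t) ^+ N.
  (* [real_series] needs the ratio B |t| to be at most 1/2, which explains the final [B * 2]; it is
     applied to real and imaginary parts, each with constant 2 C, whence [C * 4]. Outside the disc
     the value is arbitrary. *)
  move=> t; case: (boolP (B * 2 * nm t <= 1)) => [h|_]; last by exists 0.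
  have q0 : 0 <= B * nm t by rewrite mulr_ge0 ?nm_ge0 // ltW.
  have q1 : B * nm t <= 2^-1 by lra.
  have hu j : nm (c j * t ^+ j) <= C * (B * nm t) ^+ j.
    by rewrite nmM nmX exprMn mulrA ler_wpM2r // exprn_ge0 // nm_ge0.
  have [a ha] := real_series C0 q0 q1 (fun j => le_trans (nm_Re _) (hu j)).
  have [b hb] := real_series C0 q0 q1 (fun j => le_trans (nm_Im _) (hu j)).
  exists (a +i* b) => _ N; apply: le_trans (nm_le_ReIm _) _.
  have -> : C * 4 * (B * nm t) ^+ N = C * 2 * (B * nm t) ^+ N + C * 2 * (B * nm t) ^+ N by ring.
  apply: lerD; [move: (ha N)|move: (hb N)]; rewrite -?Re_sum -?Im_sum;
    by case: (\sum_(j < N) _).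
move=> /choice[phi hphi]; exists phi, (C * 4), (B * 2); split.
- by rewrite mulr_ge0.
- by rewrite mulr_gt0.
split=> [j|N u s s0 hs hu].
  apply: (@hform_le _ _ _ (nm (c j) * 1)).
    by apply: hformZ; have := hformX j (hform_coord R (0 : 'I_1)); rewrite muln1 expr1n.
  rewrite mulr1; apply: le_trans (hc j) _; apply: ler_pM => //; first by rewrite exprn_ge0 // ltW.
    by rewrite ler_peMr // ler1n.
  by apply: lerXn2r; rewrite ?nnegrE ?mulr_ge0 ?ler_peMr ?ler1n // ltW.
have us := hu 0.
apply: le_trans (hphi (u 0 0) _ N) _.
  by apply: le_trans hs; rewrite ler_wpM2l // mulr_ge0 // ltW.
have h0 : 0 <= B * nm (u 0 0) by rewrite mulr_ge0 ?nm_ge0 // ltW.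
have h1 : B * nm (u 0 0) <= B * s by rewrite ler_wpM2l // ltW.
by rewrite ler_wpM2l ?mulr_ge0 //; apply: lerXn2r; rewrite ?nnegrE; lra.
Qed.

Lemma power_series_ext phi psi c d :
  power_series phi c -> phi =1 psi -> c =1 d -> power_series psi d.
Proof. by move=> h e ec; apply: expands_ext h _ _ => [u|j u]; rewrite ?e ?ec. Qed.

Lemma power_seriesM phi psi c d : power_series phi c -> power_series psi d ->
  power_series (fun t => phi t * psi t) (fun j => \sum_(i < j.+1) c i * d (j - i)%N).
Proof.
move=> hc hd; apply: expands_ext (expandsM hc hd) _ _ => // j u.
rewrite mulr_suml; apply: eq_bigr => i _.
by rewrite mulrACA -exprD subnKC // -ltnS.
Qed.

Lemma power_series_sum (I : Type) (r : seq I) (phi : I -> K -> K) (c : I -> nat -> K) :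
  (forall i, power_series (phi i) (c i)) ->
  power_series (fun t => \sum_(i <- r) phi i t) (fun j => \sum_(i <- r) c i j).
Proof.
move=> h; apply: expands_ext (expands_sum r h) _ _ => // j u.
by rewrite mulr_suml.
Qed.

Lemma power_series_shift phi c k : power_series phi c ->
  power_series (fun t => phi t * t ^+ k) (fun j => if (k <= j)%N then c (j - k)%N else 0).
Proof.
move=> h; have hX := hformX k (hform_coord R (0 : 'I_1)); rewrite muln1 in hX.
apply: expands_ext (expands_mul_form h hX) _ _ => // j u.
by case: leqP => jk; rewrite ?mul0r // -mulrA -exprD subnK.
Qed.

Lemma power_series_line n (f : 'rV[K]_n -> K) p v : expands f p ->
  power_series (fun t => f (t *: v)) (fun j => p j v).
Proof.
move=> hf; have hp j x t : p j (t *: x) = t ^+ j * p j x.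
  by move: hf => [C [B [_ _ [h _]]]]; apply: hform_homog (h j).
have uv (u : 'rV[K]_1) : u *m v = u 0 0 *: v by rewrite {1}[u]mx11_scalar mul_scalar_mx.
by apply: expands_ext (expands_mulmx v hf) _ _ => [u|j u]; rewrite uv // hp mulrC.
Qed.

Lemma power_series_analytic n phi c (l : 'cV[K]_n) : power_series phi c ->
  analytic (fun x => phi ((x *m l) 0 0)).
Proof. by move=> h; eexists; apply: (expands_mulmx l h). Qed.

End PowerSeries.

(** * Hensel's lemma for convergent power series *)

Section Hensel.
Variable R : realType.
Notation K := R[i].

(** Course-of-values recursion: the value at j no longer changes after j + 1 iterations of F on
    whole sequences. *)
Lemma strong_recursion (T : Type) (t0 : T) (F : nat -> (nat -> T) -> T) :
  (forall j s s', (forall i, (i < j)%N -> s i = s' i) -> F j s = F j s') ->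
  exists s : nat -> T, forall j, s j = F j s.
Proof.
move=> hF; pose it n := iter n (fun s j => F j s) (fun=> t0).
have st j : forall n m, (j < n)%N -> (j < m)%N -> it n j = it m j.
  elim/ltn_ind: j => j IH [//|n] [//|m]; rewrite !ltnS => jn jm.
  by apply: hF => i ij; apply: IH => //; apply: leq_trans ij _.
exists (fun j => it j.+1 j) => j; apply: hF => i ij; exact: st.
Qed.

Lemma ler_sum_ord (b : nat -> R) N N' : (forall i, 0 <= b i) -> (N <= N')%N ->
  \sum_(i < N) b i <= \sum_(i < N') b i.
Proof.
by move=> b0 h; rewrite -(subnKC h) big_split_ord /= lerDl; apply: sumr_ge0.
Qed.

(* The partial sums S_N of a_j eps^(j+1) satisfy S_(N+1) <= eta + G S_N^2,
   hence stay below 2 eta once 4 G eta <= 1. *)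
Lemma quadratic_majorant (a : nat -> R) (G M B : R) :
  (forall j, 0 <= a j) -> 0 <= G -> 0 <= M -> 0 < B ->
  (forall j, a j <= G * (M * B ^+ j.+1 + \sum_(i < j) a i * a (j.-1 - i)%N)) ->
  exists C B', [/\ 0 <= C, 0 < B' & forall j, a j <= C * B' ^+ j.+1].
Proof.
move=> a0 G0 M0 B0 ha.
(* With e = 1 / D, the first summand gives B e <= 1/2, the second 4 G eta <= 1 for eta = 2 G M B e,
   and the third D >= 1. *)
pose D := 2 * B + 8 * G ^+ 2 * M * B + 1.
have D1 : 1 <= D.
  by rewrite /D lerDr addr_ge0 ?mulr_ge0 ?exprn_ge0 // ltW.
have D0 : 0 < D by apply: lt_le_trans D1.
have G2 : 0 <= 8 * G ^+ 2 * M * B by rewrite !mulr_ge0 ?exprn_ge0 // ltW.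
pose e := D^-1; have e0 : 0 < e by rewrite invr_gt0.
have eD : e * D = 1 by rewrite mulVf // gt_eqF.
have Be : B * e <= 2^-1.
  have : B * 2 * e <= D * e by rewrite ler_wpM2r ?(ltW e0) // /D; lra.
  by rewrite [D * e]mulrC eD; lra.
pose eta := G * M * (B * e) * 2.
have eta0 : 0 <= eta by rewrite !mulr_ge0 // ltW.
have eta1 : 4 * G * eta <= 1.
  have -> : 4 * G * eta = (8 * G ^+ 2 * M * B) * e by rewrite /eta; ring.
  apply: le_trans (_ : D * e <= 1); last by rewrite mulrC eD.
  by rewrite ler_wpM2r ?(ltW e0) // /D; lra.
pose b j := a j * e ^+ j.+1; have b0 j : 0 <= b j by rewrite mulr_ge0 // exprn_ge0 // ltW.
pose S N := \sum_(j < N) b j.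
have S0 N : 0 <= S N by apply: sumr_ge0.
have Smono N N' : (N <= N')%N -> S N <= S N' by exact: ler_sum_ord.
have SS N : \sum_(j < N.+1) \sum_(i < j) b i * b (j.-1 - i)%N <= S N ^+ 2.
  rewrite big_ord_recl big_ord0 add0r /=.
  under eq_bigr => j _ do rewrite /bump /= add1n.
  rewrite (triangle_sum b b) expr2 {2}/S mulr_suml; apply: ler_sum => i _.
  by rewrite ler_wpM2l // Smono // leq_subr.
have Sle N : S N <= 2 * eta.
  elim: N => [|N IH]; first by rewrite /S big_ord0 mulr_ge0.
  apply: (@le_trans _ _ (eta + G * S N ^+ 2)); last first.
    have : S N ^+ 2 <= (2 * eta) ^+ 2.
      by rewrite ler_pXn2r ?nnegrE ?S0 // mulr_ge0.
    move/(ler_wpM2l G0); have := ler_wpM2r eta0 eta1; lra.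
  apply: le_trans (_ : \sum_(j < N.+1) (G * M * (B * e) * (B * e) ^+ j +
      G * \sum_(i < j) b i * b (j.-1 - i)%N) <= _).
    apply: ler_sum => j _; rewrite /b.
    have -> : \sum_(i < j) a i * e ^+ i.+1 * (a (j.-1 - i)%N * e ^+ (j.-1 - i).+1) =
        (\sum_(i < j) a i * a (j.-1 - i)%N) * e ^+ j.+1.
      rewrite mulr_suml; apply: eq_bigr => i _; rewrite mulrACA -exprD; congr (_ * _ ^+ _).
      by have := ltn_ord i; lia.
    have -> : G * M * (B * e) * (B * e) ^+ j = G * (M * B ^+ j.+1) * e ^+ j.+1.
      by rewrite !exprMn !exprS; ring.
    rewrite [G * (_ * e ^+ _)]mulrA -mulrDl -mulrDr ler_wpM2r //.
    by rewrite exprn_ge0 // ltW.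
  rewrite big_split /= -!mulr_sumr; apply: lerD; last by rewrite ler_wpM2l // SS.
  rewrite /eta ler_wpM2l ?mulr_ge0 ?(ltW B0) ?(ltW e0) //.
  apply: le_trans (_ : \sum_(i < N.+1) 2^-1 ^+ i <= _); last exact: half_geometric.
  have Be0 : 0 <= B * e by rewrite mulr_ge0 // ltW.
  by apply: ler_sum => i _; apply: lerXn2r; rewrite ?nnegrE ?invr_ge0.
exists (2 * eta), D; split=> //; first by rewrite mulr_ge0.
move=> j; have : b j <= 2 * eta.
  by apply: le_trans (Sle j.+1); rewrite /S big_ord_recr /= lerDr; apply: S0.
by rewrite /b /e exprVn ler_pdivrMr // exprn_gt0.
Qed.

Section Factor.
Variable n : nat.

(** The l1 norm of the truncation at degree n, still submultiplicative. *)
Definition poly_size (p : {poly K}) : R := \sum_(i < n.+1) nm p`_i.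

Lemma poly_size_ge0 p : 0 <= poly_size p.
Proof. by apply: sumr_ge0 => i _; apply: nm_ge0. Qed.

Lemma poly_sizeD p q : poly_size (p + q) <= poly_size p + poly_size q.
Proof. by rewrite -big_split; apply: ler_sum => i _; rewrite coefD nmD. Qed.

Lemma poly_sizeB p q : poly_size (p - q) <= poly_size p + poly_size q.
Proof.
apply: le_trans (poly_sizeD _ _) _; rewrite lerD2l.
by apply: ler_sum => i _; rewrite coefN nmN.
Qed.

Lemma poly_size_sum (I : Type) (r : seq I) (F : I -> {poly K}) :
  poly_size (\sum_(i <- r) F i) <= \sum_(i <- r) poly_size (F i).
Proof.
elim/big_rec2: _ => [|i y x _ h].
  by rewrite /poly_size big1 // => i _; rewrite coef0 nm0.
by apply: le_trans (poly_sizeD _ _) _; rewrite lerD2l.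
Qed.

Lemma poly_sizeZ c p : poly_size (c *: p) = nm c * poly_size p.
Proof. by rewrite mulr_sumr; apply: eq_bigr => i _; rewrite coefZ nmM. Qed.

Lemma poly_sizeM p q : poly_size (p * q) <= poly_size p * poly_size q.
Proof.
apply: (@le_trans _ _ (\sum_(j < n.+1) \sum_(i < j.+1) nm p`_i * nm q`_(j - i)%N)).
  apply: ler_sum => j _; rewrite coefM; apply: le_trans (nm_sum _ _ _) _.
  by apply: ler_sum => i _; rewrite nmM.
rewrite (triangle_sum (fun i => nm p`_i) (fun i => nm q`_i)) mulr_suml.
apply: ler_sum => i _; rewrite ler_wpM2l ?nm_ge0 //.
by apply: (@ler_sum_ord (fun l => nm q`_l)); [move=> l; apply: nm_ge0|apply: leq_subr].
Qed.

Lemma poly_size_coef (p : {poly K}) i : (i < n.+1)%N -> nm p`_i <= poly_size p.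
Proof.
move=> hi; rewrite /poly_size (bigD1 (Ordinal hi)) //= lerDl.
by apply: sumr_ge0 => l _; apply: nm_ge0.
Qed.

Variables (k : nat) (g0 h0 : {poly K}).
Hypotheses (hk : (k <= n)%N) (g0mon : g0 \is monic) (sg0 : size g0 = k.+1).
Hypotheses (sgh0 : (size (g0 * h0)%R <= n.+1)%N) (cop : coprimep g0 h0).

Lemma size_cofactor : (size h0 <= (n - k).+1)%N.
Proof.
have [->|h00] := eqVneq h0 0; first by rewrite size_poly0.
by move: sgh0; rewrite size_monicM // sg0; lia.
Qed.

(** Reducing the first Bezout coefficient modulo [g0] bounds its degree; that of the second follows
    from d g0 = r - c h0. *)
Lemma bezout_bounded (r : {poly K}) : (size r <= n.+1)%N -> exists c : {poly K} * {poly K},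
  [/\ (size c.1 <= k)%N, (size c.2 <= (n - k).+1)%N & c.1 * h0 + c.2 * g0 = r].
Proof.
move=> sr; have /Bezout_eq1_coprimepP[[u v] /= e] := cop.
pose c := (v * r) %% g0; pose d := u * r + (v * r) %/ g0 * h0.
have cd : c * h0 + d * g0 = r.
  have := divp_eq (v * r) g0; rewrite -/c => E.
  have -> : c = v * r - (v * r) %/ g0 * g0 by rewrite {1}E addrAC subrr add0r.
  by rewrite -[RHS]mul1r -e /d; ring.
have sc : (size c <= k)%N by rewrite -ltnS -sg0 ltn_modp monic_neq0.
exists (c, d); split=> //=.
have [->|d0] := eqVneq d 0; first by rewrite size_poly0.
have : (size (d * g0)%R <= n.+1)%N.
  have -> : d * g0 = r - c * h0 by rewrite -cd addrAC subrr add0r.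
  apply: leq_trans (size_polyD _ _) _; rewrite geq_max sr size_polyN.
  apply: leq_trans (size_polyMleq _ _) _.
  by move: (size c) (size h0) sc size_cofactor => a b; lia.
by rewrite size_Mmonic // sg0; move: (size d) => a; lia.
Qed.

(** Solving for the monomials X^i and extending linearly yields a single constant [G] for all
    right-hand sides, as [quadratic_majorant] requires. *)
Lemma bezout_linear : exists (G : R) (T : {poly K} -> {poly K} * {poly K}), 0 <= G /\
  forall r : {poly K}, (size r <= n.+1)%N ->
  [/\ (size (T r).1 <= k)%N, (size (T r).2 <= (n - k).+1)%N,
      (T r).1 * h0 + (T r).2 * g0 = r
    & poly_size (T r).1 + poly_size (T r).2 <= G * poly_size r].
Proof.
have /choice[c hc] : forall i : 'I_n.+1, exists c : {poly K} * {poly K},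
    [/\ (size c.1 <= k)%N, (size c.2 <= (n - k).+1)%N & c.1 * h0 + c.2 * g0 = 'X^i].
  by move=> i; apply: bezout_bounded; rewrite size_polyXn.
pose G := \sum_i (poly_size (c i).1 + poly_size (c i).2).
exists G, (fun r : {poly K} => (\sum_(i < n.+1) r`_i *: (c i).1, \sum_(i < n.+1) r`_i *: (c i).2)).
split; first by apply: sumr_ge0 => i _; rewrite addr_ge0 ?poly_size_ge0.
move=> r sr /=; split.
- apply: (leq_trans (size_sum _ _ _)); apply/bigmax_leqP => i _.
  by apply: leq_trans (size_scale_leq _ _) _; case: (hc i).
- apply: (leq_trans (size_sum _ _ _)); apply/bigmax_leqP => i _.
  by apply: leq_trans (size_scale_leq _ _) _; case: (hc i).
- rewrite !mulr_suml -big_split /= -[RHS](coefK r) poly_def.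
  rewrite (big_ord_widen n.+1 (fun i => r`_i *: 'X^i)) // [RHS]big_mkcond.
  apply: eq_bigr => i _; rewrite -!scalerAl -scalerDr.
  have [_ _ ->] := hc i; case: ltnP => // /leq_sizeP -> //.
  by rewrite scale0r.
- apply: le_trans (lerD (poly_size_sum _ _) (poly_size_sum _ _)) _.
  rewrite -big_split /= mulr_sumr; apply: ler_sum => i _.
  rewrite !poly_sizeZ -mulrDr mulrC ler_wpM2r ?nm_ge0 //.
  rewrite /G (bigD1 i) //= lerDl; apply: sumr_ge0 => l _.
  by rewrite addr_ge0 ?poly_size_ge0.
Qed.

(** At order j > 0 the equation f = g h reads g_j h0 + h_j g0 = f_j minus products of earlier terms,
    and is solved by [T]. The size of the g_j for j > 0 keeps g monic of degree k. The norms obey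
    the recursion of [quadratic_majorant]. *)
Lemma hensel_series (f : nat -> {poly K}) (C B : R) :
  0 <= C -> 0 < B -> (forall j, (size (f j) <= n.+1)%N) ->
  (forall j i, nm (f j)`_i <= C * B ^+ j) -> f 0%N = g0 * h0 ->
  exists (g h : nat -> {poly K}) C' B',
    [/\ g 0%N = g0 /\ h 0%N = h0, forall j, (size (g j.+1) <= k)%N,
        forall j, (size (h j) <= (n - k).+1)%N,
        forall j, f j = \sum_(i < j.+1) g i * h (j - i)%N
      & [/\ 0 <= C', 0 < B' & forall j i, nm (g j)`_i <= C' * B' ^+ j /\ nm (h j)`_i <= C' * B' ^+ j]].
Proof.
move=> C0 B0 sf hf f0; have [G [T [G0 hT]]] := bezout_linear.
(* The products g_a h_b removed from [f j] are those with a + b = j and a, b >= 1; hence the bound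
   [j.-1] and the shift [i.+1]. *)
pose rest j (s : nat -> {poly K} * {poly K}) :=
  f j - \sum_(i < j.-1) (s i.+1).1 * (s (j.-1 - i)%N).2.
have [s hs] : exists s : nat -> {poly K} * {poly K},
    forall j, s j = if j == 0%N then (g0, h0) else T (rest j s).
  apply: (strong_recursion (g0, h0)) => -[//|j] s s' e /=.
  congr T; rewrite /rest /=; congr (_ - _); apply: eq_bigr => i _.
  by rewrite !e //; have := ltn_ord i; lia.
pose g j := (s j).1; pose h j := (s j).2.
have ss0 : s 0%N = (g0, h0) by rewrite hs.
have sS j : s j.+1 = T (rest j.+1 s) by rewrite hs.
have sM (p q : {poly K}) : (size p <= k)%N -> (size q <= (n - k).+1)%N -> (size (p * q)%R <= n.+1)%N.
  move=> sp sq; apply: leq_trans (size_polyMleq _ _) _.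
  by move: (size p) (size q) sp sq => a b; lia.
have srest j : (forall i, (i < j)%N -> (size (g i.+1) <= k)%N /\ (size (h i.+1) <= (n - k).+1)%N) ->
    (size (rest j.+1 s) <= n.+1)%N.
  move=> H; apply: leq_trans (size_polyD _ _) _; rewrite geq_max sf size_polyN /=.
  apply: (leq_trans (size_sum _ _ _)); apply/bigmax_leqP => i _.
  have ji : (j - i)%N = (j - i.+1).+1 by have := ltn_ord i; lia.
  apply: sM; first by case: (H i (ltn_ord i)).
  by rewrite ji; case: (H (j - i.+1)%N) => //; have := ltn_ord i; lia.
have sgh j : (size (g j.+1) <= k)%N /\ (size (h j.+1) <= (n - k).+1)%N.
  elim/ltn_ind: j => j IH; rewrite /g /h sS.
  by have [] := hT _ (srest j IH).
have hrest j := hT _ (srest j (fun i _ => sgh i)).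
have sh j : (size (h j) <= (n - k).+1)%N.
  by case: j => [|j]; [rewrite /h ss0 size_cofactor|case: (sgh j)].
have hfgh j : f j = \sum_(i < j.+1) g i * h (j - i)%N.
  case: j => [|j]; first by rewrite big_ord1 f0 /g /h ss0.
  rewrite big_ord_recl big_ord_recr /= subnn subn0 /bump /= add1n.
  have [_ _ + _] := hrest j; rewrite -sS -/(g j.+1) -/(h j.+1) /rest /= => e.
  have -> : g 0%N = g0 by rewrite /g ss0.
  have -> : h 0%N = h0 by rewrite /h ss0.
  rewrite addrCA [g0 * _]mulrC [_ * g0 + _]addrC e addrC subrK //.
have ab j : poly_size (g j.+1) + poly_size (h j.+1) <=
    G * (n.+1%:R * C * B ^+ j.+1 + \sum_(i < j)
      (poly_size (g i.+1) + poly_size (h i.+1)) *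
      (poly_size (g (j.-1 - i).+1) + poly_size (h (j.-1 - i).+1))).
  have [_ _ _] := hrest j; rewrite -sS -/(g j.+1) -/(h j.+1) => /le_trans; apply.
  rewrite ler_wpM2l //; apply: le_trans (poly_sizeB _ _) _; apply: lerD.
    rewrite -mulrA mulr_natl -[in leRHS](card_ord n.+1) -sumr_const.
    by apply: ler_sum => i _.
  apply: le_trans (poly_size_sum _ _) _; apply: ler_sum => i _.
  apply: le_trans (poly_sizeM _ _) _.
  have -> : (j.+1.-1 - i = (j.-1 - i).+1)%N by have := ltn_ord i; lia.
  by apply: ler_pM; rewrite ?poly_size_ge0 // ?lerDl ?lerDr poly_size_ge0.
have [C' [B' [C'0 B'0 hab]]] := quadratic_majorant
  (fun j => addr_ge0 (poly_size_ge0 (g j.+1)) (poly_size_ge0 (h j.+1)))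
  G0 (mulr_ge0 (ler0n _ n.+1) C0) B0 ab.
exists g, h, (C' + (poly_size g0 + poly_size h0)), B'; split=> //.
- by rewrite /g /h ss0.
- by move=> j; case: (sgh j).
have S0 : 0 <= poly_size g0 + poly_size h0 by rewrite addr_ge0 ?poly_size_ge0.
split=> [||j i]; [by rewrite addr_ge0|by []|].
have gh_le : poly_size (g j) + poly_size (h j) <= (C' + (poly_size g0 + poly_size h0)) * B' ^+ j.
  case: j => [|j]; first by rewrite /g /h ss0 mulr1 lerDr.
  by apply: le_trans (hab j) _; rewrite ler_wpM2r ?exprn_ge0 ?(ltW B'0) // lerDl.
have coef_le (p : {poly K}) : (size p <= n.+1)%N -> nm p`_i <= poly_size p.
  move=> sp; case: (ltnP i n.+1) => [|ni]; first exact: poly_size_coef.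
  by have /leq_sizeP -> := sp; rewrite ?nm0 ?poly_size_ge0.
split; apply: le_trans gh_le.
  apply: le_trans (coef_le _ _) _; last by rewrite lerDl poly_size_ge0.
  case: j {coef_le} => [|j]; first by rewrite /g ss0 sg0.
  by case: (sgh j) => /leq_trans + _; apply; apply: leq_trans hk _.
apply: le_trans (coef_le _ _) _; last by rewrite lerDr poly_size_ge0.
by apply: leq_trans (sh j) _; rewrite ltnS leq_subr.
Qed.

End Factor.
End Hensel.

(** * Arc-sections over lines *)

Section LineArcs.
Variable R : realType.
Notation K := R[i].

Lemma line_holomorphic (r : K) (v : 'rV[K]_2) : 0 < r ->
  holomorphic_arc r (fun t : K => t *: v).
Proof.
move=> r0; split=> [|i]; first by rewrite scale0r.
pose k1 : multi_index 1 := [ffun=> 1%N].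
have weight1 (k : multi_index 1) : weight k = k 0 by rewrite /weight big_ord1.
exists (fun k => if k == k1 then v 0 i else 0); split.
  exists (`|v 0 i| * r) => k; case: eqP => [->|_].
    by rewrite weight1 ffunE expr1.
  by rewrite normr0 mul0r mulr_ge0 // ltW.
move=> x _; apply/(seq_cvg_norm (fun N => \sum_(k : {ffun 'I_1 -> 'I_N})
   (if index_of_box k == k1 then v 0 i else 0) * monomial (index_of_box k) x)) => e e0.
exists 2%N => -[|[|N]] // _.
rewrite (bigD1 (box_index N.+1 k1)) //= box_indexK => [|j]; last by rewrite ffunE.
rewrite eqxx big1 ?addr0 => [|k kk].
  by rewrite /monomial big_ord1 ffunE expr1 mxE mulrC subrr normr0 ltW.
case: eqP => [ek|_]; last by rewrite mul0r.
by case/negP: kk; apply/eqP; rewrite -[k]index_of_boxK ek.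
Qed.

(** f(t v) = t^m H(v) + O(t^(m + 1)), and the main term wins for small t. *)
Lemma leading_line_neq0 n (f : 'rV[K]_n -> K) m H C v : hform m C H ->
  leading f m H -> H v != 0 ->
  exists2 e, 0 < e & forall t, t != 0 -> nm t <= e -> f (t *: v) != 0.
Proof.
move=> hH [C' [e [C'0 e0 h]]] Hv; have [s s0 vs] := exists_bound v.
have Hv0 : 0 < nm (H v) by rewrite nm_gt0.
pose A := C' * s ^+ m.+1 + 1.
have A0 : 0 < A by rewrite ltr_wpDl // mulr_ge0 // exprn_ge0 // ltW.
exists (Num.min (e / s) (nm (H v) / A / 2)).
  by rewrite lt_min !divr_gt0.
move=> t t0; rewrite le_min => /andP[te tA]; apply/negP => /eqP ft.
have nt0 : 0 < nm t by rewrite nm_gt0.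
have ts0 : 0 <= nm t * s by rewrite mulr_ge0 // ltW.
have tse : nm t * s <= e by rewrite -ler_pdivlMr.
have := h (t *: v) (nm t * s) ts0 tse (bounded_byZ t vs).
rewrite ft sub0r nmN (hform_homog _ _ hH) nmM nmX exprMn exprS mulrA [C' * _]mulrC -!mulrA.
rewrite [X in _ <= X]mulrCA ler_pM2l ?exprn_gt0 // => h1.
have : nm (H v) <= nm t * A.
  by apply: le_trans h1 _; rewrite ler_wpM2l ?(ltW nt0) // /A; lra.
rewrite leNgt => /negP; apply; rewrite -ltr_pdivlMr //; apply: le_lt_trans tA _.
by have := divr_gt0 Hv0 A0; lra.
Qed.

Section Arc.
Variables (D : set 'rV[K]_2) (delta : 'rV[K]_2 -> K) (v : 'rV[K]_2).
Variables (m : nat) (H : 'rV[K]_2 -> K).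
Hypotheses (danal : analytic_germ delta) (hD : near0 (fun y => D y <-> delta y = 0)).
Hypotheses (hH : initial_form delta m H) (Hv : H v != 0) (v0 : v != 0).

(** One element of the ideal of [D] is enough to exclude [v] from the tangent cone: [delta] itself,
    whose initial form does not vanish at [v]. *)
Lemma line_generic : generic_arc D (fun t : K => t *: v).
Proof.
have dv : derive1 (fun t : K => t *: v) 0 = v := derive1_line v.
split.
- by exists 1; rewrite ?ltr01 //; apply: line_holomorphic.
- by rewrite dv.
rewrite dv => /(_ delta m H danal _ hH) => h; case/eqP: Hv; apply: h.
by apply: near0_imp hD _ => y hy Dy; apply/hy.
Qed.

Lemma line_small_disk : exists rho : K, small_disk D (fun t : K => t *: v) rho /\
  exists2 e : R, 0 < e & rho = e%:C.
Proof.
have [[C hC] _ lead] := initial_formP hH.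
have [e e0 hde] := leading_line_neq0 hC lead Hv.
have /near0_le[e' e'0 hD'] := hD; have [s s0 vs] := exists_bound v.
pose d := Num.min e (e' / s); have d0 : 0 < d by rewrite lt_min e0 divr_gt0.
exists d%:C; split; last by exists d.
split.
- by rewrite ltcR.
- exists (d%:C + 1); first by rewrite ltrDl ltr01.
  by apply: line_holomorphic; rewrite addr_gt0 ?ltcR ?ltr01.
- move=> t u _ _ /eqP; rewrite -subr_eq0 -scalerBl scaler_eq0 (negPf v0) orbF subr_eq0.
  by move/eqP.
move=> t; rewrite norm_nm lecR le_min => /andP[te te'] Dt.
have [->|t0] := eqVneq t 0; first by rewrite scale0r.
case/eqP: (hde t t0 te); apply/hD' => // i; apply: le_trans (bounded_byZ t vs i) _.
by rewrite -ler_pdivlMr.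
Qed.

End Arc.

Lemma discriminant_neq0_roots (p : {poly K}) : p \is monic -> discriminant p != 0 ->
  exists r : seq K, [/\ uniq r, size p = (size r).+1 & all (root p) r].
Proof.
move=> pm; rewrite mulf_eq0 negb_or resultant_eq0 => /andP[_ sep].
have [r pE] := closed_field_poly_normal p.
rewrite (monicP pm) scale1r in pE.
exists r; split.
- rewrite -separable_prod_XsubC -pE separable_poly.unlock /coprimep.
  rewrite eqn_leq leqNgt sep /= lt0n size_poly_eq0 gcdp_eq0 negb_and monic_neq0 //.
- by rewrite pE size_prod_XsubC.
- by apply/allP => z zr; rewrite pE root_prod_XsubC.
Qed.

End LineArcs.

Section ArcSections.
Variable R : realType.
Notation K := R[i].

Lemma ord2_cases (j : 'I_2) : j = 0 \/ j = 1.
Proof. by case: j => [[|[|j]] hj] //; [left|right]; apply: val_inj. Qed.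

Section Fixed.
Variables (X : set 'rV[K]_3) (P : 'M[K]_(3, 2)) (l : 'cV[K]_3).
Variables (E : 'M[K]_(2, 3)) (w : 'rV[K]_3).
Variables (n : nat) (F : 'rV[K]_2 -> {poly K}) (D : set 'rV[K]_2).
Variables (dm : nat) (Hd : 'rV[K]_2 -> K).

Let f (x : 'rV[K]_3) : K := (F (x *m P)).[(x *m l) 0 0].

Hypotheses (EP : E *m P = 1%:M) (El : E *m l = 0) (wP : w *m P = 0) (wl : w *m l = 1%:M).
Hypotheses (hF : weierstrass_polynomial n F) (fan : analytic f).
Hypothesis (fX : near0 (fun x => X x <-> f x = 0)).
Hypothesis (hD : near0 (fun y => D y <-> discriminant (F y) = 0)).
Hypothesis (danal : analytic_germ (fun y => discriminant (F y))).
Hypothesis (hd : initial_form (fun y => discriminant (F y)) dm Hd).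
Hypothesis (hirr : generic_arc_section_irreducible X P D).

Definition direction (s : K) : 'rV[K]_2 := \row_j (if j == 0 then 1 else s).

Lemma direction0 s : direction s 0 0 = 1.
Proof. by rewrite mxE. Qed.

Lemma direction1 s : direction s 0 1 = s.
Proof. by rewrite mxE. Qed.

Lemma direction_neq0 s : direction s != 0.
Proof. by apply/eqP => /rowP/(_ 0)/eqP; rewrite !mxE oner_eq0. Qed.

Variable s : K.
Hypothesis Hds : Hd (direction s) != 0.
Let v := direction s.

Definition over_line (x : 'rV[K]_3) := (x *m P) 0 1 = s * (x *m P) 0 0.

Lemma over_lineP x : over_line x -> x *m P = (x *m P) 0 0 *: v.
Proof.
move=> h; apply/rowP => j; rewrite [RHS]mxE; case: (ord2_cases j) => ->.
  by rewrite direction0 mulr1.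
by rewrite direction1 mulrC.
Qed.

Definition plane_point (t z : K) : 'rV[K]_3 := (t *: v) *m E + z *: w.

Lemma plane_pointP t z : plane_point t z *m P = t *: v.
Proof. by rewrite mulmxDl -mulmxA EP mulmx1 -scalemxAl wP scaler0 addr0. Qed.

Lemma plane_pointl t z : (plane_point t z *m l) 0 0 = z.
Proof. by rewrite mulmxDl -mulmxA El mulmx0 add0r -scalemxAl wl !mxE mulr1. Qed.

Lemma plane_point_over t z : over_line (plane_point t z).
Proof.
by rewrite /over_line plane_pointP [LHS]mxE [in RHS]mxE direction0 direction1 mulr1 mulrC.
Qed.

Lemma near0_plane Q : near0 Q ->
  exists2 e, 0 < e & forall t z, nm t <= e -> nm z <= e -> Q (plane_point t z).
Proof.
move=> /near0_le[d d0 h].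
have [a a0 ha] := exists_bound (v *m E); have [b b0 hb] := exists_bound w.
have ab0 : 0 < a + b by rewrite addr_gt0.
exists (d / (a + b)); first by rewrite divr_gt0.
move=> t z te ze; apply: h => i; rewrite /plane_point -scalemxAl mxE.
apply: le_trans (nmD _ _) _; apply: (@le_trans _ _ (d / (a + b) * a + d / (a + b) * b)).
  apply: lerD; apply: le_trans (bounded_byZ _ _ i) _; try exact: ha; try exact: hb.
    by rewrite ler_wpM2r // ltW.
  by rewrite ler_wpM2r // ltW.
by rewrite -mulrDr divfK // gt_eqF.
Qed.

(** For small t <> 0 the discriminant is nonzero at t v, so [F (t *: v)] has n distinct roots, all
    small. They give points of the section, hence roots of [Q t]. This is what makes a component of
    lower degree proper. *)
Lemma vanishing_degree (Q : K -> {poly K}) :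
  near0 (fun x => f x = 0 -> over_line x -> (Q ((x *m P) 0 0)).[(x *m l) 0 0] = 0) ->
  exists2 e, 0 < e & forall t, t != 0 -> nm t <= e -> Q t != 0 -> (n < size (Q t))%N.
Proof.
move=> /near0_plane[e1 e10 h1].
have /near0_le[e2 e20 h2] := weierstrass_root_small hF e10.
have [[C hC] _ lead] := initial_formP hd.
have [e3 e30 h3] := leading_line_neq0 hC lead Hds.
have [b b0 vb] := exists_bound v.
exists (Num.min (Num.min e1 e3) (e2 / b)); first by rewrite !lt_min e10 e30 divr_gt0.
move=> t t0; rewrite !le_min => /andP[/andP[te1 te3] te2] Qt0.
have [hmon hsize _ _] := hF.
have [r [ru rs rr]] := discriminant_neq0_roots (hmon (t *: v)) (h3 t t0 te3).
move: rs; rewrite hsize => -[->]; apply: max_poly_roots => //.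
apply/allP => z zr; have Fz : root (F (t *: v)) z by exact: (allP rr).
have ze1 : nm z <= e1.
  apply: h2 Fz => i; apply: le_trans (bounded_byZ t vb i) _.
  by rewrite -ler_pdivlMr.
have := h1 t z te1 ze1; rewrite /f plane_pointP plane_pointl.
rewrite [(t *: v) 0 0]mxE direction0 mulr1 => h.
by apply/rootP/h; [apply/rootP|exact: plane_point_over].
Qed.

Lemma section_component (q : 'rV[K]_3 -> K) : analytic q ->
  analytic_set_germ [set x | [/\ f x = 0, over_line x & q x = 0]].
Proof.
move=> qan.
pose g (j : 'I_3) x := if j == 0 then f x else
  if j == 1 then (x *m P) 0 1 + (- s) * (x *m P) 0 0 else q x.
exists 3%N, g; split.
  have coordP i : analytic (fun x : 'rV[K]_3 => (x *m P) 0 i).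
    exact: analytic_mulmx (analytic_coord R i).
  move=> j; apply: analytic_analytic_germ; rewrite /g.
  case: (j == 0); first exact: fan.
  case: (j == 1); last exact: qan.
  by apply: analyticD => //; apply: analyticM => //; apply: analytic_cst.
have nT : near0 (fun _ : 'rV[K]_3 => True) by apply/near0_le; exists 1.
suff : near0 (fun x => [/\ f x = 0, over_line x & q x = 0] <-> forall j, g j x = 0) by [].
apply: near0_imp nT _ => x _; rewrite /over_line; split=> [[fx /eqP ox qx] j|h].
  rewrite /g; case: (j == 0) => //; case: (j == 1) => //.
  by apply/eqP; rewrite mulNr subr_eq0.
split; first exact: (h 0).
  by apply/eqP; have := h 1; rewrite /g /= => /eqP; rewrite mulNr subr_eq0.
by have := h (lift 0 (lift 0 0)).
Qed.

(** [i] tells which of the two components exhausts the section; [vanishing_degree] applies to that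
    one. *)
Lemma section_irreducible (G1 G2 : K -> {poly K}) :
  analytic (fun x : 'rV[K]_3 => (G1 ((x *m P) 0 0)).[(x *m l) 0 0]) ->
  analytic (fun x : 'rV[K]_3 => (G2 ((x *m P) 0 0)).[(x *m l) 0 0]) ->
  near0 (fun x => f x = 0 -> over_line x ->
    (G1 ((x *m P) 0 0)).[(x *m l) 0 0] = 0 \/ (G2 ((x *m P) 0 0)).[(x *m l) 0 0] = 0) ->
  exists (i : bool) (e : R), 0 < e /\ forall t, t != 0 -> nm t <= e ->
    (if i then G1 t else G2 t) != 0 -> (n < size (if i then G1 t else G2 t))%N.
Proof.
move=> an1 an2 cover.
have gen := line_generic danal hD hd Hds (direction_neq0 s).
have [rho [small [r r0 rhoE]]] := line_small_disk hD hd Hds (direction_neq0 s).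
have [_ irr] := hirr gen small.
set S := arc_section _ _ _ _ in irr.
(* The parameter of the arc is the first coordinate of [x *m P], so the condition on the disk holds
   automatically near 0. *)
have SE : near0 (fun x => S x <-> f x = 0 /\ over_line x).
  have hr : near0 (fun y : 'rV[K]_2 => bounded_by y r) by apply/near0_le; exists r.
  apply: near0_imp (near0_and fX (near0_mulmx P hr)) _ => x [Xx rx]; rewrite /S /arc_section /=; split.
    move=> [/Xx fx [t _ tx]]; split=> //.
    by rewrite /over_line -tx [LHS]mxE [in RHS]mxE direction0 direction1 mulr1 mulrC.
  move=> [fx ox]; split; first exact/Xx.
  exists ((x *m P) 0 0); last by rewrite -over_lineP.
  by rewrite rhoE norm_nm lecR.
have use (G : K -> {poly K}) : same_germ S
    [set x | [/\ f x = 0, over_line x & (G ((x *m P) 0 0)).[(x *m l) 0 0] = 0]] ->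
    exists (e : R), 0 < e /\ forall t, t != 0 -> nm t <= e -> G t != 0 -> (n < size (G t))%N.
  move=> h; have [|e e0 he] := @vanishing_degree G; last by exists e.
  apply: near0_imp (near0_and SE h) _ => x [hS hG] fx ox.
  by have /hS/hG[] : f x = 0 /\ over_line x by split.
case: (irr _ _ (section_component an1) (section_component an2)) => [|/use[e he]|/use[e he]].
- apply: near0_imp (near0_and SE cover) _ => x [hS hc]; split.
    by move=> /hS[fx ox]; case: (hc fx ox) => h; [left|right].
  by case=> -[fx ox _]; apply/hS.
- by exists true, e.
- by exists false, e.
Qed.

End Fixed.
End ArcSections.

(** * The tangent cone over a single generic line *)

Section TangentDichotomy.
Variable R : realType.
Notation K := R[i].

Lemma poly_eval_eq0 (q : {poly K}) : (forall z, q.[z] = 0) -> q = 0.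
Proof.
move=> h; apply/eqP/negPn/negP => q0; have [t + _] := exists_nonroot [::] q0.
by rewrite h eqxx.
Qed.

Variables (P : 'M[K]_(3, 2)) (l : 'cV[K]_3) (E : 'M[K]_(2, 3)) (w : 'rV[K]_3).
Variables (n : nat) (F : 'rV[K]_2 -> {poly K}) (s : K).
Let f (x : 'rV[K]_3) : K := (F (x *m P)).[(x *m l) 0 0].
Let v := direction s.
Let point := plane_point E w s.

Hypotheses (EP : E *m P = 1%:M) (El : E *m l = 0) (wP : w *m P = 0) (wl : w *m l = 1%:M).
Hypothesis hF : weierstrass_polynomial n F.

Variable (p : nat -> nat -> 'rV[K]_2 -> K).
Hypothesis hp : forall i, expands (fun y => (F y)`_i) (p i).
Let a i j := p i j v.

Lemma p_homog i j t : p i j (t *: v) = a i j * t ^+ j.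
Proof.
by have [C [B [_ _ [h _]]]] := hp i; rewrite (hform_homog _ _ (h j)) mulrC.
Qed.

(** Multiplying the i-th coefficient by z^i raises degrees by i, whence the index [d - i]. *)
Lemma line_expansion :
  expands (fun u : 'rV[K]_2 => f (point (u 0 0) (u 0 1)))
    (fun d u => \sum_(i < n.+1)
      if (i <= d)%N then a i (d - i) * u 0 0 ^+ (d - i) * u 0 1 ^+ i else 0).
Proof.
pose A : 'M[K]_2 := \matrix_(i, j) (if i == 0 then v 0 j else 0).
have uA (u : 'rV[K]_2) : u *m A = u 0 0 *: v.
  by apply/rowP => j; rewrite !mxE big_ord_recl big_ord1 !mxE /= mulr0 addr0.
have h i : expands (fun u : 'rV[K]_2 => (F (u 0 0 *: v))`_i * u 0 1 ^+ i)
    (fun d u => if (i <= d)%N then a i (d - i) * u 0 0 ^+ (d - i) * u 0 1 ^+ i else 0).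
  have hX := hformX i (hform_coord R (1 : 'I_2)); rewrite muln1 in hX.
  apply: expands_ext (expands_mul_form (expands_mulmx A (hp i)) hX) _ _ => [u|d u].
    by rewrite uA.
  by rewrite uA p_homog.
apply: expands_ext (expands_sum (index_enum 'I_n.+1) (fun i : 'I_n.+1 => h i)) _ _ => // u.
have [_ hsize _ _] := hF.
by rewrite /f /point (plane_pointP EP wP) (plane_pointl El wl) horner_coef hsize.
Qed.

Variables (m : nat) (H : 'rV[K]_3 -> K) (C0 : R).
Hypotheses (hH : hform m C0 H) (lead : leading f m H).

(* In the plane over the line spanned by v, with coordinates (t, z), f is the sum
   of the a_(i,j) t^j z^i; all terms with i + j < m vanish, and those with
   i + j = m form the restriction of H. *)
Lemma point_leading : leading (fun u : 'rV[K]_2 => f (point (u 0 0) (u 0 1))) m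
    (fun u => H (point (u 0 0) (u 0 1)))
  /\ exists C, hform m C (fun u : 'rV[K]_2 => H (point (u 0 0) (u 0 1))).
Proof.
pose B : 'M[K]_(2, 3) := \matrix_(i, j) (if i == 0 then (v *m E) 0 j else w 0 j).
have uB (u : 'rV[K]_2) : u *m B = point (u 0 0) (u 0 1).
  rewrite /point /plane_point -scalemxAl; apply/rowP => j.
  rewrite [LHS]mxE big_ord_recl big_ord1 !mxE /=; congr (_ + _ * _).
  by congr (u _ _); apply: val_inj.
split.
  have [C [e [C1 e0 h]]] := leading_mulmx B lead.
  by exists C, e; split=> // u d d0 de hu; rewrite -uB; apply: h.
exists (C0 * mx_size B ^+ m); apply: hform_ext (hform_mulmx B hH) _ => u.
by rewrite uB.
Qed.

Lemma line_form_eval d z :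
  \sum_(i < n.+1) (if (i <= d)%N then a i (d - i) * 1 ^+ (d - i) * z ^+ i else 0) =
  (\poly_(i < n.+1) (if (i <= d)%N then a i (d - i) else 0)).[z].
Proof.
rewrite horner_poly; apply: eq_bigr => i _.
by case: leqP => _; rewrite ?mul0r // expr1n mulr1.
Qed.

Lemma line_leading (d i : nat) : (i <= n)%N -> (i <= d)%N -> (d < m)%N -> a i (d - i) = 0.
Proof.
move=> iN id dm; have [lead2 [C hC]] := point_leading.
have [h _] := leading_expands line_expansion lead2 hC.
have /(congr1 (fun q : {poly K} => q`_i)) :
    \poly_(i < n.+1) (if (i <= d)%N then a i (d - i) else 0) = 0.
  apply: poly_eval_eq0 => z; rewrite -line_form_eval.
  by have := h d (direction z) dm; rewrite direction0 direction1.
by rewrite coef_poly ltnS iN id coef0.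
Qed.

(* The restriction of H to the plane over the line, dehomogenized by t = 1. *)
Definition tangent_poly := \poly_(i < n.+1) (if (i <= m)%N then a i (m - i) else 0).

Lemma tangent_polyE z : H (point 1 z) = tangent_poly.[z].
Proof.
have [lead2 [C hC]] := point_leading.
have [_ h] := leading_expands line_expansion lead2 hC.
by have := h (direction z); rewrite direction0 direction1 -line_form_eval.
Qed.

(** The monomial z^n occurs in F with coefficient 1. *)
Lemma leading_degree_le : (m <= n)%N.
Proof.
rewrite leqNgt; apply/negP => nm_; have := line_leading (leqnn n) (leqnn n) nm_.
have [C [B [_ _ [/(_ 0%N) /= [c [_ hc]] _]]]] := hp n.
have [hmon hsize _ _] := hF.
rewrite subnn /a hc -(hc 0) (expands0 (hp n)).
have /monicP := hmon 0; rewrite lead_coefE hsize => -> /eqP.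
by rewrite oner_eq0.
Qed.

Hypothesis irr : forall G1 G2 : K -> {poly K},
  analytic (fun x : 'rV[K]_3 => (G1 ((x *m P) 0 0)).[(x *m l) 0 0]) ->
  analytic (fun x : 'rV[K]_3 => (G2 ((x *m P) 0 0)).[(x *m l) 0 0]) ->
  near0 (fun x => f x = 0 -> over_line P s x ->
    (G1 ((x *m P) 0 0)).[(x *m l) 0 0] = 0 \/ (G2 ((x *m P) 0 0)).[(x *m l) 0 0] = 0) ->
  exists (i : bool) (e : R), 0 < e /\ forall t, t != 0 -> nm t <= e ->
    (if i then G1 t else G2 t) != 0 -> (n < size (if i then G1 t else G2 t))%N.

Lemma coefficient_bound N : exists C B, [/\ 0 <= C, 1 <= B &
  forall i j, (i < N)%N -> nm (a i j) <= C * B ^+ j].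
Proof.
elim: N => [|N [C [B [C1 B1 h]]]]; first by exists 0, 1.
have [C' [B' [C'0 B'0 h']]] := power_series_bound (power_series_line v (hp N)).
exists (C + C'), (B + B'); split; first exact: addr_ge0.
  by rewrite ler_wpDr // ltW.
have B0 : 0 <= B := le_trans ler01 B1.
move=> i j; rewrite ltnS leq_eqVlt => /orP[/eqP ->|/h hi].
  apply: le_trans (h' j) _; apply: ler_pM; [by []|by rewrite exprn_ge0 // ltW|by rewrite lerDr|].
  by apply: lerXn2r; rewrite ?nnegrE ?lerDr // ?addr_ge0 // ltW.
apply: le_trans (hi j) _; apply: ler_pM; [by []|by rewrite exprn_ge0|by rewrite lerDl|].
by apply: lerXn2r; rewrite ?nnegrE ?lerDl ?addr_ge0 // ltW.
Qed.

(** The functions of index above [k] vanish everywhere, not only near 0, so that each t gives a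
    polynomial of degree at most [k]. *)
Lemma power_series_coefs (g : nat -> {poly K}) k (C B : R) : 0 <= C -> 0 < B ->
  (forall j, (size (g j) <= k.+1)%N) -> (forall j i, nm (g j)`_i <= C * B ^+ j) ->
  exists phi : nat -> K -> K, (forall i, power_series (phi i) (fun j => (g j)`_i)) /\
    forall i t, (k < i)%N -> phi i t = 0.
Proof.
move=> C1 B1 sg hg.
have : forall i, exists phi, power_series phi (fun j => (g j)`_i) /\
    forall t, (k < i)%N -> phi t = 0.
  move=> i; case: (leqP i k) => ik.
    by have [phi hphi] := power_series_exists C1 B1 (fun j => hg j i); exists phi.
  exists (fun=> 0); split=> //.
  have h0 : hform 0 0 (fun _ : 'rV[K]_1 => 0 : K) by exact: hform0.
  apply: expands_ext (expands_form h0) _ _ => // j u; rewrite if_same.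
  by have /leq_sizeP -> := sg j; rewrite ?mul0r.
by move=> /choice[phi hphi]; exists phi; split=> i; case: (hphi i).
Qed.

Lemma power_series_coord d phi c (i : 'I_d) : power_series phi c ->
  analytic (fun x : 'rV[K]_d => phi (x 0 i)).
Proof.
move=> h; apply: analytic_ext (power_series_analytic (delta_mx i 0) h) _ => x.
congr phi; rewrite mxE (bigD1 i) //= mxE !eqxx mulr1 big1 ?addr0 // => j /negPf ji.
by rewrite mxE ji mulr0.
Qed.

(* Hensel lifts the coprime factorization of the initial form; substituting
   z = t w back turns the two factors into G1 and G2. *)
Lemma section_splits h0 lam k : tangent_poly = h0 * ('X - lam%:P) ^+ k ->
  ~~ root h0 lam -> (0 < k < n)%N -> False.
Proof.
move=> hE rh0 /andP[k0 kn]; have [hmon hsize han hF0] := hF.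
have [C [B [C1 B1 hCB]]] := coefficient_bound n.+1.
have B0 : 0 < B := lt_le_trans ltr01 B1.
(* [fj j] is the coefficient of t^j in t^-m F(t v)(t W), a polynomial in W: a term a_(i,l) t^l z^i
   becomes t^(l + i - m) W^i. *)
pose fj j := \poly_(i < n.+1) (if (i <= j + m)%N then a i (j + m - i) else 0).
pose g0 := ('X - lam%:P) ^+ k.
have g0mon : g0 \is monic by rewrite monic_exp // monicXsubC.
have sg0 : size g0 = k.+1 by rewrite size_exp_XsubC.
have cop : coprimep g0 h0.
  by apply: coprimep_expl; rewrite coprimep_sym coprimep_XsubC.
have sgh0 : (size (g0 * h0)%R <= n.+1)%N by rewrite mulrC -hE size_poly.
have sfj j : (size (fj j) <= n.+1)%N by exact: size_poly.
have hfj j i : nm (fj j)`_i <= C * B ^+ m * B ^+ j.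
  have R0 : 0 <= C * B ^+ m * B ^+ j by rewrite !mulr_ge0 ?exprn_ge0 // ltW.
  rewrite coef_poly; case: ltnP => iN; last by rewrite nm0.
  case: leqP => ij; last by rewrite nm0.
  apply: le_trans (hCB _ _ iN) _; rewrite -mulrA -exprD ler_wpM2l //.
  by rewrite addnC ler_weXn2l // leq_subr.
have f0 : fj 0%N = g0 * h0 by rewrite mulrC -hE.
have [g [h [C' [B' [[gg0 hh0] sg sh hgh [C'0 B'0 hb]]]]]] :=
  hensel_series (ltnW kn) g0mon sg0 sgh0 cop (mulr_ge0 C1 (exprn_ge0 m (ltW B0))) B0 sfj hfj f0.
have sg' j : (size (g j) <= k.+1)%N by case: j => [|j]; rewrite ?gg0 ?sg0 // ltnW // ltnS.
have [phi [hphi phi0]] := power_series_coefs C'0 B'0 sg' (fun j i => (hb j i).1).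
have [psi [hpsi psi0]] := power_series_coefs C'0 B'0 sh (fun j i => (hb j i).2).
have ident i : (i < n.+1)%N -> near0 (fun u : 'rV[K]_1 =>
    (F (u 0 0 *: v))`_i * u 0 0 ^+ i =
    (\sum_(b < i.+1) phi b (u 0 0) * psi (i - b)%N (u 0 0)) * u 0 0 ^+ m).
  move=> iN.
  have h1 := power_series_shift i (power_series_line v (hp i)).
  have h2 := power_series_shift m (power_series_sum (index_enum 'I_i.+1)
    (fun b : 'I_i.+1 => power_seriesM (hphi b) (hpsi (i - b)%N))).
  suff h3 : power_series (fun t => (\sum_(b < i.+1) phi b t * psi (i - b)%N t) * t ^+ m)
      (fun d => if (i <= d)%N then a i (d - i) else 0) by exact: (expands_near_eq h1 h3).
  apply: power_series_ext h2 _ _ => // d /=.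
  have fE j : \sum_(b < i.+1) \sum_(c < j.+1) (g c)`_b * (h (j - c)%N)`_(i - b) = (fj j)`_i.
    by rewrite hgh coef_sum exchange_big; apply: eq_bigr => c _; rewrite coefM.
  (* For d < m the left side is 0 because of the shift by t^m, the right side by [line_leading]. *)
  case: (leqP m d) => md; last by case: leqP => // id; rewrite line_leading // -ltnS.
  by rewrite fE coef_poly iN subnK.
(* For t <> 0 these are t^k and t^n times the Hensel factors at W = z / t; the powers of t clear the
   denominators, so that the coefficients are analytic at t = 0 too. *)
pose G1 t := \poly_(i < k.+1) (t ^+ (k - i) * phi i t).
pose G2 t := \poly_(i < (n - k).+1) (t ^+ (n - i) * psi i t).
have [e e0 key] : exists2 e, 0 < e & forall t, t != 0 -> nm t <= e ->
    forall z, t ^+ (k + n) * (F (t *: v)).[z] = t ^+ m * ((G1 t).[z] * (G2 t).[z]).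
  have /near0_le[e e0 he] : near0 (fun u : 'rV[K]_1 => forall i : 'I_n.+1,
    (F (u 0 0 *: v))`_i * u 0 0 ^+ i =
    (\sum_(b < i.+1) phi b (u 0 0) * psi (i - b)%N (u 0 0)) * u 0 0 ^+ m).
    by apply: near0_forall => i; apply: ident.
  exists e => // t t0 te z.
  have {}he (i : 'I_n.+1) : (F (t *: v))`_i * t ^+ i =
      (\sum_(b < i.+1) phi b t * psi (i - b)%N t) * t ^+ m.
    by have := he (const_mx t); rewrite mxE; apply=> j; rewrite mxE.
  pose W := z / t; have zE : z = t * W by rewrite /W mulrC divfK.
  pose Gp := \poly_(i < k.+1) phi i t; pose Ep := \poly_(i < (n - k).+1) psi i t.
  have GpE i : Gp`_i = phi i t.
    by rewrite coef_poly ltnS; case: leqP => // ki; rewrite phi0.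
  have EpE i : Ep`_i = psi i t.
    by rewrite coef_poly ltnS; case: leqP => // ki; rewrite psi0.
  have G1E : (G1 t).[z] = t ^+ k * Gp.[W].
    rewrite !horner_poly mulr_sumr; apply: eq_bigr => i _.
    have -> : t ^+ k = t ^+ (k - i) * t ^+ i by rewrite -exprD subnK // -ltnS.
    by rewrite zE exprMn; ring.
  have G2E : (G2 t).[z] = t ^+ n * Ep.[W].
    rewrite !horner_poly mulr_sumr; apply: eq_bigr => i _.
    have -> : t ^+ n = t ^+ (n - i) * t ^+ i.
      by rewrite -exprD subnK //; apply: leq_trans (leq_subr k n); rewrite -ltnS.
    by rewrite zE exprMn; ring.
  have sGE : (size (Gp * Ep)%R <= n.+1)%N.
    apply: leq_trans (size_polyMleq _ _) _.
    have := size_poly k.+1 (fun i => phi i t); have := size_poly (n - k).+1 (fun i => psi i t).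
    rewrite -/Gp -/Ep; move: (size Gp) (size Ep) => b c; lia.
  have FE : (F (t *: v)).[z] = t ^+ m * (Gp.[W] * Ep.[W]).
    rewrite -hornerM (horner_coef_wide _ sGE) mulr_sumr horner_coef hsize.
    apply: eq_bigr => i _.
    have -> : (Gp * Ep)`_i = \sum_(b < i.+1) phi b t * psi (i - b)%N t.
      by rewrite coefM; apply: eq_bigr => b _; rewrite GpE EpE.
    by rewrite {1}zE exprMn mulrA he; ring.
  by rewrite FE G1E G2E exprD; ring.
have Fneq0 y : F y != 0 by rewrite monic_neq0.
have tn0 (t : K) d : t != 0 -> t ^+ d != 0 by move=> t0; rewrite expf_neq0.
have Gn0 t : t != 0 -> nm t <= e -> G1 t != 0 /\ G2 t != 0.
  move=> t0 te; split; apply: contraNneq (Fneq0 (t *: v)) => G0; apply/eqP/poly_eval_eq0 => z;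
    by have /eqP := key t t0 te z; rewrite G0 horner0 ?mul0r !mulr0 mulf_eq0 (negPf (tn0 _ _ t0)) => /eqP.
have [|||i [e' [e'0 he']]] := irr (G1 := G1) (G2 := G2).
- apply: (analytic_horner P l (B := fun y : 'rV[K]_2 => G1 (y 0 0)) (N := k.+1)) => [i ik|y]; last exact: size_poly.
  have h1 : analytic (fun y : 'rV[K]_2 => y 0 0 ^+ (k - i) * phi i (y 0 0)).
    by apply: analyticM; [apply/analyticX/analytic_coord|apply: power_series_coord (hphi i)].
  by apply: analytic_ext h1 _ => y; rewrite coef_poly ik.
- apply: (analytic_horner P l (B := fun y : 'rV[K]_2 => G2 (y 0 0)) (N := (n - k).+1)) => [i ik|y]; last exact: size_poly.
  have h1 : analytic (fun y : 'rV[K]_2 => y 0 0 ^+ (n - i) * psi i (y 0 0)).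
    by apply: analyticM; [apply/analyticX/analytic_coord|apply: power_series_coord (hpsi i)].
  by apply: analytic_ext h1 _ => y; rewrite coef_poly ik.
- have hy : near0 (fun y : 'rV[K]_2 => bounded_by y e) by apply/near0_le; exists e.
  apply: near0_imp (near0_mulmx P hy) _ => x xe fx ox.
  have xP := over_lineP ox; set t := (x *m P) 0 0 in xP *; set z := (x *m l) 0 0.
  rewrite /f xP -/z in fx; have [t0|t0] := eqVneq t 0; last first.
    have /eqP := key t t0 (xe 0) z; rewrite fx mulr0 eq_sym mulf_eq0 (negPf (tn0 _ _ t0)) /=.
    by rewrite mulf_eq0 => /orP[/eqP|/eqP]; [left|right].
  (* At t = 0, F 0 is z^n, so z = 0; there G1 vanishes because its constant coefficient carries t^k
     with k > 0. *)
  left; have z0 : z = 0.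
    move: fx; rewrite t0 scale0r horner_coef hsize big_ord_recr big1 /= ?add0r => [|i _].
      have /monicP := hmon 0; rewrite lead_coefE hsize => ->; rewrite mul1r => /eqP.
      by rewrite expf_eq0 => /andP[_ /eqP].
    by rewrite hF0 ?mul0r.
  by rewrite z0 t0 horner_coef0 coef_poly /= subn0 expr0n eqn0Ngt k0 mul0r.
pose t : K := (Num.min e e')%:C.
have d0 : 0 < Num.min e e' by rewrite lt_min e0.
have nt : nm t = Num.min e e' by rewrite nm_real // ltW.
have t0 : t != 0 by rewrite -nm_gt0 nt.
have te : nm t <= e by rewrite nt ge_min lexx.
have te' : nm t <= e' by rewrite nt ge_min lexx orbT.
have [G1n G2n] := Gn0 t t0 te.
(* The degrees, at most [k] and [n - k], are both less than [n], whereas [he'] asks for at least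
   [n]. *)
have := he' t t0 te'; case: i {he'} => /(_ _)/wrap[] // hlt.
  by have := leq_trans hlt (size_poly _ _); rewrite ltnS leqNgt kn.
have := leq_trans hlt (size_poly _ _).
by rewrite ltnS leqNgt; case/negP; rewrite -subn_gt0 subKn // ltnW.
Qed.

(** A root of a nonconstant [tangent_poly] has multiplicity k >= n by [section_splits]. The degree
    is at most m <= n, so k = m and the cofactor is a constant. *)
Lemma tangent_dichotomy :
  (size tangent_poly <= 1)%N \/
  exists c lam, c != 0 /\ tangent_poly = c *: ('X - lam%:P) ^+ m.
Proof.
have [sh|sh] := leqP (size tangent_poly) 1; [by left|right].
have h0 : tangent_poly != 0 by rewrite -size_poly_gt0 (ltn_trans _ sh).
have /closed_rootP[lam rlam] : size tangent_poly != 1%N by rewrite neq_ltn sh orbT.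
have [k [q]] := multiplicity_XsubC tangent_poly lam; rewrite h0 /= => rq hE.
have k0 : (0 < k)%N.
  rewrite lt0n; apply: contraNneq rq => k0; move: rlam.
  by rewrite hE k0 expr0 mulr1.
have q0 : q != 0 by apply: contraNneq h0 => q0; rewrite hE q0 mul0r.
have sE : size tangent_poly = (size q + k)%N.
  by rewrite hE size_Mmonic ?monic_exp ?monicXsubC // size_exp_XsubC addnS.
have q1 : (0 < size q)%N by rewrite size_poly_gt0.
have hn : (size q + k <= n.+1)%N by rewrite -sE size_poly.
have hm : (size q + k <= m.+1)%N.
  rewrite -sE; apply/leq_sizeP => j mj; rewrite coef_poly; case: ltnP => // _.
  by rewrite leqNgt mj.
have mn := leading_degree_le.
have kn : (n <= k)%N.
  rewrite leqNgt; apply/negP => kn; apply: (section_splits hE rq); by rewrite k0.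
have km : k = m by lia.
have sq : size q = 1%N by lia.
exists q`_0, lam; split; last first.
  by rewrite {1}hE km {1}(size1_polyC (eq_leq sq)) mul_polyC.
by apply: contraNneq q0 => q00; rewrite (size1_polyC (eq_leq sq)) q00.
Qed.

End TangentDichotomy.

(** * Determination of the tangent cone *)

Section Cone.
Variable R : realType.
Notation K := R[i].

Definition row3 (a b c : K) : 'rV[K]_3 := \row_j [:: a; b; c]`_j.

Lemma row3_mulmx n (M : 'M[K]_(3, n)) a b c :
  row3 a b c *m M = a *: row 0 M + b *: row 1 M + c *: row (lift 0 (lift 0 0)) M.
Proof.
apply/rowP => j; rewrite !mxE !big_ord_recl big_ord0 !mxE /= addr0 addrA.
by congr (_ + _ * M _ j + _); apply: val_inj.
Qed.

Lemma vanish_off_roots (d q : {poly K}) : d != 0 ->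
  (forall s, d.[s] != 0 -> q.[s] = 0) -> q = 0.
Proof.
move=> d0 h; have : d * q = 0.
  apply: poly_eval_eq0 => s; rewrite hornerM.
  by have [->|/h ->] := eqVneq d.[s] 0; rewrite ?mul0r ?mulr0.
by move/eqP; rewrite mulf_eq0 (negPf d0) => /eqP.
Qed.

(** Rescaling gives equality off the hyperplane x_i = 0; a point of that hyperplane is reached along
    the i-th axis, where both sides are polynomials. *)
Lemma hform_eq_chart n (i : 'I_n) j C C' (p q : 'rV[K]_n -> K) :
  hform j C p -> hform j C' q -> (forall x : 'rV[K]_n, x 0 i = 1 -> p x = q x) -> p =1 q.
Proof.
move=> hp hq h x.
have h' (y : 'rV[K]_n) : y 0 i != 0 -> p y = q y.
  move=> y0; have -> : y = y 0 i *: ((y 0 i)^-1 *: y) by rewrite scalerA divff // scale1r.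
  by rewrite (hform_homog _ _ hp) (hform_homog _ _ hq) h // mxE mulVf.
have [a ha] := hform_line x (delta_mx 0 i) hp; have [b hb] := hform_line x (delta_mx 0 i) hq.
have ab : a - b = 0.
  have X0 : 'X + (x 0 i)%:P != 0 :> {poly K} by rewrite monic_neq0 // monicXaddC.
  apply: (vanish_off_roots X0) => s; rewrite !hornerE -ha -hb => sx.
  by rewrite h' ?subrr // !mxE !eqxx mulr1 addrC.
have := congr1 (fun r : {poly K} => r.[0]) ab; rewrite hornerD hornerN horner0 -ha -hb scale0r addr0.
by move/eqP; rewrite subr_eq0 => /eqP.
Qed.

(** [d] is the dehomogenization of [Hd]. It is not zero: a point where [Hd] does not vanish can be
    moved along the first axis off the line where the first coordinate is 0, then rescaled into the
    chart. *)
Lemma good_directions (Hd : 'rV[K]_2 -> K) m C : hform m C Hd -> (exists u, Hd u != 0) ->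
  exists2 d : {poly K}, d != 0 & forall s, d.[s] != 0 -> Hd (direction s) != 0.
Proof.
move=> hH [u hu].
have [d hd] := hform_line (direction 0) (delta_mx 0 1 : 'rV[K]_2) hH.
have dE s : Hd (direction s) = d.[s].
  rewrite -hd; congr Hd; apply/rowP => j.
  by case: (ord2_cases j) => ->; rewrite !mxE /= ?mulr0 ?addr0 ?mulr1 ?add0r.
exists d; last by move=> s; rewrite dE.
have [q hq] := hform_line u (delta_mx 0 0 : 'rV[K]_2) hH.
have q0 : q != 0.
  by apply: contraNneq hu => q0; rewrite -[u]addr0 -(scale0r (delta_mx 0 0)) hq q0 horner0.
have [t qt] := exists_nonroot [:: - u 0 0] q0; rewrite inE => tu.
pose y := u + t *: delta_mx 0 0.
have y0 : y 0 0 != 0 by rewrite !mxE !eqxx mulr1 addrC addr_eq0.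
have yE : y = y 0 0 *: direction (y 0 1 / y 0 0).
  apply/rowP => j; rewrite [RHS]mxE; case: (ord2_cases j) => ->.
    by rewrite direction0 mulr1.
  by rewrite direction1 mulrC divfK.
move: qt; rewrite -hq -/y yE (hform_homog _ _ hH) dE mulf_eq0 negb_or => /andP[_].
by apply: contraNneq => ->; rewrite horner0.
Qed.

(** The outer variable is z, the inner one s. The degree bound is the essential part: it makes the
    coefficient of z^j constant and that of z^(j - 1) affine in s. *)
Lemma hform_dehomogenize j C (p : 'rV[K]_3 -> K) : hform j C p ->
  exists Q : {poly {poly K}}, (forall s z, p (row3 1 s z) = (Q.[z%:P]).[s]) /\
    forall i, (size (Q`_i)%R <= j.+1 - i)%N.
Proof.
elim: j C p => [|j IH] C p.
  move=> [a [_ h]]; exists a%:P%:P; split=> [s z|i]; first by rewrite h !hornerC.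
  by rewrite coefC; case: i => [|i] /=; rewrite ?size_poly0 // size_polyC; case: eqP.
move=> [c [q [hq _ hp]]].
have /choice[Q hQ] : forall i : 'I_3, exists Q : {poly {poly K}},
    (forall s z, q i (row3 1 s z) = (Q.[z%:P]).[s]) /\
    forall i, (size (Q`_i)%R <= j.+1 - i)%N by move=> i; apply: IH (hq i).
pose i2 : 'I_3 := lift 0 (lift 0 0).
exists (Q 0 + 'X%:P * Q 1 + Q i2 * 'X); split=> [s z|i].
  rewrite hp !big_ord_recl big_ord0 addr0 !mxE /= mul1r addrA.
  have -> : lift ord0 ord0 = 1 :> 'I_3 by apply: val_inj.
  rewrite !(hQ _).1 !(hornerD, hornerM, hornerX, hornerC).
  by rewrite [z * _]mulrC.
have h0 := (hQ 0).2 i; have h1 := (hQ 1).2 i; have h2 := (hQ i2).2 i.-1.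
rewrite !coefD coefCM coefMX.
apply: leq_trans (size_polyD _ _) _; rewrite geq_max; apply/andP; split.
  apply: leq_trans (size_polyD _ _) _; rewrite geq_max; apply/andP; split.
    by apply: leq_trans h0 _; lia.
  have [->|Q10] := eqVneq (Q 1)`_i 0; first by rewrite mulr0 size_poly0.
  rewrite mulrC size_mulX //; move: Q10; rewrite -size_poly_gt0.
  by move: (size (Q 1)`_i) h1 => b; lia.
case: i h0 h1 h2 => [|i] _ _ /=; first by rewrite size_poly0.
by move=> h2; apply: leq_trans h2 _; lia.
Qed.

End Cone.

(** * From all generic lines to the equation of the cone *)

Section Classification.
Variable R : realType.
Notation K := R[i].
Variables (P : 'M[K]_(3, 2)) (l : 'cV[K]_3) (E : 'M[K]_(2, 3)) (w : 'rV[K]_3).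
Hypotheses (EP : E *m P = 1%:M) (El : E *m l = 0) (wP : w *m P = 0) (wl : w *m l = 1%:M).
Hypothesis PE : P *m E + l *m w = 1%:M.

Definition point3 (a b c : K) : 'rV[K]_3 := (\row_j [:: a; b]`_j) *m E + c *: w.

Lemma point3P a b c : point3 a b c *m P = \row_j [:: a; b]`_j.
Proof. by rewrite mulmxDl -mulmxA EP mulmx1 -scalemxAl wP scaler0 addr0. Qed.

Lemma point3l a b c : (point3 a b c *m l) 0 0 = c.
Proof. by rewrite mulmxDl -mulmxA El mulmx0 add0r -scalemxAl wl !mxE mulr1. Qed.

Lemma point3K (x : 'rV[K]_3) : point3 ((x *m P) 0 0) ((x *m P) 0 1) ((x *m l) 0 0) = x.
Proof.
rewrite /point3.
have -> : \row_j [:: (x *m P) 0 0; (x *m P) 0 1]`_j = x *m P.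
  by apply/rowP => j; case: (ord2_cases j) => ->; rewrite mxE.
have -> : (x *m l) 0 0 *: w = (x *m l) *m w by rewrite {2}[x *m l]mx11_scalar mul_scalar_mx.
by rewrite -!mulmxA -mulmxDr PE mulmx1.
Qed.

Lemma plane_point_point3 s z : plane_point E w s 1 z = point3 1 s z.
Proof.
rewrite /plane_point /point3 scale1r; congr (_ *m _ + _); apply/rowP => j.
by case: (ord2_cases j) => ->; rewrite !mxE.
Qed.

Definition linear_form (a b c : K) : 'cV[K]_3 := a *: col 0 P + b *: col 1 P + c *: l.

Lemma linear_formE (x : 'rV[K]_3) a b c : (x *m linear_form a b c) 0 0 =
  a * (x *m P) 0 0 + b * (x *m P) 0 1 + c * (x *m l) 0 0.
Proof.
by rewrite !mulmxDr -!scalemxAr !mxE; do 2 congr (_ + _); congr (_ * _);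
  apply: eq_bigr => i _; rewrite !mxE.
Qed.

Lemma linear_form_point3 a b c a' b' c' :
  (point3 a b c *m linear_form a' b' c') 0 0 = a' * a + b' * b + c' * c.
Proof. by rewrite linear_formE point3P point3l !mxE. Qed.

Lemma linear_form_neq0 a b c : (a, b, c) != (0, 0, 0) -> linear_form a b c != 0.
Proof.
apply: contraNneq => h; have e x y z : a * x + b * y + c * z = 0.
  by rewrite -linear_form_point3 h mulmx0 mxE.
have := e 1 0 0; have := e 0 1 0; have := e 0 0 1.
by rewrite !mulr0 !mulr1 ?add0r !addr0 => -> -> ->.
Qed.

Lemma hform_linear n (u : 'cV[K]_n) : exists C, hform 1 C (fun x => (x *m u) 0 0).
Proof. by eexists; apply: hform_mulmx (hform_coord R 0). Qed.

Lemma chart_eq m C C' (H T : 'rV[K]_3 -> K) : hform m C H -> hform m C' T ->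
  (forall s z, H (point3 1 s z) = T (point3 1 s z)) -> H =1 T.
Proof.
move=> hH hT h.
pose B : 'M[K]_3 := \matrix_(i, j) [:: E 0 j; E 1 j; w 0 j]`_i.
have rowB a b c : row3 a b c *m B = point3 a b c.
  rewrite row3_mulmx; apply/rowP => j; rewrite !mxE big_ord_recl big_ord1 !mxE /=.
  by congr (_ + _ * E _ _ + _); apply: val_inj.
have rowE (y : 'rV[K]_3) : y = row3 (y 0 0) (y 0 1) (y 0 (lift 0 (lift 0 0))).
  by apply/rowP => -[[|[|[|j]]] hj] //; rewrite mxE; congr (y _ _); apply: val_inj.
have e : (fun y => H (y *m B)) =1 (fun y => T (y *m B)).
  apply: (hform_eq_chart (i := 0) (hform_mulmx B hH) (hform_mulmx B hT)) => y y0.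
  by rewrite [y]rowE y0 rowB.
by move=> x; have := e (row3 ((x *m P) 0 0) ((x *m P) 0 1) ((x *m l) 0 0)); rewrite rowB point3K.
Qed.

Variables (m : nat) (C : R) (H : 'rV[K]_3 -> K) (d : {poly K}).
Hypotheses (hH : hform m C H) (H0 : exists x, H x != 0) (d0 : d != 0).
Hypothesis tangent : forall s, d.[s] != 0 -> exists h : {poly K},
  (forall z, H (point3 1 s z) = h.[z]) /\
  ((size h <= 1)%N \/ exists c lam, c != 0 /\ h = c *: ('X - lam%:P) ^+ m).

Lemma power_case (A : K) (L : {poly K}) : A != 0 -> (size L <= 2)%N ->
  (forall s z, H (point3 1 s z) = A * (z - L.[s]) ^+ m) -> multiple_line m H.
Proof.
move=> A0 sL h; pose u := linear_form (- L`_0) (- L`_1) 1.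
exists A, u; split=> //.
  by apply: linear_form_neq0; rewrite xpair_eqE oner_eq0 andbF.
have [Cu hu] := hform_linear u.
have hT := hformZ A (hformX m hu); rewrite muln1 in hT.
apply: (chart_eq hH hT) => s z; rewrite h linear_form_point3; congr (_ * _ ^+ _).
rewrite (horner_coef_wide _ sL) !big_ord_recl big_ord0 /=; ring.
Qed.

(** The linear factors of Q are homogenized. Either all the lines obtained coincide, or two of them
    differ, and their equations then force both coordinates of [p *m P] to vanish. *)
Lemma product_case (Q : {poly K}) : Q != 0 -> (size Q <= m.+1)%N ->
  (forall s z, H (point3 1 s z) = Q.[s]) ->
  multiple_line m H \/ lines_through_center P m H.
Proof.
move=> Q0 sQ h; have [r QE] := closed_field_poly_normal Q.
set b := lead_coef Q in QE; have b0 : b != 0 by rewrite lead_coef_eq0.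
have sr : (size r <= m)%N by move: sQ; rewrite QE size_scale // size_prod_XsubC.
(* A pair (a, b) stands for the form a x1 + b x2. The degree missing in Q is made up by the line x1
   = 0, invisible in the chart x1 = 1. *)
pose L := nseq (m - size r) (1, 0) ++ [seq (- z, 1) | z <- r] : seq (K * K).
pose lf (ab : K * K) := linear_form ab.1 ab.2 0.
have sL : size L = m by rewrite size_cat size_nseq size_map subnK.
have hprod (S : seq (K * K)) : exists C, hform (size S) C (fun x => \prod_(ab <- S) (x *m lf ab) 0 0).
  elim: S => [|ab S [CS hS]].
    by exists 1, 1; rewrite nm1; split=> // x; rewrite big_nil.
  have [Cu hu] := hform_linear (lf ab); exists (Cu * CS).
  by apply: hform_ext (hformM hu hS) _ => x; rewrite big_cons.
have HE x : H x = b * \prod_(ab <- L) (x *m lf ab) 0 0.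
  have [CL hL] := hprod L; rewrite sL in hL.
  apply: (chart_eq hH (hformZ b hL)) => {x} s z; rewrite h {1}QE hornerZ horner_prod.
  rewrite big_cat big_map big_nseq /=; congr (_ * _).
  have -> : iter (m - size r) ( *%R ((point3 1 s z *m lf (1, 0)) 0 0)) 1 = 1.
    elim: (m - size r)%N => [//|k IH]; rewrite iterS IH linear_form_point3 /=; ring.
  rewrite mul1r; apply: eq_bigr => a _; rewrite linear_form_point3 !hornerE /=; ring.
have L_elt ab : ab \in L -> ab = (1, 0) \/ exists a, ab = (- a, 1).
  rewrite mem_cat => /orP[|/mapP[a _ ->]]; last by right; exists a.
  by rewrite mem_nseq => /andP[_ /eqP ->]; left.
have lf0 ab : ab \in L -> lf ab != 0.
  by move=> /L_elt[->|[a ->]]; apply: linear_form_neq0; rewrite !xpair_eqE /= oner_eq0 ?andbF.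
(* The default only matters for m = 0: [L] is then empty, and any nonzero form to the power 0 will
   do. *)
pose ab0 := head (1, 0) L.
have ab0L : ab0 = (1, 0) \/ ab0 \in L.
  by rewrite /ab0; case: (L) => [|ab S]; [left|right; rewrite /= mem_head].
have [/all_pred1P LE|/allPn[ab1 ab1L ab10]] := boolP (all (pred1 ab0) L).
  left; exists b, (lf ab0); split=> //.
    case: ab0L => [->|/lf0 //].
    by apply: linear_form_neq0; rewrite !xpair_eqE /= oner_eq0.
  move=> x; rewrite HE LE sL big_nseq; congr (_ * _).
  by elim: (m) => [|k IH]; rewrite ?expr0 // iterS IH exprS.
have ab0L' : ab0 \in L.
  by move: ab1L; rewrite /ab0; case: (L) => //= ab S _; rewrite mem_head.
right; exists b, (fun i : 'I_m => lf (nth (1, 0) L i)); split=> //.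
- by move=> i; apply/lf0/mem_nth; rewrite sL.
- by move=> x; rewrite HE (big_nth (1, 0)) big_mkord sL.
move=> p; split=> [hp|hp i]; last first.
  apply/matrixP => i' j'; rewrite !ord1 [in RHS]mxE linear_formE hp !mxE.
  by rewrite !mulr0 mul0r !addr0.
have hL ab : ab \in L -> ab.1 * (p *m P) 0 0 + ab.2 * (p *m P) 0 1 = 0.
  move=> abL; have iL : (index ab L < m)%N by rewrite -sL index_mem.
  have /matrixP/(_ 0 0) := hp (Ordinal iL).
  by rewrite /= nth_index // linear_formE mul0r addr0 => ->; rewrite mxE.
suff [y0 y1] : (p *m P) 0 0 = 0 /\ (p *m P) 0 1 = 0.
  by apply/rowP => j; case: (ord2_cases j) => ->; rewrite [RHS]mxE.
have h0 := hL _ ab0L'; have h1 := hL _ ab1L.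
(* The pairs are normalized as (1, 0) or (-a, 1), so distinct ones are independent; Cramer's rule
   concludes. *)
have /eqP det0 : ab0.1 * ab1.2 - ab0.2 * ab1.1 != 0.
  case: (L_elt _ ab0L') (L_elt _ ab1L) ab10 => [->|[a ->]] [->|[a' ->]] /=.
  - by rewrite eqxx.
  - by rewrite mulr1 mul0r subr0 oner_eq0.
  - by rewrite mulr0 mul1r sub0r oppr_eq0 oner_eq0.
  - rewrite xpair_eqE eqxx andbT mulr1 mul1r opprK addrC => a'a.
    by rewrite subr_eq0 eq_sym -eqr_opp eq_sym.
set y0 := (p *m P) 0 0 in h0 h1 *; set y1 := (p *m P) 0 1 in h0 h1 *.
split; apply/eqP; [have e : (ab0.1 * ab1.2 - ab0.2 * ab1.1) * y0 = 0|have e : (ab0.1 * ab1.2 - ab0.2 * ab1.1) * y1 = 0].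
- have -> : (ab0.1 * ab1.2 - ab0.2 * ab1.1) * y0 =
    ab1.2 * (ab0.1 * y0 + ab0.2 * y1) - ab0.2 * (ab1.1 * y0 + ab1.2 * y1) by ring.
  by rewrite h0 h1 !mulr0 subrr.
- by move/eqP: e; rewrite mulf_eq0 => /orP[/eqP/det0|].
- have -> : (ab0.1 * ab1.2 - ab0.2 * ab1.1) * y1 =
    ab0.1 * (ab1.1 * y0 + ab1.2 * y1) - ab1.1 * (ab0.1 * y0 + ab0.2 * y1) by ring.
  by rewrite h0 h1 !mulr0 subrr.
- by move/eqP: e; rewrite mulf_eq0 => /orP[/eqP/det0|].
Qed.

Lemma lead_exp_XsubC k (lam : K) : (('X - lam%:P) ^+ k)`_k = 1.
Proof.
by have /monicP := monic_exp k (monicXsubC lam); rewrite lead_coefE size_exp_XsubC.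
Qed.

Lemma coef_exp_XsubC k (lam : K) : (('X - lam%:P) ^+ k.+1)`_k = - (k.+1%:R * lam).
Proof.
elim: k => [|k IH]; first by rewrite expr1 coefB coefX coefC sub0r mul1r.
rewrite exprS mulrBl coefB coefXM coefCM /= IH lead_exp_XsubC -[k.+2%:R]natr1; ring.
Qed.

Lemma cone_classification : multiple_line m H \/ lines_through_center P m H.
Proof.
have [Q [hQ sQ]] := hform_dehomogenize (hform_mulmx
  (\matrix_(i < 3, j < 3) [:: E 0 j; E 1 j; w 0 j]`_i) hH).
have {}hQ s z : H (point3 1 s z) = (Q.[z%:P]).[s].
  rewrite -hQ; congr H; rewrite row3_mulmx; apply/rowP => j.
  rewrite !mxE big_ord_recl big_ord1 !mxE /=.
  by congr (_ + _ * E _ _ + _); apply: val_inj.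
have Qhigh i : (m < i)%N -> Q`_i = 0 :> {poly K}.
  move=> mi; apply/eqP; rewrite -size_poly_eq0 -leqn0; apply: leq_trans (sQ i) _; lia.
have QE s z : (Q.[z%:P]).[s] = \sum_(i < m.+1) (Q`_i).[s] * z ^+ i.
  have sQm : (size Q <= m.+1)%N by apply/leq_sizeP => i; exact: Qhigh.
  rewrite (horner_coef_wide _ sQm).
  by rewrite horner_sum; apply: eq_bigr => i _; rewrite hornerM -polyC_exp hornerC.
have coefE s : d.[s] != 0 -> exists h : {poly K}, (forall i, (i <= m)%N -> h`_i = (Q`_i).[s]) /\
  ((size h <= 1)%N \/ exists c lam, c != 0 /\ h = c *: ('X - lam%:P) ^+ m).
  move=> /tangent[h [hE hc]]; exists h; split=> // i im.
  have -> : h = \poly_(i < m.+1) (Q`_i).[s].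
    apply/eqP; rewrite -subr_eq0; apply/eqP/poly_eval_eq0 => z.
    by rewrite hornerD hornerN -hE hQ QE horner_poly subrr.
  by rewrite coef_poly ltnS im.
have [m0|m0] := posnP m.
  have [_ hconst] : True /\ forall s z, H (point3 1 s z) = (Q`_0).[s].
    by split=> // s z; rewrite hQ QE m0 big_ord1 mulr1.
  have sQ0 : (size (Q`_0)%R <= m.+1)%N by apply: leq_trans (sQ _) _.
  have [Q0|Q0] := eqVneq Q`_0 0; last exact: product_case Q0 sQ0 hconst.
  have [x /eqP[]] := H0.
  by rewrite (chart_eq hH (hform0 _ _ m)) // => s z; rewrite hconst Q0 horner0.
have [Qm|Qm] := eqVneq Q`_m 0.
  have Qi i : (0 < i <= m)%N -> Q`_i = 0.
    move=> /andP[i0 im]; apply: (vanish_off_roots d0) => s /coefE[h [hE hc]].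
    rewrite -hE //; case: hc => [/leq_sizeP -> //|[c [lam [c0 hl]]]].
    have := hE m (leqnn m); rewrite Qm horner0 hl coefZ.
    by rewrite lead_exp_XsubC mulr1 => c00; rewrite c00 eqxx in c0.
  have hconst s z : H (point3 1 s z) = (Q`_0).[s].
    rewrite hQ QE big_ord_recl mulr1 big1 ?addr0 // => i _.
    by rewrite Qi ?horner0 ?mul0r //= ltn_ord.
  have sQ0 : (size (Q`_0)%R <= m.+1)%N by apply: leq_trans (sQ _) _.
  have [Q0|Q0] := eqVneq Q`_0 0; last exact: product_case Q0 sQ0 hconst.
  have [x /eqP[]] := H0.
  by rewrite (chart_eq hH (hform0 _ _ m)) // => s z; rewrite hconst Q0 horner0.
left; pose A := (Q`_m)`_0.
have QmE : Q`_m = A%:P.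
  by apply: size1_polyC; apply: leq_trans (sQ m) _; rewrite subSnn.
have A0 : A != 0 by apply: contraNneq Qm => A0; rewrite QmE A0.
have mA0 : m%:R * A != 0 by rewrite mulf_neq0 // pnatr_eq0 -lt0n.
(* The m-fold root as a function of s: the coefficient of z^(m - 1) in A (z - lam)^m is - m A
   lam. *)
pose L := - (m%:R * A)^-1 *: Q`_m.-1.
have sL : (size L <= 2)%N.
  by apply: leq_trans (size_scale_leq _ _) _; apply: leq_trans (sQ _) _; lia.
apply: (power_case A0 sL) => s z.
(* For fixed z this is an identity of polynomials in s; it only has to be checked where [d] does not
   vanish. *)
have zero : \sum_(i < m.+1) z ^+ i *: Q`_i - A *: (z%:P - L) ^+ m = 0.
  apply: (vanish_off_roots d0) => {}s /coefE[h [hE hc]].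
  have hm : h`_m = A by rewrite hE // QmE hornerC.
  case: hc => [sh|[c [lam [c0 hl]]]].
    have /leq_sizeP/(_ m m0) := sh; rewrite hm => A00.
    by rewrite A00 eqxx in A0.
  have cA : c = A by rewrite -hm hl coefZ lead_exp_XsubC mulr1.
  have lamE : L.[s] = lam.
    have cm : (('X - lam%:P) ^+ m)`_m.-1 = - (m%:R * lam).
      by move: m0; case: (m) => // k _; apply: coef_exp_XsubC.
    rewrite hornerZ -hE ?leq_pred // hl cA coefZ cm.
    by field; rewrite A0 pnatr_eq0 -lt0n m0.
  rewrite hornerD hornerN horner_sum hornerZ horner_exp hornerD hornerN hornerC lamE.
  have -> : \sum_(i < m.+1) (z ^+ i *: Q`_i).[s] = h.[z].
    have sh : (size h <= m.+1)%N.
      by rewrite hl; apply: leq_trans (size_scale_leq _ _) _; rewrite size_exp_XsubC.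
    rewrite (horner_coef_wide _ sh); apply: eq_bigr => i _.
    by rewrite hornerZ hE -1?ltnS // mulrC.
  by rewrite hl cA hornerZ horner_exp hornerXsubC subrr.
have := congr1 (fun q : {poly K} => q.[s]) zero.
rewrite horner0 hornerD hornerN horner_sum hornerZ horner_exp hornerD hornerN hornerC.
move/eqP; rewrite subr_eq0 => /eqP <-; rewrite hQ QE.
by apply: eq_bigr => i _; rewrite hornerZ mulrC.
Qed.

End Classification.

(** * Change of reduced equation and conclusion *)

Section Main.
Variable R : realType.
Notation K := R[i].

(** Each equation divides the other, so f (1 - q q') = 0 near 0. If q(0) were 0, then |q q'| <= 1/2
    near 0 and f would be the zero germ. *)
Lemma reduced_equations_proportional n (X : set 'rV[K]_n) (f g : 'rV[K]_n -> K) :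
  reduced_equation X f -> reduced_equation X g ->
  exists q, [/\ analytic q, q 0 != 0 & near0 (fun x => g x = f x * q x)].
Proof.
move=> [fan fn0 fX fdiv] [gan gn0 gX gdiv].
have [q /analytic_germ_analytic qan hq] : divides_germ f g.
  by apply: fdiv => //; apply: near0_imp (gX : near0 _) _ => x h /h.
have [q' /analytic_germ_analytic qan' hq'] : divides_germ g f.
  by apply: gdiv => //; apply: near0_imp (fX : near0 _) _ => x h /h.
exists q; split=> //; apply/negP => /eqP q0; apply: fn0.
have half0 : 0 < 2^-1 :> R by rewrite invr_gt0.
have qq0 : q 0 * q' 0 = 0 by rewrite q0 mul0r.
have small := analytic_small (analyticM qan qan') qq0 half0.
apply: near0_imp (near0_and (near0_and (hq : near0 _) (hq' : near0 _)) small) _.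
move=> x [[e e'] hs]; apply/eqP/negPn/negP => fx.
have /eqP : f x * (1 - q x * q' x) = 0 by rewrite mulrBr mulr1 mulrA -e -e' subrr.
rewrite mulf_eq0 (negPf fx) subr_eq0 => /eqP one.
by move: hs; rewrite -one nm1; lra.
Qed.

Lemma multiple_lineZ m (H : 'rV[K]_3 -> K) (c : K) : c != 0 ->
  multiple_line m (fun x => c * H x) -> multiple_line m H.
Proof.
move=> c0 [b [u [b0 u0 h]]]; exists (c^-1 * b), u; split=> //.
  by rewrite mulf_neq0 // invr_eq0.
by move=> x; rewrite -mulrA -h mulKf.
Qed.

Lemma lines_through_centerZ (P : 'M[K]_(3, 2)) m (H : 'rV[K]_3 -> K) (c : K) : c != 0 ->
  lines_through_center P m (fun x => c * H x) -> lines_through_center P m H.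
Proof.
move=> c0 [b [u [b0 u0 h hP]]]; exists (c^-1 * b), u; split=> //.
  by rewrite mulf_neq0 // invr_eq0.
by move=> x; rewrite -mulrA -h mulKf.
Qed.

End Main.

Theorem corollary5p6 (R : realType) (X : set 'rV[R[i]]_3)
    (P : 'M[R[i]]_(3, 2)) (D : set 'rV[R[i]]_2)
    (m : nat) (H : 'rV[R[i]]_3 -> R[i])
    (hX : surface_germ X)
    (hP : \rank P = 2%N)
    (hfin : finite_projection X P)
    (hD : is_discriminant X P D)
    (hH : tangent_cone_equation X m H)
    (hirr : generic_arc_section_irreducible X P D) :
  multiple_line m H \/ lines_through_center P m H.
Proof.
have [X0 _] := hX.
have [l [n [F [hr hF hred hDn]]]] := hD.
have [g gred /initial_formP[[C hC] [x0 Hx0] lead]] := hH.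
have [q [qan q0 hq]] := reduced_equations_proportional gred hred.
have [E [w [EP El wP wl PE]]] := coordinates hr.
have danal := discriminant_analytic hF.
have [dm [Hd hd]] := initial_form_exists danal (reduced_discriminant_neq0 X0 hr hF hred).
have [[Cd hCd] Hd0 _] := initial_formP hd.
have [d d0 hdir] := good_directions hCd Hd0.
(* The Weierstrass equation has initial form q(0) H; the classification is carried out for this
   form, and the nonzero constant removed at the end. *)
have hqH := hformZ (q 0) hC.
have leadF : leading (fun x => (F (x *m P)).[(x *m l) 0 0]) m (fun x => q 0 * H x).
  by apply: leading_near (leading_mul hC lead qan); apply: near0_imp hq _ => x ->.
have [fan _ fX _] := hred.
have [_ _ han _] := hF.
have /choice[p hp] : forall i, exists p, expands (fun y => (F y)`_i) p.
  by move=> i; apply/analytic_germ_analytic/han.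
have tangent s : d.[s] != 0 -> exists h : {poly R[i]},
    (forall z, q 0 * H (point3 E w 1 s z) = h.[z]) /\
    ((size h <= 1)%N \/ exists c lam, c != 0 /\ h = c *: ('X - lam%:P) ^+ m).
  move=> /hdir hs.
  have irr := section_irreducible EP El wP wl hF (analytic_germ_analytic fan) fX hDn danal hd hirr hs.
  exists (tangent_poly n s p m); split; last first.
    exact: (tangent_dichotomy EP El wP wl hF hp hqH leadF irr).
  move=> z; rewrite -plane_point_point3.
  exact: (tangent_polyE s EP El wP wl hF hp hqH leadF).
have qH0 : exists x, q 0 * H x != 0 by exists x0; rewrite mulf_neq0.
case: (cone_classification EP El wP wl PE hqH qH0 d0 tangent).
  by left; apply: multiple_lineZ q0 _.
by right; apply: lines_through_centerZ q0 _.
Qed.
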